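(* Let $X_i=(X_{i1},\dots,X_{ip})'$, $i\in\{1,\dots,n\}$, be random vectors in $\mathbb{R}^p$ where the $X_{ij}$ are all i.i.d. Assume that $\mathbf{E}X_{11}=0$, $\mathbf{E}X_{11}^2=1$, $\mathbf{E}|X_{11}|^3<\infty$ and $\mathbf{E}X_{11}^3>0$. If $\log p=o(n^{1/3})$ and $\sqrt n=o\big(p(\log p)^{3/2}\big)$ as $n\to\infty$, then $$\liminf_{n\to\infty}\sqrt{\frac{n}{(\log p)^3}}\;\tau_{n,\mathcal{A}^{\max}}>0.$$
   Context: $p=p_n$ is a sequence of positive integers depending on $n$; the law of $X_{11}$ does not depend on $n$. $T_n=(T_{n1},\dots,T_{np})'$ with $T_{nj}=\sum_{i=1}^n X_{ij}\big/\sqrt{\sum_{i=1}^n X_{ij}^2}$ (with $0/0:=0$). $Z$ is a standard Gaussian vector in $\mathbb{R}^p$ (mean $0$, identity covariance). $\mathcal{A}^{\max}=\{(-\infty,t]\times\cdots\times(-\infty,t]\subset\mathbb{R}^p: t\in\mathbb{R}\}$ and $\tau_{n,\mathcal{A}^{\max}}=\sup_{A\in\mathcal{A}^{\max}}|\mathbf{P}(T_n\in A)-\mathbf{P}(Z\in A)|$. *)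

(* Defs.v *)
From HB Require Import structures.
From mathcomp Require Import all_boot all_order all_algebra.
From mathcomp Require Import all_classical all_reals all_analysis.

Set Implicit Arguments.
Unset Strict Implicit.
Unset Printing Implicit Defensive.

Import Order.TTheory GRing.Theory Num.Theory.
Import numFieldNormedType.Exports.

Local Open Scope classical_set_scope.
Local Open Scope ring_scope.

(* Only Borel sets are compared: the values of a measure on non-measurable
   sets carry no information. *)
Definition has_law d (T : measurableType d) (R : realType)
    (P : probability T R) (X : {RV P >-> R})
    (mu : probability (measurableTypeR R) R) : Prop :=
  forall B : set (measurableTypeR R), measurable B -> distribution P X B = mu B.

Definition independent_RVs d (T : measurableType d) (R : realType)
    (P : probability T R) (I : finType) (X : I -> {RV P >-> R}) : Prop :=
  forall (J : {set I}) (B : I -> set (measurableTypeR R)),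
    (forall i, measurable (B i)) ->
    P (\bigcap_(i in [set` J]) (X i @^-1` B i)) =
    (\prod_(i in J) P (X i @^-1` B i))%E.

Definition iid_with_law d (T : measurableType d) (R : realType)
    (P : probability T R) (I : finType) (X : I -> {RV P >-> R})
    (mu : probability (measurableTypeR R) R) : Prop :=
  independent_RVs X /\ forall i, has_law (X i) mu.

(* The standard Gaussian vector of R^p has independent N(0, 1) coordinates; the
   second parameter of normal_prob is the standard deviation. *)
Definition standard_gaussian_vector d (T : measurableType d) (R : realType)
    (P : probability T R) (p : nat) (Z : 'I_p -> {RV P >-> R}) : Prop :=
  iid_with_law Z (normal_prob 0 1).

(* The convention 0/0 := 0 is the library's: if all x_ij vanish for a given j,
   the denominator is 0 and its inverse is 0. *)
Definition self_normalized_sum (R : realType) (n p : nat)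
    (x : 'I_n -> 'I_p -> R) : 'rV[R]_p :=
  \row_j ((\sum_(i < n) x i j) / Num.sqrt (\sum_(i < n) x i j ^+ 2)).

Definition Amax (R : realType) (p : nat) : set (set 'rV[R]_p) :=
  [set A | exists t : R, A = [set x : 'rV[R]_p | forall j, x 0 j <= t]].

Definition sup_distance (R : realType) (p : nat) (AA : set (set 'rV[R]_p))
    d (T : measurableType d) (P : probability T R) (S : T -> 'rV[R]_p)
    d' (T' : measurableType d') (Q : probability T' R) (W : T' -> 'rV[R]_p)
    : \bar R :=
  ereal_sup [set `|P (S @^-1` A) - Q (W @^-1` A)|%E | A in AA].

(* Main.v *)
(* Write L = log p and let x be the Gaussian quantile of level 1 - 1/p, so that
   x^2 is of order L, and let F be the distribution function of one coordinate
   of T_n. By independence the two probabilities of (-oo, x]^p are F(x)^p and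
   (1 - 1/p)^p. A positive third moment makes a self-normalized sum less likely
   than a Gaussian to exceed x: its tail is at most
   (1/p)(1 - c x^3 / sqrt n). Hence the two powers differ by at least a constant
   times x^3 / sqrt n >= sqrt (L^3 / n). The hypothesis log p = o(n^(1/3)) says
   that x^3 / sqrt n -> 0, and the other one is used only for p -> oo.

   For the tail bound put b = x / sqrt n and tilt the law mu of the entries by
   exp (b y - b^2 y^2 / 2). The total mass m of the tilt is
   1 - E[X^3] b^3 / 6 + o(b^3), because the second-order terms cancel, and m^n is
   the source of the factor 1 - c x^3 / sqrt n. When the sum of squares is within
   n / x of n, the tail is m^n exp (- x^2 / 2) E[exp (- x M); M > 0] up to small
   errors, where M is a nearly additive statistic of the tilted sample, and
   Stein's method compares that expectation with its Gaussian counterpart. Other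
   values of the sum of squares are discarded by tilting with a different
   quadratic coefficient: 1 below n, and 1/4 on the geometric scales above n,
   where the square root is bounded below by its chords. *)
Require Import Defs.
From HB Require Import structures.
From mathcomp Require Import all_boot all_order all_algebra.
From mathcomp Require Import all_classical all_reals all_analysis.
From mathcomp Require Import measurable_realfun.
From mathcomp Require Import ring lra.

Set Implicit Arguments.
Unset Strict Implicit.
Unset Printing Implicit Defensive.

Import Order.TTheory GRing.Theory Num.Theory.
Import numFieldNormedType.Exports.

Local Open Scope classical_set_scope.
Local Open Scope ring_scope.

(** * Real-valued integrals *)

(** The cubic gain is of order x^3 / sqrt n relative to the Gaussian tail, while every approximation
    error is of order (x / sqrt n) exp (- x^2 / 2), that is x^2 / sqrt n relative to the same tail.
    The spare factor x is what makes crude absolute constants sufficient once x is large. No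
    expansion of the tail is needed either: for a standard Gaussian Z, the expectation of exp (- x
    Z) over Z > 0 equals exp (x^2 / 2) times the tail at x, so the main term is m^n times that tail
    exactly. The tilt repairs this: its weight absorbs powers of b y, so a fourth power of y under
    the tilted law costs one factor 1 / b = sqrt n / x, which is just affordable. A sample enters
    only through its sum and its sum of squares; a recursively defined law of this pair replaces
    n-fold product spaces, and exchangeability becomes an identity between integrals against it. *)

Ltac mfun_step := lazymatch goal with
  | |- measurable_fun _ (fun _ => ?c) => exact: measurable_cst
  | |- measurable_fun _ (fun x => x) => exact: measurable_id
  | |- measurable_fun _ (fun x => (@?f x + @?g x)%R) =>
      apply: (@measurable_funD _ _ _ _ f g)
  | |- measurable_fun _ (fun x => (@?f x * @?g x)%R) =>
      apply: (@measurable_funM _ _ _ _ f g)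
  | |- measurable_fun _ (fun x => (- @?f x)%R) =>
      apply: (@measurable_funN _ _ _ _ f)
  | |- measurable_fun _ (fun x => (@?f x ^+ ?n)%R) =>
      apply: (@measurable_funX _ _ _ _ f n)
  | |- measurable_fun _ (fun x => `|@?f x|%R) =>
      apply: (measurableT_comp (g := f) (@normr_measurable _ setT))
  | |- measurable_fun _ (fun x => expR (@?f x)) =>
      apply: (@measurableT_comp _ _ _ _ _ _ (@expR _) _ f);
      first exact: measurable_expR
  | |- measurable_fun _ (fun x => Num.min (@?f x) (@?g x)) =>
      apply: (@measurable_minr _ _ _ _ f g)
  | |- measurable_fun _ (fun x => Num.max (@?f x) (@?g x)) =>
      apply: (@measurable_maxr _ _ _ _ f g)
  | |- measurable_fun _ (fun x => (@?f x, @?g x)) =>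
      apply: (@measurable_fun_pair _ _ _ _ _ _ f g)
  | |- measurable_fun _ (fun x => (@?f x).1) =>
      apply: (@measurableT_comp _ _ _ _ _ _ fst _ f);
      first exact: measurable_fst
  | |- measurable_fun _ (fun x => (@?f x).2) =>
      apply: (@measurableT_comp _ _ _ _ _ _ snd _ f);
      first exact: measurable_snd
  | |- measurable_fun _ (fun x => EFin (@?f x)) => apply/measurable_EFinP
  | |- measurable_fun _ (EFin \o _) => apply/measurable_EFinP
  | |- measurable_fun _ (fun x => (@?f x < @?g x)%R) =>
      apply: (@measurable_fun_ltr _ _ _ _ f g)
  | |- measurable_fun _ (fun x => (@?f x <= @?g x)%R) =>
      apply: (@measurable_fun_ler _ _ _ _ f g)
  | |- measurable_fun _ (fun x => (@?f x * @?g x)%E) =>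
      apply: (@emeasurable_funM _ _ _ _ f g)
  | |- measurable_fun _ (Order.lt ?a) =>
      apply: (@measurable_fun_ltr _ _ _ _ (fun=> a) id)
  | |- measurable_fun _ _ => apply: measurable_fun_ifT
  end.
Ltac mfun := rewrite /comp /=; repeat first [assumption | mfun_step].

Section Rintegration.
Context d (T : measurableType d) (R : realType).
Implicit Types f g : T -> R.

Definition integrableR (m : {measure set T -> \bar R}) (f : T -> R) :=
  m.-integrable setT (EFin \o f).

Lemma integrableR_measurable (m : {measure set T -> \bar R}) f :
  integrableR m f -> measurable_fun setT f.
Proof. by move=> /measurable_int/measurable_EFinP. Qed.

Lemma integrableR_le (m : {measure set T -> \bar R}) f g :
  measurable_fun setT f -> integrableR m g -> (forall x, `|f x| <= g x) ->
  integrableR m f.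
Proof.
move=> mf ig fg; apply: (le_integrable _ _ _ ig) => //.
  exact/measurable_EFinP.
move=> x _ /=; rewrite lee_fin (le_trans (fg x))// ler_norm //.
Qed.

Lemma eq_integrableR (m : {measure set T -> \bar R}) f g : f =1 g ->
  integrableR m f -> integrableR m g.
Proof. by move=> /funext ->. Qed.

Lemma integrableRD (m : {measure set T -> \bar R}) f g :
  integrableR m f -> integrableR m g -> integrableR m (fun x => f x + g x).
Proof. by move=> fi gi; exact: (integrableD measurableT fi gi). Qed.

Lemma integrableRZ (m : {measure set T -> \bar R}) c f :
  integrableR m f -> integrableR m (fun x => c * f x).
Proof. by move=> fi; exact: (integrableZl measurableT c fi). Qed.

Lemma integrableRB (m : {measure set T -> \bar R}) f g :
  integrableR m f -> integrableR m g -> integrableR m (fun x => f x - g x).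
Proof. by move=> fi gi; exact: (integrableB measurableT fi gi). Qed.

Lemma integrableR_norm (m : {measure set T -> \bar R}) f :
  integrableR m f -> integrableR m (fun x => `|f x|).
Proof. by move=> fi; exact: (integrable_norm fi). Qed.

Lemma integrableR_cst (P : probability T R) c : integrableR P (fun=> c).
Proof. exact: finite_measure_integrable_cst. Qed.

Lemma integrableR_bounded (P : probability T R) f c :
  measurable_fun setT f -> (forall x, `|f x| <= c) -> integrableR P f.
Proof. by move=> mf fc; apply: integrableR_le mf (integrableR_cst P c) fc. Qed.

Lemma EFin_Rintegral (m : {measure set T -> \bar R}) f : integrableR m f ->
  (\int[m]_x f x)%:E = (\int[m]_x (f x)%:E)%E.
Proof. by move=> fi; rewrite /Rintegral fineK//; exact: integrable_fin_num. Qed.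

Lemma RintD (m : {measure set T -> \bar R}) f g :
  integrableR m f -> integrableR m g ->
  \int[m]_x (f x + g x) = \int[m]_x f x + \int[m]_x g x.
Proof. by move=> *; rewrite RintegralD. Qed.

Lemma RintB (m : {measure set T -> \bar R}) f g :
  integrableR m f -> integrableR m g ->
  \int[m]_x (f x - g x) = \int[m]_x f x - \int[m]_x g x.
Proof. by move=> *; rewrite RintegralB. Qed.

Lemma RintZ (m : {measure set T -> \bar R}) c f :
  integrableR m f -> \int[m]_x (c * f x) = c * \int[m]_x f x.
Proof. by move=> *; rewrite RintegralZl. Qed.

Lemma Rint_cst (P : probability T R) c : \int[P]_x c = c.
Proof. by rewrite Rintegral_cst//= probability_setT mulr1. Qed.

Lemma le_Rint (m : {measure set T -> \bar R}) f g :
  integrableR m f -> integrableR m g -> (forall x, f x <= g x) ->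
  \int[m]_x f x <= \int[m]_x g x.
Proof. by move=> fi gi fg; apply: le_Rintegral. Qed.

Lemma Rint_norm (m : {measure set T -> \bar R}) f : integrableR m f ->
  `|\int[m]_x f x| <= \int[m]_x `|f x|.
Proof. by move=> fi; apply: le_normr_Rintegral. Qed.

Lemma integrableR_ge0 (m : {measure set T -> \bar R}) f :
  measurable_fun setT f -> (forall x, 0 <= f x) ->
  (\int[m]_x (f x)%:E < +oo)%E -> integrableR m f.
Proof.
move=> mf f0 foo; apply/integrableP; split; first exact/measurable_EFinP.
by under eq_integral do rewrite /= ger0_norm//.
Qed.

End Rintegration.

Section product_Rintegration.
Context d1 d2 (T1 : measurableType d1) (T2 : measurableType d2) (R : realType).
Variables (P1 : probability T1 R) (P2 : probability T2 R).
Local Notation PP := (P1 \x P2)%E.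

Lemma integrableR_prodM (a : T1 -> R) (c : T2 -> R) :
  integrableR P1 a -> integrableR P2 c ->
  integrableR PP (fun z => a z.1 * c z.2).
Proof.
move=> ia ic; have ma := integrableR_measurable ia.
have mc := integrableR_measurable ic.
have mac : measurable_fun setT (fun z : T1 * T2 => a z.1 * c z.2).
  by apply: measurable_funM; apply: measurableT_comp.
apply/integrableP; split; first exact/measurable_EFinP.
rewrite fubini_tonelli1//=; last 1 first.
  by apply/measurable_EFinP; apply: measurableT_comp.
rewrite /fubini_F/=.
under eq_integral => x _.
  under eq_integral do rewrite normrM EFinM.
  rewrite ge0_integralZl//; last by apply/measurable_EFinP/measurableT_comp.
  rewrite -EFin_Rintegral; last exact: integrableR_norm.
  over.
rewrite ge0_integralZr//=.
- rewrite -EFin_Rintegral; last exact: integrableR_norm.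
  by rewrite -EFinM ltry.
- exact/measurable_EFinP/measurableT_comp.
- by rewrite lee_fin Rintegral_ge0.
Qed.

(** Every section, and not just almost every one, is asked to be integrable, so that the inner
    integral agrees with the extended one at each point. *)
Lemma Rfubini (f : T1 * T2 -> R) : integrableR PP f ->
  (forall x, integrableR P2 (fun y => f (x, y))) ->
  \int[PP]_z f z = \int[P1]_x \int[P2]_y f (x, y).
Proof.
move=> fi fx; congr fine; rewrite -[LHS]integral12_prod_meas1//.
by apply: eq_integral => x _; rewrite EFin_Rintegral.
Qed.

Lemma integrableR_fubini (f : T1 * T2 -> R) : integrableR PP f ->
  (forall x, integrableR P2 (fun y => f (x, y))) ->
  integrableR P1 (fun x => \int[P2]_y f (x, y)).
Proof.
move=> fi fx; have := integrable_fubini_F fi.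
by apply: eq_integrable => // x _ /=; rewrite EFin_Rintegral.
Qed.

Lemma Rfubini2 (f : T1 * T2 -> R) : integrableR PP f ->
  (forall y, integrableR P1 (fun x => f (x, y))) ->
  \int[PP]_z f z = \int[P2]_y \int[P1]_x f (x, y).
Proof.
move=> fi fx; congr fine; rewrite -[LHS]integral21_prod_meas1//.
by apply: eq_integral => x _; rewrite EFin_Rintegral.
Qed.

Lemma Rint_prodM (a : T1 -> R) (c : T2 -> R) :
  integrableR P1 a -> integrableR P2 c ->
  \int[PP]_z (a z.1 * c z.2) = (\int[P1]_x a x) * \int[P2]_y c y.
Proof.
move=> ia ic; rewrite (Rfubini (integrableR_prodM ia ic)); last first.
  by move=> x; exact: (integrableRZ (a x) ic).
rewrite -[RHS]RintegralZr//; apply: eq_Rintegral => x _.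
exact: (RintZ (a x) ic).
Qed.

Lemma integrableR_fst (a : T1 -> R) : integrableR P1 a ->
  integrableR PP (fun z => a z.1).
Proof.
move=> ia; have := integrableR_prodM ia (integrableR_cst P2 1).
by under eq_fun do rewrite mulr1.
Qed.

Lemma integrableR_snd (a : T2 -> R) : integrableR P2 a ->
  integrableR PP (fun z => a z.2).
Proof.
move=> ia; have := integrableR_prodM (integrableR_cst P1 1) ia.
by under eq_fun do rewrite mul1r.
Qed.

Lemma Rint_fst (a : T1 -> R) : integrableR P1 a ->
  \int[PP]_z a z.1 = \int[P1]_x a x.
Proof.
move=> ia; have := Rint_prodM ia (integrableR_cst P2 1).
by rewrite Rint_cst mulr1 => <-; apply: eq_Rintegral => z _; rewrite mulr1.
Qed.

Lemma Rint_snd (a : T2 -> R) : integrableR P2 a ->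
  \int[PP]_z a z.2 = \int[P2]_x a x.
Proof.
move=> ia; have := Rint_prodM (integrableR_cst P1 1) ia.
by rewrite Rint_cst mul1r => <-; apply: eq_Rintegral => z _; rewrite mul1r.
Qed.

End product_Rintegration.

(** * Laws of sums, tilting and exchangeability *)

Section sumlaw.
Context {R : realType}.
Implicit Types (nu : probability R R) (k : nat).

Definition sum_step (z : R * (R * R)) : R * R :=
  (z.2.1 + z.1, z.2.2 + z.1 ^+ 2).

Lemma measurable_sum_step : measurable_fun setT sum_step.
Proof.
apply/measurable_fun_pairP; split => /=.
- apply: measurable_funD => //; apply: measurableT_comp => //.
- apply: measurable_funD => //; first by apply: measurableT_comp.
  by apply: measurable_funX.
Qed.

HB.instance Definition _ := isMeasurableFun.Build _ _ _ _ sum_step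
  measurable_sum_step.

(* Law of [(y_1 + ... + y_k, y_1^2 + ... + y_k^2)] for i.i.d. [y_i] of law [nu]. *)
Fixpoint sumlaw nu k : probability (R * R)%type R :=
  if k is k'.+1
  then distribution [the probability _ _ of (nu \x sumlaw nu k')%E] sum_step
  else @dirac _ (R * R)%type (0, 0) R.

Lemma sumlawSE nu k (f : R * R -> \bar R) : measurable_fun setT f ->
    (forall u, 0 <= f u)%E ->
  (\int[sumlaw nu k.+1]_u f u = \int[nu \x sumlaw nu k]_z f (sum_step z))%E.
Proof. by move=> mf f0; rewrite ge0_integral_distribution. Qed.

Lemma integrableR_sumlawS nu k (f : R * R -> R) :
  measurable_fun setT f ->
  integrableR (nu \x sumlaw nu k)%E (f \o sum_step) ->
  integrableR (sumlaw nu k.+1) f.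
Proof.
move=> mf fi; apply: integrable_pushforward => //.
exact/measurable_EFinP.
Qed.

Lemma integrableR_sumlawSW nu k (f : R * R -> R) :
  integrableR (sumlaw nu k.+1) f ->
  integrableR (nu \x sumlaw nu k)%E (f \o sum_step).
Proof.
move=> fi; have mf := integrableR_measurable fi.
have mf2 : measurable_fun setT (f \o sum_step) by exact: measurableT_comp.
apply/integrableP; split; first exact/measurable_EFinP.
move/integrableP : fi => [_]; rewrite sumlawSE//.
by apply: measurableT_comp => //; exact/measurable_EFinP.
Qed.

Lemma Rint_sumlawS nu k (f : R * R -> R) :
  integrableR (sumlaw nu k.+1) f ->
  \int[sumlaw nu k.+1]_u f u = \int[(nu \x sumlaw nu k)%E]_z f (sum_step z).
Proof.
move=> fi; have mf := integrableR_measurable fi.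
congr fine; rewrite integral_distribution//; first exact/measurable_EFinP.
exact: (integrableR_sumlawSW fi).
Qed.

Lemma sumlaw0E nu (f : R * R -> \bar R) : measurable_fun setT f ->
  (\int[sumlaw nu 0]_u f u = f (0%R, 0%R))%E.
Proof. by move=> mf; rewrite integral_dirac// diracT mul1e. Qed.

Lemma sum_stepC y y' u :
  sum_step (y, sum_step (y', u)) = sum_step (y', sum_step (y, u)).
Proof. by congr pair; rewrite /= addrAC. Qed.

End sumlaw.

(** The measure with density [h] is built directly. Integrals against it go through its
    Radon-Nikodym derivative, which equals [h] almost everywhere because both have the same integral
    over every measurable set. *)
Lemma density_probability d (T : measurableType d) (R : realType)
    (mu : probability T R) (h : T -> R) :
  (forall y, 0 <= h y) -> integrableR mu h -> \int[mu]_y h y = 1 ->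
  exists nu : probability T R, forall f : T -> \bar R, measurable_fun setT f ->
    (forall y, 0 <= f y)%E ->
    (\int[nu]_y f y = \int[mu]_y (f y * (h y)%:E))%E.
Proof.
move=> h0 ih h1.
pose nu (A : set T) : \bar R := (\int[mu]_(y in A) (h y)%:E)%E.
have nu0 : nu set0 = 0%E by rewrite /nu integral_set0.
have nu_ge0 A : (0 <= nu A)%E.
  by apply: integral_ge0 => y _; rewrite lee_fin.
have nu_sa : semi_sigma_additive nu.
  move=> A mA tA mUA; rewrite /nu integral_bigcup//; last first.
    exact: integrableS ih.
  apply: is_cvg_ereal_nneg_natsum_cond => n _ _.
  by apply: integral_ge0 => y _; rewrite lee_fin.
have nuT : nu setT = 1%E by rewrite /nu -EFin_Rintegral// h1.
pose nuM := isMeasure.Build d T R nu nu0 nu_ge0 nu_sa.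
pose nu_meas : {measure set T -> \bar R} := HB.pack nu nuM.
pose nuP := Measure_isProbability.Build d T R nu_meas nuT.
pose nu_prob : probability T R := HB.pack nu nuM nuP.
exists nu_prob => f mf f0.
have dom : nu_prob `<< mu.
  apply/null_content_dominatesP => A mA muA0.
  change (nu A = 0%E); apply: null_set_integral => //.
  apply/measurable_EFinP; apply: measurable_funTS.
  exact: (integrableR_measurable ih).
rewrite -(Radon_Nikodym_SigmaFinite.change_of_variables dom)//.
apply: ae_eq_integral => //.
- apply: emeasurable_funM => //; apply: measurable_int.
  exact: Radon_Nikodym_SigmaFinite.f_integrable.
- apply: emeasurable_funM => //; apply/measurable_EFinP.
  exact: (integrableR_measurable ih).
- apply: ae_eqe_mul2l.
  apply: integral_ae_eq => //.
  + exact: Radon_Nikodym_SigmaFinite.f_integrable.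
  + apply/measurable_EFinP; exact: (integrableR_measurable ih).
  + move=> E _ mE; rewrite -Radon_Nikodym_SigmaFinite.f_integral//.
Qed.

Section sumlaw_tilt.
Context {R : realType}.
Variables (mu nu : probability R R) (m b c : R).
Hypothesis m_ge0 : 0 <= m.
Hypothesis mu_nu : forall f : R -> \bar R, measurable_fun setT f ->
  (forall y, 0 <= f y)%E ->
  (\int[mu]_y f y = \int[nu]_y (f y * (m * expR (- (b * y - c * y ^+ 2)))%:E))%E.

(** The density of one entry is the exponential of a combination of [y] and [y ^+ 2], so the product
    of [k] densities is a function of the two sums alone. *)
Lemma sumlaw_tilt k (F : R * R -> \bar R) : measurable_fun setT F ->
  (forall u, 0 <= F u)%E ->
  (\int[sumlaw mu k]_u F u =
   \int[sumlaw nu k]_u (F u * (m ^+ k * expR (- (b * u.1 - c * u.2)))%:E))%E.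
Proof.
elim: k F => [|k IH] F mF F0.
  rewrite !sumlaw0E//; last by mfun.
  by rewrite /= !mulr0 subrr oppr0 expR0 expr0 mulr1 mule1.
have mE : measurable_fun setT (fun u : R * R => expR (- (b * u.1 - c * u.2))).
  by mfun.
have mFE j : measurable_fun setT
    (fun u => (F u * (m ^+ j * expR (- (b * u.1 - c * u.2)))%:E)%E).
  by mfun.
have mFs : measurable_fun setT (fun z => F (sum_step z)).
  exact: measurableT_comp.
have sec y : measurable_fun setT (fun u : R * R => F (sum_step (y, u))).
  by apply: (measurableT_comp mFs); exact: measurable_pair1.
rewrite !sumlawSE//; last first.
  by move=> u; rewrite mule_ge0// lee_fin mulr_ge0 ?expR_ge0 ?exprn_ge0.
rewrite !fubini_tonelli1//=; last 2 first.
- by apply: measurableT_comp (mFE _) _.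
- by move=> z; rewrite mule_ge0// lee_fin mulr_ge0 ?expR_ge0 ?exprn_ge0.
rewrite /fubini_F.
under eq_integral => y _ do rewrite IH//.
rewrite mu_nu//.
- apply: eq_integral => y _.
  rewrite muleC -ge0_integralZl//=.
  + apply: eq_integral => u _; rewrite muleCA; congr (_ * _)%E.
    rewrite -EFinM; congr (_%:E); rewrite mulrACA -exprS -expRD; congr (_ * expR _).
    by ring.
  + apply: emeasurable_funM => //; apply/measurable_EFinP.
    exact: measurable_funM.
  + by move=> u _; rewrite mule_ge0// lee_fin mulr_ge0 ?expR_ge0 ?exprn_ge0.
  + by rewrite lee_fin mulr_ge0 ?expR_ge0.
- apply: (@measurable_fun_fubini_tonelli_F _ _ _ _ _ (sumlaw nu k) (fun z : R * (R * R) => (F (sum_step z) * (m ^+ k * expR (- (b * z.2.1 - c * z.2.2)))%:E)%E)) => //.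
  + by mfun.
  + by move=> u; rewrite mule_ge0// lee_fin mulr_ge0 ?expR_ge0 ?exprn_ge0.
- move=> y; apply: integral_ge0 => u _.
  by rewrite mule_ge0// lee_fin mulr_ge0 ?expR_ge0 ?exprn_ge0.
Qed.

End sumlaw_tilt.

Section additive_statistics.
Context {R : realType}.
Variables (nu : probability R R) (al be ga : R).

Definition summand (y : R) : R := al * y + be * y ^+ 2 + ga.
(** The sum of [summand] over [k] entries, expressed through their sum [u.1] and sum of squares
    [u.2]. *)
Definition addstat k (u : R * R) : R := al * u.1 + be * u.2 + ga * k%:R.

Lemma addstatS k z :
  addstat k.+1 (sum_step z) = addstat k z.2 + summand z.1.
Proof. by rewrite /addstat /summand /= -natr1; ring. Qed.

Lemma measurable_summand : measurable_fun setT summand.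
Proof. by rewrite /summand; mfun. Qed.

Lemma measurable_addstat k : measurable_fun setT (addstat k).
Proof. by rewrite /addstat; mfun. Qed.

Lemma addstat0 : addstat 0 (0, 0) = 0.
Proof. by rewrite /addstat /= !mulr0 !addr0. Qed.

Lemma integrableR_sumlaw0 (f : R * R -> R) : measurable_fun setT f ->
  integrableR (sumlaw nu 0) f.
Proof.
move=> mf; apply/integrableP; split; first by mfun.
rewrite sumlaw0E//=; first exact: ltry.
by apply: measurableT_comp => //; mfun.
Qed.

Lemma Rint_sumlaw0 (f : R * R -> R) : measurable_fun setT f ->
  \int[sumlaw nu 0]_u f u = f (0, 0).
Proof. by move=> mf; rewrite /Rintegral sumlaw0E//; mfun. Qed.

Lemma integrableR_addstat k : integrableR nu summand ->
  integrableR (sumlaw nu k) (addstat k).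
Proof.
move=> gi; elim: k => [|k IH].
  by apply: integrableR_sumlaw0; exact: measurable_addstat.
apply: integrableR_sumlawS; first exact: measurable_addstat.
rewrite (_ : _ \o _ = fun z => addstat k z.2 + summand z.1).
  apply: integrableRD; first exact: integrableR_snd.
  exact: integrableR_fst.
by apply/funext => z; rewrite /= addstatS.
Qed.

Lemma Rint_addstat k : integrableR nu summand ->
  \int[sumlaw nu k]_u addstat k u = k%:R * \int[nu]_y summand y.
Proof.
move=> gi; elim: k => [|k IH].
  by rewrite Rint_sumlaw0 ?addstat0 ?mul0r//; exact: measurable_addstat.
rewrite Rint_sumlawS; last exact: integrableR_addstat.
under eq_Rintegral do rewrite addstatS.
rewrite RintD; last 2 first.
- by apply: integrableR_snd; exact: integrableR_addstat.
- exact: integrableR_fst.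
rewrite Rint_snd ?Rint_fst//; last exact: integrableR_addstat.
by rewrite IH -natr1 mulrDl mul1r.
Qed.

Lemma integrableR_summand : integrableR nu (fun y => summand y ^+ 2) ->
  integrableR nu summand.
Proof.
move=> g2; apply: (@integrableR_le _ _ _ _ _ (fun y => 1 + summand y ^+ 2)).
- exact: measurable_summand.
- by apply: integrableRD => //; exact: integrableR_cst.
- move=> y; rewrite -[summand y ^+ 2](real_normK (num_real _)).
  by have := sqr_ge0 (`|summand y| - 1); have := normr_ge0 (summand y); nra.
Qed.

Lemma integrableR_addstat2 k : integrableR nu (fun y => summand y ^+ 2) ->
  integrableR (sumlaw nu k) (fun u => addstat k u ^+ 2).
Proof.
move=> gi; have gi1 := integrableR_summand gi.
have mA j := @measurable_addstat j.
elim: k => [|k IH].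
  by apply: integrableR_sumlaw0; mfun.
apply: integrableR_sumlawS; first by mfun.
rewrite (_ : _ \o _ = fun z => (addstat k z.2 ^+ 2 +
    2 * (summand z.1 * addstat k z.2)) + summand z.1 ^+ 2).
  apply: integrableRD; first apply: integrableRD.
  - exact: (integrableR_snd _ IH).
  - by apply: integrableRZ; apply: integrableR_prodM => //;
      exact: integrableR_addstat.
  - exact: (integrableR_fst _ gi).
by apply/funext => z; rewrite /= addstatS; ring.
Qed.

Lemma Rint_addstat2 k : integrableR nu (fun y => summand y ^+ 2) ->
  \int[sumlaw nu k]_u (addstat k u ^+ 2) =
  k%:R * \int[nu]_y (summand y ^+ 2) +
  (k%:R ^+ 2 - k%:R) * (\int[nu]_y summand y) ^+ 2.
Proof.
move=> gi; have gi1 := integrableR_summand gi.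
have mA j := @measurable_addstat j.
elim: k => [|k IH].
  rewrite Rint_sumlaw0 ?addstat0; last by mfun.
  by rewrite !expr0n /= subrr !mul0r addr0.
rewrite Rint_sumlawS; last exact: integrableR_addstat2.
transitivity (\int[(nu \x sumlaw nu k)%E]_z ((addstat k z.2 ^+ 2 +
    2 * (summand z.1 * addstat k z.2)) + summand z.1 ^+ 2)).
  by apply: eq_Rintegral => z _; rewrite addstatS; ring.
have i1 := integrableR_snd nu (integrableR_addstat2 k gi).
have i2 := integrableR_prodM gi1 (integrableR_addstat k gi1).
have i3 := integrableR_fst (sumlaw nu k) gi.
rewrite RintD//; last by apply: integrableRD => //; exact: integrableRZ.
rewrite RintD//; last exact: integrableRZ.
rewrite RintZ// Rint_prodM//; last exact: integrableR_addstat.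
rewrite (Rint_snd nu (integrableR_addstat2 k gi)) (Rint_fst _ gi).
rewrite IH Rint_addstat// -natr1; ring.
Qed.

End additive_statistics.

Lemma Rint_bounded d (T : measurableType d) (R : realType)
    (P : probability T R) (f : T -> R) c :
  measurable_fun setT f -> (forall x, `|f x| <= c) -> `|\int[P]_x f x| <= c.
Proof.
move=> mf fc; have fi := integrableR_bounded P mf fc.
apply: (le_trans (Rint_norm fi)); rewrite -[leRHS](Rint_cst P).
by apply: le_Rint => //; [exact: integrableR_norm|exact: integrableR_cst].
Qed.

Section exchangeability.
Context {R : realType}.
Variables (nu : probability R R) (al be ga : R).
Local Notation g := (summand al be ga).
Local Notation A := (addstat al be ga).
Hypothesis gi : integrableR nu g.

(* Each of the k + 1 summands contributes equally to E[(sum of the g) f]. *)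
Lemma Rint_addstatM k (f : R * R -> R) c :
  measurable_fun setT f -> (forall u, `|f u| <= c) ->
  \int[sumlaw nu k.+1]_u (A k.+1 u * f u) =
  k.+1%:R * \int[(nu \x sumlaw nu k)%E]_z (g z.1 * f (sum_step z)).
Proof.
have mg := integrableR_measurable gi.
have iM d (T : measurableType d) (P : probability T R) (a h : T -> R) :
    integrableR P a -> measurable_fun setT h -> (forall x, `|h x| <= c) ->
    integrableR P (fun x => a x * h x).
  move=> ia mh hc; have ma := integrableR_measurable ia.
  apply: (@integrableR_le _ _ _ _ _ (fun x => c * `|a x|)).
  - exact: measurable_funM.
  - exact/integrableRZ/integrableR_norm.
  - by move=> x; rewrite normrM mulrC ler_wpM2r.
elim: k f => [|k IH] f mf fc.
all: have mfs : measurable_fun setT (f \o sum_step) by exact: measurableT_comp.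
all: have mfsy y : measurable_fun setT (fun u => f (sum_step (y, u)))
  by exact: (measurableT_comp mfs (measurable_pair1 _)).
all: rewrite Rint_sumlawS; last by
  apply: iM => //; exact: integrableR_addstat.
  have i1 := integrableR_fst (sumlaw nu 0) gi.
  rewrite mul1r (Rfubini (f := fun z => g z.1 * f (sum_step z))); last 2 first.
  - exact: (iM _ _ _ (fun z => g z.1) (fun z => f (sum_step z))).
  - move=> y /=; apply: integrableRZ.
    exact: integrableR_bounded (mfsy y) (fun=> fc _).
  have mA1 : measurable_fun setT (fun z => A 1 (sum_step z)).
    by apply: measurableT_comp => //; exact: measurable_addstat.
  rewrite Rfubini; last 2 first.
  - apply: iM => //.
    by apply: (integrableR_sumlawSW (f := A 1)); exact: integrableR_addstat.
  - move=> y; apply: integrableR_sumlaw0; apply: measurable_funM => //.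
    exact: (measurableT_comp mA1 (measurable_pair1 _)).
  apply: eq_Rintegral => y _; have := mfsy y.
  have := measurableT_comp mA1 (measurable_pair1 y).
  rewrite /comp /= => ? ?; rewrite !Rint_sumlaw0; [|by mfun..].
  by rewrite addstatS addstat0 add0r.
have iA := integrableR_addstat k.+1 gi.
pose PP := (nu \x sumlaw nu k.+1)%E.
have i1 : integrableR PP (fun z => A k.+1 z.2 * f (sum_step z)).
  by apply: iM => //; exact: integrableR_snd.
have i2 : integrableR PP (fun z => g z.1 * f (sum_step z)).
  by apply: iM => //; exact: integrableR_fst.
transitivity (\int[PP]_z (A k.+1 z.2 * f (sum_step z) + g z.1 * f (sum_step z))).
  by apply: eq_Rintegral => z _; rewrite addstatS mulrDl.
(* The newest entry yields one copy of the target; by induction with the newest entry frozen, the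
   older ones must yield the other [k.+1] copies. *)
rewrite RintD// -[in RHS]natr1 mulrDl mul1r; congr (_ + _).
have i1y y : integrableR (sumlaw nu k.+1)
    (fun u => A k.+1 u * f (sum_step (y, u))) by exact: iM.
have i2y y : integrableR (sumlaw nu k.+1)
    (fun u => g y * f (sum_step (y, u))).
  by apply: integrableRZ; exact: integrableR_bounded (mfsy y) (fun=> fc _).
rewrite (Rfubini i1)// (Rfubini i2)//.
(* [Phi] averages [f] over all entries but two. Its symmetry in these two is what moves the weight
   [g] from one to the other. *)
have [Phi PhiE] : {Phi : R * R -> R | Phi =
    fun p => \int[sumlaw nu k]_u f (sum_step (p.1, sum_step (p.2, u)))}.
  by eexists.
have mF3 : measurable_fun setT (fun q : (R * R) * (R * R) =>
    f (sum_step (q.1.1, sum_step (q.1.2, q.2)))).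
  apply: (measurableT_comp (g := fun q : (R * R) * (R * R) =>
    sum_step (q.1.1, sum_step (q.1.2, q.2))) mf).
  by rewrite /sum_step; mfun.
have mF3p p : measurable_fun setT (fun u => f (sum_step (p.1, sum_step (p.2, u)))).
  by have := measurableT_comp mF3 (measurable_pair1 p); rewrite /comp.
have mPhi : measurable_fun setT Phi.
  apply: (@integrableR_measurable _ _ _ (nu \x nu)%E).
  rewrite PhiE; apply: (integrableR_fubini (P2 := sumlaw nu k) (f := fun q : (R * R) * (R * R) =>
    f (sum_step (q.1.1, sum_step (q.1.2, q.2))))).
    exact: integrableR_bounded mF3 (fun=> fc _).
  move=> p; exact: integrableR_bounded (mF3p p) (fun=> fc _).
have Phic p : `|Phi p| <= c by rewrite PhiE; exact: Rint_bounded.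
have PhiC y y' : Phi (y, y') = Phi (y', y).
  by rewrite PhiE; apply: eq_Rintegral => u _ /=; rewrite sum_stepC.
have mPy y : measurable_fun setT (fun y' => Phi (y, y')).
  exact: (measurableT_comp mPhi (measurable_pair1 _)).
have mPy' y' : measurable_fun setT (fun y => Phi (y, y')).
  exact: (measurableT_comp mPhi (measurable_pair2 _)).
have swap : \int[nu]_y \int[nu]_y' (g y' * Phi (y, y')) =
            \int[nu]_y \int[nu]_y' (g y * Phi (y, y')).
  have j : integrableR (nu \x nu)%E (fun p => g p.2 * Phi p).
    by apply: iM => //; exact: integrableR_snd.
  rewrite -(Rfubini j); last by move=> y; exact: iM.
  rewrite (Rfubini2 j); last first.
    by move=> y /=; apply: integrableRZ; exact: integrableR_bounded (mPy' y) (fun=> Phic _).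
  by apply: eq_Rintegral => y _; apply: eq_Rintegral => y' _; rewrite PhiC.
transitivity (\int[nu]_y (k.+1%:R * \int[nu]_y' (g y' * Phi (y, y')))).
  apply: eq_Rintegral => y _; rewrite (IH (fun u => f (sum_step (y, u))))//.
  have mz : measurable_fun setT
    (fun z => f (sum_step (y, sum_step z)))
    by exact: (measurableT_comp (mfsy y) measurable_sum_step).
  congr (_ * _); rewrite Rfubini/=.
  - apply: eq_Rintegral => y' _; rewrite PhiE RintZ//.
    exact: integrableR_bounded (mF3p (y, y')) (fun=> fc _).
  - by apply: iM => //; exact: integrableR_fst.
  - move=> y' /=; apply: integrableRZ.
    exact: integrableR_bounded (mF3p (y, y')) (fun=> fc _).
rewrite RintZ; last first.
  apply: (integrableR_fubini (P2 := nu) (f := fun p => g p.2 * Phi p)).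
    by apply: iM => //; exact: integrableR_snd.
  by move=> y; exact: iM.
rewrite swap; congr (_ * _); apply: eq_Rintegral => y _.
rewrite RintZ; last exact: integrableR_bounded (mPy y) (fun=> Phic _).
rewrite /= RintZ; last exact: integrableR_bounded (mfsy y) (fun=> fc _).
congr (_ * _); rewrite Rint_sumlawS; last first.
  exact: integrableR_bounded (mfsy y) (fun=> fc _).
have mz : measurable_fun setT
    (fun z => f (sum_step (y, sum_step z)))
    by exact: (measurableT_comp (mfsy y) measurable_sum_step).
rewrite PhiE Rfubini//.
- exact: integrableR_bounded mz (fun=> fc _).
- by move=> y'; exact: integrableR_bounded (mF3p (y, y')) (fun=> fc _).
Qed.

End exchangeability.

(** * The Gaussian tail and Mills' ratio *)

Section gaussian_tail.
Context {R : realType}.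
Local Notation leb := (@lebesgue_measure R).
Local Notation pdf := (normal_pdf (0 : R) 1).

Definition gtail (x : R) : R := fine (normal_prob (0 : R) 1 `]x, +oo[).
Definition gcdf (x : R) : R := fine (normal_prob (0 : R) 1 `]-oo, x]).

Lemma pdfE (t : R) : pdf t = normal_peak 1 * expR (- t ^+ 2 / 2).
Proof. by rewrite normal_pdfE// /normal_fun subr0 expr1n. Qed.

Lemma pdf_gt0 (t : R) : 0 < pdf t.
Proof. by rewrite pdfE mulr_gt0 ?expR_gt0 ?normal_peak_gt0. Qed.

Lemma gtailE x : gtail x = 1 - gcdf x.
Proof.
rewrite /gtail /gcdf -setCitvl probability_setC//=.
by rewrite fineB// fin_num_measure.
Qed.

Lemma gtail_ge0 x : 0 <= gtail x.
Proof. exact: fine_ge0. Qed.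

Lemma is_derive_gtail (x : R) : is_derive x 1 gtail (- pdf x).
Proof.
have -> : gtail = fun x => 1 - gcdf x by apply/funext => y; exact: gtailE.
have xx1 : x < x + 1 by rewrite ltrDl.
have ip : leb.-integrable [set` Interval -oo%O (BRight (x + 1))] (EFin \o pdf).
  by apply: (integrableS _ _ (subsetT _)) => //; exact: integrable_normal_pdf.
have cp : {for x, continuous pdf}.
  by apply: continuous_normal_pdf; rewrite oner_eq0.
have [d1 d2] := continuous_FTC1 xx1 ip (ltNyr _) cp.
have dF : is_derive x 1 gcdf (pdf x).
  by rewrite -d2 derive1E; exact: DeriveDef.
by apply: is_derive_eq; rewrite add0r mul1r.
Qed.

Lemma is_derive_pdf (x : R) : is_derive x 1 pdf (- x * pdf x).
Proof.
have -> : pdf = fun t => normal_peak 1 * expR (- t ^+ 2 / 2).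
  by apply/funext => t; exact: pdfE.
apply: is_derive_eq; rewrite /GRing.scale/=.
by set E := expR _; field.
Qed.

(** The identity as a random variable on the normal law: its complementary distribution function is
    [gtail]. *)
Let idX : measurableTypeR R -> R := idfun.

Let measurable_idX : measurable_fun setT idX.
Proof. by move=> _ B mB; rewrite setTI. Qed.

HB.instance Definition _ := isMeasurableFun.Build _ _ _ _ idX measurable_idX.

Lemma gtail_small (e : R) : 0 < e -> exists v0, forall v, v0 <= v -> gtail v < e.
Proof.
move=> e0; have := @cvg_ccdfy0 _ _ _ (normal_prob (0 : R) 1) idX.
move=> /fine_cvgP[_ /cvgr_lt/(_ _ e0)[M [_ hM]]].
exists (M + 1) => v Mv; apply: hM; apply: lt_le_trans Mv.
by rewrite ltrDl.
Qed.

Lemma pdf_le (u v : R) : 0 <= u -> u <= v -> pdf v <= pdf u.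
Proof.
move=> u0 uv; rewrite !pdfE ler_wpM2l ?normal_peak_ge0// ler_expR.
by rewrite ler_pM2r ?invr_gt0// lerN2 ler_sqr ?nnegrE// (le_trans u0).
Qed.

Lemma gtail_mvt (u v : R) : u <= v ->
  exists2 c, u <= c <= v & gtail u - gtail v = pdf c * (v - u).
Proof.
move=> uv.
have [|c] := MVT_segment uv (fun x _ => is_derive_gtail x).
  apply: derivable_within_continuous => x _.
  by have [] := is_derive_gtail x.
rewrite in_itv /= => cuv E; exists c => //.
by rewrite -[LHS]opprB E mulNr opprK.
Qed.

(** On [v >= u] the function [u * gtail v - pdf v] has derivative [(v - u) * pdf v >= 0], and it is
    at most [u * gtail v], which tends to 0. Hence it is nonpositive at [v = u]. *)
Lemma gtail_mills (u : R) : 0 <= u -> u * gtail u <= pdf u.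
Proof.
move=> u0; pose k (v : R) := - pdf v - u * (- gtail v).
have dk (v : R) : is_derive v 1 k (v * pdf v - u * pdf v).
  have := is_derive_pdf v; have := is_derive_gtail v => d1 d2.
  by rewrite /k; apply: is_derive_eq; rewrite /GRing.scale/=; ring.
have kuv v : u < v -> k u <= k v.
  move=> uv; have [|c] := MVT uv (fun x _ => dk x).
    apply: derivable_within_continuous => x _.
    by have [] := dk x.
  rewrite in_itv /= => /andP[uc cv] kE; rewrite -subr_ge0 kE mulr_ge0//.
    by rewrite -mulrBl mulr_ge0 ?subr_ge0 ?ltW ?pdf_gt0.
  by rewrite subr_ge0 ltW.
rewrite leNgt; apply/negP => lt.
have e0 : 0 < (u * gtail u - pdf u) / (u + 1).
  by rewrite divr_gt0 ?subr_gt0// ltr_wpDl.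
have [v0 hv0] := gtail_small e0.
pose v := Num.max v0 (u + 1).
have uv : u < v by rewrite lt_max ltrDl ltr01 orbT.
have := kuv _ uv; have := hv0 v; rewrite le_max lexx => /(_ isT).
rewrite ltr_pdivlMr; last by rewrite ltr_wpDl.
by rewrite /k; have := pdf_gt0 v; have := gtail_ge0 v; nra.
Qed.

Lemma gtail_lb (u s : R) : 0 <= u -> 0 <= s -> s * pdf (u + s) <= gtail u.
Proof.
move=> u0 s0; have us : u <= u + s by rewrite lerDl.
have [c /andP[uc cus] E] := gtail_mvt us.
have : gtail u - gtail (u + s) <= gtail u by rewrite gerBl gtail_ge0.
apply: le_trans; rewrite E addrAC subrr add0r mulrC ler_wpM2r//.
by rewrite pdf_le// (le_trans u0).
Qed.

Lemma gtail0 : gtail 0 = 1 / 2.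
Proof.
have c1 : continuous pdf by apply: continuous_normal_pdf; rewrite oner_eq0.
have sym : pdf =1 pdf \o -%R by move=> t; rewrite /= !pdfE sqrrN.
have := ge0_symfun_integralT (fun t => ltW (pdf_gt0 t)) c1 sym.
rewrite integral_normal_pdf -set_itvcy -integral_itv_obnd_cbnd; last first.
  by apply/measurable_EFinP/measurable_funTS; exact: measurable_normal_pdf.
have -> : (\int[leb]_(t in `]0%R, +oo[) (pdf t)%:E = (gtail 0)%:E)%E.
  by rewrite /gtail fineK// fin_num_measure.
by rewrite -EFinM => -[] ?; lra.
Qed.

(** Mills' ratio, tail over density, with the inverse density written out so that it can be
    differentiated as a product. *)
Definition mills (u : R) : R := gtail u * (expR (u ^+ 2 / 2) / normal_peak 1).

(** This is Stein's equation with constant right-hand side -1; the solution for [exp_step] is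
    assembled from shifted and reflected copies of [mills]. *)
Lemma is_derive_mills (u : R) : is_derive u 1 mills (u * mills u - 1).
Proof.
have := is_derive_gtail u => d1.
have p0 : normal_peak 1 != 0 :> R by rewrite gt_eqF// normal_peak_gt0// oner_eq0.
rewrite /mills; apply: is_derive_eq; rewrite /GRing.scale/= pdfE.
have := expRxMexpNx_1 (u ^+ 2 / 2).
rewrite -mulNr; set E := expR _; set F := expR _ => EF.
apply/eqP; rewrite -subr_eq0; apply/eqP.
transitivity (1 - E * F); last by rewrite EF subrr.
by field.
Qed.

Lemma mills_ge0 u : 0 <= mills u.
Proof.
by rewrite mulr_ge0 ?gtail_ge0// divr_ge0 ?expR_ge0 ?normal_peak_ge0.
Qed.

Lemma millsE u : mills u = gtail u / pdf u.
Proof.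
by congr (_ * _); rewrite pdfE mulNr expRN invfM (invrK (expR _)) [RHS]mulrC.
Qed.

Lemma mills_le1 (u : R) : 0 <= u -> u * mills u <= 1.
Proof.
move=> u0; rewrite millsE mulrA ler_pdivrMr ?pdf_gt0// mul1r.
exact: gtail_mills.
Qed.

Lemma mills_antitone (u v : R) : 0 <= u -> u <= v -> mills v <= mills u.
Proof.
move=> u0 uv.
have [|c] := MVT_segment uv (fun x _ => is_derive_mills x).
  apply: derivable_within_continuous => x _.
  by have [] := is_derive_mills x.
rewrite in_itv /= => /andP[uc cuv] E; rewrite -subr_le0 E.
rewrite mulr_le0_ge0 ?subr_ge0// subr_le0 mills_le1// (le_trans u0)//.
Qed.

Lemma mills0 : normal_peak 1 * mills 0 = 1 / 2.
Proof.
have : normal_peak 1 != 0 :> R by rewrite gt_eqF// normal_peak_gt0// oner_eq0.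
rewrite /mills gtail0 expr0n /= mul0r expR0.
by set c := normal_peak 1 => c0; field.
Qed.

End gaussian_tail.

(** * Stein's equation for a one-sided exponential *)

Section stein_equation.
Context {R : realType}.
Variable x : R.
Hypothesis x1 : 1 <= x.

Definition exp_step (u : R) : R := if 0 < u then expR (- (x * u)) else 0.
(* [E h(Z)] for [Z] standard Gaussian, after completing the square. *)
Definition exp_step_mean : R := expR (x ^+ 2 / 2) * gtail x.
Local Notation h := exp_step.
Local Notation N := exp_step_mean.

(** By the equation for [mills], both [N * mills u] and [- (N * mills (- u))] solve [f' = u f - N],
    and [- expR (- (x * u)) * mills (u + x)] solves [f' = u f + expR (- (x * u))]. On each half-line
    the combination taken is bounded. The branches meet at 0 because [N * mills 0] is half of
    [mills x]. *)
Let fp (u : R) := N * mills u - expR (- (x * u)) * mills (u + x).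
Let fm (u : R) := - (N * mills (- u)).

(* The bounded solution of Stein's equation [f'(u) = u f(u) + h(u) - E h(Z)]. *)
Definition stein_sol (u : R) : R := if 0 < u then fp u else fm u.
Local Notation f := stein_sol.
(** Read off from the equation instead of being defined as a derivative: [stein_sol] has a corner at
    0, where [exp_step] jumps. *)
Definition stein_der (u : R) : R := u * f u + h u - N.
Local Notation g := stein_der.

Let x0 : 0 <= x. Proof. exact: le_trans x1. Qed.

Let NE : N = normal_peak 1 * mills x.
Proof.
have : normal_peak 1 != 0 :> R by rewrite gt_eqF// normal_peak_gt0// oner_eq0.
rewrite /exp_step_mean /mills.
by set c := normal_peak 1 => c0; field.
Qed.

Lemma exp_step_mean_ge0 : 0 <= N.
Proof. by rewrite mulr_ge0 ?expR_ge0 ?gtail_ge0. Qed.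

Let N_half : N <= 1 / 2.
Proof.
by rewrite NE -mills0 ler_wpM2l ?normal_peak_ge0// mills_antitone.
Qed.

Let Nmills0 : N * mills 0 = mills x / 2.
Proof. by rewrite NE mulrAC mills0 mulrC mulrA mulr1. Qed.

Let mills_x : mills x <= x^-1.
Proof.
by rewrite -[leRHS]mul1r ler_pdivlMr ?(lt_le_trans ltr01)// mulrC mills_le1.
Qed.

Lemma exp_step_01 u : 0 <= h u <= 1.
Proof.
rewrite /h; case: ifPn => u0; last by rewrite lexx ler01.
rewrite expR_ge0 -[leRHS]expR0 ler_expR oppr_le0 mulr_ge0// ltW//.
Qed.

Let expx u : 0 <= u -> 0 <= expR (- (x * u)) <= 1.
Proof.
move=> u0.
by rewrite expR_ge0 -[leRHS]expR0 ler_expR oppr_le0 mulr_ge0.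
Qed.

Let fp0 : fp 0 = fm 0.
Proof.
by rewrite /fp /fm mulr0 oppr0 expR0 add0r mul1r Nmills0; lra.
Qed.

Let fpE u : 0 <= u -> f u = fp u.
Proof.
rewrite le_eqVlt => /orP[/eqP <-|u0]; first by rewrite /f ltxx fp0.
by rewrite /f u0.
Qed.

Let fmE u : u <= 0 -> f u = fm u.
Proof. by rewrite /f ltNge => ->. Qed.

Let Nm u : 0 <= u -> 0 <= N * mills u <= mills x / 2.
Proof.
move=> u0; rewrite mulr_ge0 ?mills_ge0 ?exp_step_mean_ge0//=.
by rewrite -Nmills0 ler_wpM2l ?exp_step_mean_ge0// mills_antitone.
Qed.

Let Em u : 0 <= u -> 0 <= expR (- (x * u)) * mills (u + x) <= mills x.
Proof.
move=> u0; have /andP[e0 e1] := expx u0.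
have m1 : mills (u + x) <= mills x by rewrite mills_antitone ?lerDr.
have := mills_ge0 (u + x); set a := mills (u + x) in m1 *.
set b := mills x in m1 *; set e := expR _ in e0 e1 * => a0; nra.
Qed.

(** Each term lies between 0 and [mills x <= x^-1]. The decay in [x] matters: an error [al] in the
    mean will cost only [al / x]. *)
Lemma stein_sol_le u : `|f u| <= x^-1.
Proof.
apply: le_trans mills_x; have mx := mills_ge0 x.
have [u0|/ltW u0] := leP 0 u.
  rewrite fpE// /fp ler_norml.
  by have := Nm u0; have := Em u0; lra.
rewrite fmE// /fm ler_norml; have := Nm (u := - u); rewrite oppr_ge0 => /(_ u0).
lra.
Qed.

Let ufu u : `|u * f u| <= 1.
Proof.
have [u0|/ltW u0] := leP 0 u.
  rewrite fpE// /fp mulrBr ler_norml.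
  have /andP[e0 e1] := expx u0.
  have ux : 0 <= u + x by rewrite addr_ge0.
  have := mills_le1 ux; have := mills_le1 u0.
  have := mills_ge0 u; have := mills_ge0 (u + x).
  have := N_half; have := exp_step_mean_ge0.
  set a := mills (u + x); set b := mills u; set e := expR _ in e0 e1 *.
  move=> n0 n1 a0 b0 ub uxa.
  have uxa' : u * a <= 1.
    by have : 0 <= x * a by [rewrite mulr_ge0]; move: uxa; rewrite mulrDl; lra.
  have : 0 <= u * (N * b) <= 1.
    have ub0 : 0 <= u * b by exact: mulr_ge0.
    rewrite mulrCA; apply/andP; split; first exact: mulr_ge0.
    by apply: mulr_ile1 => //; lra.
  have : 0 <= u * (e * a) <= 1.
    have ua0 : 0 <= u * a by exact: mulr_ge0.
    by rewrite mulrCA; apply/andP; split; [exact: mulr_ge0|exact: mulr_ile1].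
  lra.
have u0' : 0 <= - u by rewrite oppr_ge0.
rewrite fmE// /fm ler_norml; have := mills_le1 u0'; have := mills_ge0 (- u).
have := N_half; have := exp_step_mean_ge0.
set b := mills (- u) => *; apply/andP; split; nra.
Qed.

Lemma stein_der_le u : `|g u| <= 2.
Proof.
have := ufu u; have := N_half; have := exp_step_mean_ge0; have := exp_step_01 u.
by rewrite /g !ler_norml; lra.
Qed.

Let dfp (u : R) : is_derive u 1 fp (u * fp u + expR (- (x * u)) - N).
Proof.
have := is_derive_mills u; have := is_derive_mills (u + x) => d1 d2.
rewrite /fp; apply: is_derive_eq; rewrite /GRing.scale/=; ring.
Qed.

Let dfm (u : R) : is_derive u 1 fm (u * fm u - N).
Proof.
have := is_derive_mills (- u) => d1.
rewrite /fm; apply: is_derive_eq; rewrite /GRing.scale/=; ring.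
Qed.

Let mvt_pos u v : 0 <= u -> u < v ->
  exists2 c, u < c < v & f v - f u = g c * (v - u).
Proof.
move=> u0 uv.
have [|c] := MVT uv (fun y _ => dfp y).
  by apply: derivable_within_continuous => y _; have [] := dfp y.
rewrite in_itv /= => cuv E; exists c => //.
have c0 : 0 < c by case/andP: cuv => uc _; exact: le_lt_trans uc.
rewrite !fpE//; last by rewrite (le_trans u0)// ltW.
by rewrite E /g fpE ?ltW// /h c0.
Qed.

Let mvt_neg u v : v <= 0 -> u < v ->
  exists2 c, u < c < v & f v - f u = g c * (v - u).
Proof.
move=> v0 uv.
have [|c] := MVT uv (fun y _ => dfm y).
  by apply: derivable_within_continuous => y _; have [] := dfm y.
rewrite in_itv /= => cuv E; exists c => //.
have c0 : c <= 0 by case/andP: cuv => _ cv; rewrite (le_trans (ltW cv)).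
rewrite !fmE//; last by rewrite (le_trans _ v0)// ltW.
by rewrite E /g fmE// /h ltNge c0 /= addr0.
Qed.

Let lip_lt u v : u < v -> `|f v - f u| <= 2 * (v - u).
Proof.
have main a b (c : R) : a < b -> f b - f a = g c * (b - a) ->
    `|f b - f a| <= 2 * (b - a).
  move=> ab ->; have ba : 0 <= b - a by rewrite subr_ge0 ltW.
  by rewrite normrM (ger0_norm ba); exact: ler_wpM2r (stein_der_le c).
move=> uv; have [u0|u0] := leP 0 u.
  by have [c _ E] := mvt_pos u0 uv; exact: main E.
have [v0|v0] := leP v 0.
  by have [c _ E] := mvt_neg v0 uv; exact: main E.
(* The mean value theorem fails across the corner, so an interval around 0 is cut there. *)
have [c _ /(main _ _ _ u0) E1] := mvt_neg (lexx 0) u0.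
have [c' _ /(main _ _ _ v0) E2] := mvt_pos (lexx 0) v0.
rewrite (le_trans (ler_distD (f 0) _ _))//.
by rewrite (le_trans (lerD E2 E1))//; lra.
Qed.

Lemma stein_sol_lip u s : `|f (u + s) - f u| <= 2 * `|s|.
Proof.
have [s0|s0|->] := ltgtP s 0; last by rewrite addr0 subrr !normr0 mulr0.
  have us : u + s < u by rewrite gtrDl.
  by rewrite distrC (le_trans (lip_lt us))// ltr0_norm//; lra.
have us : u < u + s by rewrite ltrDl.
by rewrite (le_trans (lip_lt us))// gtr0_norm//; lra.
Qed.

Let f_le1 u : `|f u| <= 1.
Proof.
by rewrite (le_trans (stein_sol_le u))// invf_le1// (lt_le_trans ltr01).
Qed.

Let ufu_diff u s : `|(u + s) * f (u + s) - u * f u| <= `|s| * (1 + 2 * `|u|).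
Proof.
rewrite (_ : _ - _ = s * f (u + s) + u * (f (u + s) - f u)); last by ring.
rewrite (le_trans (ler_normD _ _))// !normrM mulrDr mulr1 lerD//.
  by rewrite ler_piMr.
by have := stein_sol_lip u s; have := normr_ge0 u; nra.
Qed.

Let exp_lip u v : 0 <= u -> 0 <= v ->
  `|expR (- (x * v)) - expR (- (x * u))| <= x * `|v - u|.
Proof.
wlog uv : u v / u <= v.
  move=> H u0 v0; have [|/ltW] := leP u v; first by move=> ?; exact: H.
  by move=> vu; rewrite distrC [`|v - u|]distrC; exact: H.
move=> u0 v0; rewrite distrC ger0_norm; last first.
  by rewrite subr_ge0 ler_expR lerN2 ler_wpM2l.
rewrite ger0_norm ?subr_ge0//.
have := expR_ge1Dx (- (x * (v - u))); have /andP[] := expx u0.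
have -> : expR (- (x * v)) = expR (- (x * u)) * expR (- (x * (v - u))).
  by rewrite -expRD; congr expR; ring.
have : 0 <= x * (v - u) by rewrite mulr_ge0// subr_ge0.
set a := expR _; set b := expR _; set c := x * (v - u); nra.
Qed.

Let h_diff u s : `|h (u + s) - h u| <=
  `|s| * x + (if `|u| <= `|s| then 1 else 0).
Proof.
have sx : 0 <= `|s| * x by rewrite mulr_ge0.
case: ifPn => us.
  have := exp_step_01 u; have := exp_step_01 (u + s).
  by rewrite ler_norml; lra.
rewrite addr0; rewrite -ltNge in us.
have [u0|u0|u0] := ltgtP u 0; last by move: us; rewrite u0 normr0 normr_lt0.
  have us0 : u + s < 0.
    by move: us; rewrite (ltr0_norm u0); have := ler_norm s; lra.
  by rewrite /h !(ltNge 0) (ltW us0) (ltW u0) /= subrr normr0.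
have us0 : 0 < u + s.
  by move: us; rewrite (gtr0_norm u0); have := ler_norm (- s); rewrite normrN; lra.
rewrite /h us0 u0 (le_trans (exp_lip (ltW u0) (ltW us0)))//.
by rewrite addrAC subrr add0r mulrC.
Qed.

(** The indicator pays for the jump of [exp_step] at 0, which a step of length [|s|] from [u]
    reaches only if [|u| <= |s|]. *)
Lemma stein_der_diff u s : `|g (u + s) - g u| <=
  `|s| * (1 + 2 * `|u| + x) + (if `|u| <= `|s| then 1 else 0).
Proof.
rewrite (_ : _ - _ = ((u + s) * f (u + s) - u * f u) + (h (u + s) - h u));
  last by rewrite /g; ring.
rewrite (le_trans (ler_normD _ _))//.
by rewrite (le_trans (lerD (ufu_diff u s) (h_diff u s)))//; lra.
Qed.

(** If [|s| < |u|] the step avoids the corner and the mean value theorem reduces the claim to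
    [stein_der_diff]. Otherwise the Lipschitz constant 2 and the bound 2 on [stein_der] add up to
    4. *)
Lemma stein_sol_taylor u s : `|f (u + s) - f u - s * g u| <=
  `|s| * (`|s| * (1 + 2 * `|u| + x) + (if `|u| <= `|s| then 4 else 0)).
Proof.
have B0 : 0 <= `|s| * (1 + 2 * `|u| + x).
  by rewrite mulr_ge0// !addr_ge0// mulr_ge0.
case: ifPn => us.
  rewrite (le_trans (ler_normB _ _))// normrM.
  have := stein_sol_lip u s; have := stein_der_le u; have := normr_ge0 s.
  nra.
rewrite -ltNge in us; rewrite addr0.
have step c : f (u + s) - f u = g c * s -> `|c - u| <= `|s| ->
    `|f (u + s) - f u - s * g u| <= `|s| * (`|s| * (1 + 2 * `|u| + x)).
  move=> -> cu; rewrite [s * _]mulrC -mulrBl normrM mulrC ler_wpM2l//.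
  have := stein_der_diff u (c - u); rewrite subrKC [`|u| <= _]leNgt (le_lt_trans cu us) /=.
  rewrite addr0 => /le_trans; apply; rewrite ler_wpM2r//.
  by rewrite !addr_ge0// mulr_ge0.
have [s0|s0|s0] := ltgtP s 0.
- have us' : u + s < u by rewrite gtrDl.
  have [c cI E] : exists2 c, u + s < c < u & f u - f (u + s) = g c * (u - (u + s)).
    have [u0|u0] := leP u 0; first exact: mvt_neg.
    apply: mvt_pos => //; move: us; rewrite (gtr0_norm u0) (ltr0_norm s0); lra.
  apply: (step c); first by rewrite -[LHS]opprB E; ring.
  by rewrite (ltr0_norm s0) ler0_norm; lra.
- have us' : u < u + s by rewrite ltrDl.
  have [c cI E] : exists2 c, u < c < u + s & f (u + s) - f u = g c * (u + s - u).
    have [u0|u0] := leP 0 u; first exact: mvt_pos.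
    apply: mvt_neg => //; move: us; rewrite (ltr0_norm u0) (gtr0_norm s0); lra.
  apply: (step c); first by rewrite E; ring.
  by rewrite (gtr0_norm s0) ger0_norm; lra.
- by rewrite s0 addr0 subrr mul0r subr0 normr0 mul0r.
Qed.

Lemma measurable_exp_step : measurable_fun setT h.
Proof. by rewrite /h; mfun. Qed.

Lemma measurable_stein_sol : measurable_fun setT f.
Proof.
have cm (k k' : R -> R) : (forall u : R, is_derive u 1 k (k' u)) ->
    measurable_fun setT k.
  move=> dk; apply: continuous_measurable_fun => u.
  apply/differentiable_continuous/derivable1_diffP.
  by have [] := dk u.
have := cm _ _ dfp; have := cm _ _ dfm => *.
by rewrite /f; mfun.
Qed.

End stein_equation.

(** * A smoothed normal approximation for nearly additive statistics *)

Section clip.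
Context {R : realType}.
Variables (m H : R).
Hypothesis H0 : 0 <= H.

Definition clip (t : R) : R := Num.min (Num.max (t - m) (- H)) H.

Let clipP t : [\/ clip t = - H /\ t - m <= - H,
  clip t = t - m /\ - H <= t - m <= H | clip t = H /\ H <= t - m].
Proof.
have h0 := H0; rewrite /clip; have [tH|/ltW tH] := leP (t - m) (- H).
  by apply: Or31; split=> //; rewrite min_l//; lra.
have [tH'|/ltW tH'] := leP (t - m) H; last by apply: Or33.
by apply: Or32; rewrite tH.
Qed.

Lemma clip_le t : `|clip t| <= H.
Proof. have h0 := H0; by rewrite ler_norml; have [] := clipP t => -[->]; lra. Qed.

Lemma clip_nd t s : t <= s -> clip t <= clip s.
Proof. have h0 := H0; by have [] := clipP t => -[-> ?]; have [] := clipP s => -[-> ?]; lra. Qed.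

Lemma clip_lip t s : `|clip t - clip s| <= `|t - s|.
Proof.
have h0 := H0; wlog ts : t s / s <= t.
  have [st|/ltW ts] := leP s t; first exact.
  by move=> H'; rewrite distrC [leRHS]distrC H'.
rewrite !ger0_norm ?subr_ge0 ?clip_nd//.
by have [] := clipP t => -[-> ?]; have [] := clipP s => -[-> ?]; lra.
Qed.

Lemma clip_id t : `|t - m| <= H -> clip t = t - m.
Proof. have h0 := H0; by rewrite ler_norml; have [] := clipP t => -[-> ?]; lra. Qed.

Lemma measurable_clip : measurable_fun setT clip.
Proof. by rewrite /clip; mfun. Qed.

End clip.

Section almost_additive.
Context d1 d2 (T1 : measurableType d1) (T2 : measurableType d2) (R : realType).
Variables (nu : probability T1 R) (rho : probability T2 R).
Local Notation PP := (nu \x rho)%E.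
(** [M] is the nearly additive statistic and [L] its additive part; [M'] is the statistic with one
    entry left out, hence independent of that entry, whose contribution is [xi] up to an error [e].
    The identity [exchange] expresses that [L] is a sum of [n] exchangeable copies of [xi]. The
    sizes [al], [be] and [kap] measure the errors in the mean, in the variance, and of third
    order. *)
Variables (xi e : T1 -> R) (M' : T2 -> R) (M L : T1 * T2 -> R).
Variables (n kap al be : R).
Hypothesis n0 : 0 <= n.
Hypotheses (mM' : measurable_fun setT M') (mM : measurable_fun setT M).
Hypothesis ME : forall z, `|M z - M' z.2 - xi z.1| <= e z.1.
Hypothesis LM : forall z, L z <= M z.
Hypothesis exchange : forall F : R -> R, measurable_fun setT F ->
  (exists c, forall t, `|F t| <= c) ->
  \int[PP]_z (L z * F (M z)) = n * \int[PP]_z (xi z.1 * F (M z)).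
Hypotheses (ixi : integrableR nu xi) (ixi2 : integrableR nu (fun y => xi y ^+ 2))
  (ixi3 : integrableR nu (fun y => `|xi y| ^+ 3)) (ie : integrableR nu e)
  (ixie : integrableR nu (fun y => `|xi y| * e y))
  (iL : integrableR PP L) (iD : integrableR PP (fun z => M z - L z)).
Hypotheses (kap0 : 0 < kap) (kap1 : kap <= 1) (al1 : al <= 1) (be14 : be <= 1 / 4).
Hypothesis xi1 : n * `|\int[nu]_y xi y| <= al.
Hypothesis xi2 : `|n * (\int[nu]_y xi y ^+ 2) - 1| <= be.
Hypothesis xi3 : n * (\int[nu]_y `|xi y| ^+ 3) <= kap.
Hypothesis xie : n * (\int[nu]_y (`|xi y| * e y)) <= kap.
Hypothesis xiDe : \int[nu]_y (`|xi y| + e y) <= kap.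
Hypothesis L2 : \int[PP]_z `|L z| <= 2.
Hypothesis MBL : \int[PP]_z (M z - L z) <= kap.

Let e0 y : 0 <= e y.
Proof.
have [u _] : exists u : T2, True.
  by exists point.
exact: le_trans (ME (y, u)).
Qed.

Let mxi : measurable_fun setT xi := integrableR_measurable ixi.
Let me : measurable_fun setT e := integrableR_measurable ie.
Let mL : measurable_fun setT L := integrableR_measurable iL.

Definition band (a b : R) (u : T2) : R :=
  if a <= M' u then (if M' u <= b then 1 else 0) else 0.

Let measurable_band a b : measurable_fun setT (band a b).
Proof. by rewrite /band; mfun. Qed.

Let band01 a b u : 0 <= band a b u <= 1.
Proof. by rewrite /band; case: ifP => _; [case: ifP => _|]; rewrite ?lexx ?ler01. Qed.

Let band_bounded a b u : `|band a b u| <= 1.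
Proof. by rewrite ger0_norm; case/andP: (band01 a b u). Qed.

(* Stein's method with a clipped linear test function. *)
Lemma concentration a b : a <= b ->
  \int[rho]_u band a b u <= 3 * (b - a) + 26 * kap.
Proof.
have [k0 k1 al1' be14'] := And4 kap0 kap1 al1 be14.
(* The margin [4 * kap] keeps the clipped function linear with slope 1 along every step of length at
   most [4 * kap] that starts in [[a, b]]. *)
move=> ab; pose H := (b - a) / 2 + 4 * kap; pose m := (a + b) / 2.
have H0 : 0 <= H by rewrite /H; lra.
pose F := clip m H.
have mF : measurable_fun setT F by exact: measurable_clip.
have FH t : `|F t| <= H by exact: clip_le.
have mFM : measurable_fun setT (F \o M) by exact: measurableT_comp.
have mFM' : measurable_fun setT (F \o M') by exact: measurableT_comp.
have iM d (T : measurableType d) (P : probability T R) (a' h : T -> R) c :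
    integrableR P a' -> measurable_fun setT h -> (forall x, `|h x| <= c) ->
    integrableR P (fun x => a' x * h x).
  move=> ia mh hc; have ma := integrableR_measurable ia.
  apply: (@integrableR_le _ _ _ _ _ (fun x => c * `|a' x|)).
  - exact: measurable_funM.
  - exact/integrableRZ/integrableR_norm.
  - by move=> x; rewrite normrM mulrC ler_wpM2r.
(* Monotonicity of [F] makes [xi * (F (M' + xi) - F M')] nonnegative, and on the band it equals
   [xi ^+ 2] for small [xi]. The cubic correction makes the lower bound nonpositive for large [xi].
   Replacing [M] by [M' + xi] costs [|xi| * e]. *)
have pw z : xi z.1 * F (M' z.2) +
    ((xi z.1 ^+ 2 - (4 * kap)^-1 * `|xi z.1| ^+ 3) * band a b z.2 -
     `|xi z.1| * e z.1) <= xi z.1 * F (M z).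
  set t := M' z.2; set s := xi z.1.
  have B1 : `|s * (F (M z) - F (t + s))| <= `|s| * e z.1.
    rewrite normrM ler_wpM2l// (le_trans (clip_lip _ _ _ _))//.
    by rewrite opprD addrA ME.
  have B2 : (s ^+ 2 - (4 * kap)^-1 * `|s| ^+ 3) * band a b z.2 <=
      s * (F (t + s) - F t).
    have mono : 0 <= s * (F (t + s) - F t).
      have [s0|/ltW s0] := leP 0 s.
        by rewrite mulr_ge0// subr_ge0 clip_nd// lerDl.
      by rewrite mulr_le0// subr_le0 clip_nd// gerDl.
    rewrite /band -/t; case: ifPn => at'; last by rewrite mulr0.
    case: ifPn => tb; last by rewrite mulr0.
    rewrite mulr1; have [sk|sk] := leP `|s| (4 * kap).
      have -> : F (t + s) - F t = s.
        move: sk; rewrite ler_norml => sk.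
        by rewrite /F !clip_id ?ler_norml /H /m; lra.
      by rewrite -expr2 gerBl mulr_ge0// ?invr_ge0 ?exprn_ge0//; lra.
    apply: le_trans mono; rewrite subr_le0 -[s ^+ 2](real_normK (num_real s)).
    rewrite exprS mulrA ler_peMl ?sqr_ge0//.
    rewrite mulrC ler_pdivlMr ?mul1r; lra.
  by move: B1; rewrite ler_norml mulrBr => /andP[B1 _]; move: B2; rewrite mulrBr; lra.
have iband : integrableR rho (band a b).
  exact: integrableR_bounded (measurable_band a b) (band_bounded a b).
have iFM' : integrableR rho (fun u => F (M' u)).
  exact: integrableR_bounded mFM' (fun=> FH _).
have i1 : integrableR PP (fun z => xi z.1 * F (M' z.2)).
  exact: (integrableR_prodM ixi iFM').
have ia : integrableR nu (fun y => xi y ^+ 2 - (4 * kap)^-1 * `|xi y| ^+ 3).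
  by apply: integrableRB => //; exact: integrableRZ.
have i2 : integrableR PP (fun z =>
    (xi z.1 ^+ 2 - (4 * kap)^-1 * `|xi z.1| ^+ 3) * band a b z.2).
  exact: (integrableR_prodM ia iband).
have i3 : integrableR PP (fun z => `|xi z.1| * e z.1) by exact: integrableR_fst ixie.
have i4 : integrableR PP (fun z => xi z.1 * F (M z)).
  exact: iM (integrableR_fst _ ixi) mFM (fun=> FH _).
have i5 : integrableR PP (fun z => L z * F (M z)).
  exact: iM iL mFM (fun=> FH _).
have := le_Rint (integrableRD i1 (integrableRB i2 i3)) i4 pw.
rewrite RintD//; last exact: integrableRB.
rewrite RintB// (Rint_prodM ixi iFM') (Rint_prodM ia iband) (Rint_fst _ ixie) (RintB ixi2 (integrableRZ _ ixi3)).
rewrite (RintZ _ ixi3).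
move=> /(ler_wpM2l n0); rewrite -(exchange mF); last by exists H.
have EL : \int[PP]_z (L z * F (M z)) <= H * 2.
  apply: (@le_trans _ _ (H * \int[PP]_z `|L z|)); last exact: ler_wpM2l.
  rewrite -RintZ; last exact: integrableR_norm.
  apply: le_Rint => //; first exact/integrableRZ/integrableR_norm.
  move=> z; rewrite (le_trans (ler_norm _))// normrM [leRHS]mulrC.
  exact: ler_wpM2l.
move=> /le_trans/(_ EL).
set p := \int[rho]_u band a b u.
have p0 : 0 <= p by apply: Rintegral_ge0 => u _; case/andP: (band01 a b u).
have FM'H : `|\int[rho]_u F (M' u)| <= H by exact: Rint_bounded.
have T1' : - (al * H) <= n * ((\int[nu]_y xi y) * \int[rho]_u F (M' u)).
  suff : `|n * ((\int[nu]_y xi y) * \int[rho]_u F (M' u))| <= al * H.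
    by rewrite ler_norml => /andP[].
  rewrite mulrA normrM; apply: ler_pM => //.
  by rewrite normrM (ger0_norm n0).
set A1 := \int[nu]_y xi y in T1' *; set A2 := \int[nu]_y _ ^+ 2.
set A3 := \int[nu]_y (_ ^+ 3); set A4 := \int[nu]_y _.
move=> main.
have C : p / 2 <= n * ((A2 - (4 * kap)^-1 * A3) * p).
  have -> : n * ((A2 - (4 * kap)^-1 * A3) * p) =
      (n * A2 - (4 * kap)^-1 * (n * A3)) * p by ring.
  rewrite mulrC ler_wpM2r//.
  have : (4 * kap)^-1 * (n * A3) <= 1 / 4.
    rewrite invfM -mulrA mul1r ler_piMr//.
    by rewrite mulrC ler_pdivrMr ?mul1r.
  by move: xi2; rewrite -/A2 ler_norml; lra.
have : n * A4 <= kap by [].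
have : al * H <= H by rewrite -[leRHS]mul1r ler_wpM2r.
(* Altogether [p / 2 <= 2 * H + al * H + kap <= 3 * H + kap], and [6 * H + 2 * kap] is the stated
   bound. *)
move: main C T1'; rewrite !mulrDr mulrN.
by rewrite /H; lra.
Qed.

Variable x : R.
Hypothesis x1 : 1 <= x.
Local Notation f := (stein_sol x).
Local Notation g := (stein_der x).

Let near0 (s : R) (u : T2) : R := band (- `|s|) `|s| u.

Let near0E s u : near0 s u = if `|M' u| <= `|s| then 1 else 0.
Proof.
by rewrite /near0 /band ler_norml; do 2 case: (_ <= _).
Qed.

Let sh y := `|xi y| + e y.

(** The left side is [g M - M * f M]. Adding and subtracting [n * xi * f M] creates a first line of
    zero mean by [exchange]; expanding [f] and [g] around [M'] then leaves products of a function of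
    the removed entry with a function of the others, plus the cost of the jump near 0. *)
Let stein_pointwise z : exp_step x (M z) - exp_step_mean x <=
  n * (xi z.1 * f (M z)) - L z * f (M z) +
  ((1 - n * xi z.1 ^+ 2) * g (M' z.2) + - n * (xi z.1 * f (M' z.2)) +
   ((sh z.1 + n * `|xi z.1| ^+ 3) * (1 + x + 2 * `|M' z.2|) +
    (2 * n * (`|xi z.1| * e z.1) + (M z - L z) +
     (near0 (sh z.1) z.2 + 4 * n * (xi z.1 ^+ 2 * near0 (xi z.1) z.2))))).
Proof.
have sh0 : 0 <= sh z.1 by rewrite addr_ge0.
set t := M' z.2; set s := M z - t.
have Ms : M z = t + s by rewrite /s addrC subrK.
have ssh : `|s| <= sh z.1.
  have := ME z; rewrite -/t -/s /sh => H.
  by rewrite -[s](subrKC (xi z.1)) (le_trans (ler_normD _ _))// lerD2l.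
have G : g (M z) <= g t + sh z.1 * (1 + x + 2 * `|t|) + near0 (sh z.1) z.2.
  have := le_trans (ler_norm _) (stein_der_diff x1 t s); rewrite -Ms.
  have : `|s| * (1 + 2 * `|t| + x) <= sh z.1 * (1 + x + 2 * `|t|).
    have -> : 1 + 2 * `|t| + x = 1 + x + 2 * `|t| by ring.
    by rewrite ler_wpM2r// !addr_ge0 ?mulr_ge0// (le_trans _ x1).
  have : (if `|t| <= `|s| then 1 else 0) <= near0 (sh z.1) z.2 :> R.
    rewrite near0E -/t (ger0_norm sh0); case: ifPn => ts.
      by rewrite (le_trans ts ssh).
    by case: ifP.
  by move=> I1 I2 /le_trans/(_ (lerD I2 I1)); lra.
have F1 : xi z.1 * f t + xi z.1 ^+ 2 * g t -
    (`|xi z.1| ^+ 3 * (1 + x + 2 * `|t|) + 4 * (xi z.1 ^+ 2 * near0 (xi z.1) z.2))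
    - 2 * (`|xi z.1| * e z.1) <= xi z.1 * f (M z).
  have B1 : `|xi z.1 * (f (M z) - f (t + xi z.1))| <= 2 * (`|xi z.1| * e z.1).
    rewrite normrM mulrCA ler_wpM2l//.
    have -> : M z = (t + xi z.1) + (s - xi z.1) by rewrite Ms; ring.
    by rewrite (le_trans (stein_sol_lip x1 _ _))// ler_wpM2l// ME.
  have B2 : `|xi z.1 * (f (t + xi z.1) - f t - xi z.1 * g t)| <=
      `|xi z.1| ^+ 3 * (1 + x + 2 * `|t|) + 4 * (xi z.1 ^+ 2 * near0 (xi z.1) z.2).
    rewrite normrM.
    have := ler_wpM2l (normr_ge0 (xi z.1)) (stein_sol_taylor x1 t (xi z.1)).
    move=> /le_trans; apply.
    rewrite near0E -/t -[xi z.1 ^+ 2](real_normK (num_real (xi z.1))).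
    rewrite le_eqVlt; apply/orP; left; apply/eqP.
    by case: ifP => _; ring.
  move: B1 B2; rewrite !ler_norml => /andP[B1 _] /andP[B2 _].
  by set i := near0 _ _ in B2 *; lra.
have F2 : - (M z - L z) <= (M z - L z) * f (M z).
  rewrite -lerN2 opprK -mulrN (le_trans (ler_norm _))// normrM normrN.
  rewrite ger0_norm ?subr_ge0// ler_piMr ?subr_ge0//.
  rewrite (le_trans (stein_sol_le x1 _))// invf_le1//.
  exact: lt_le_trans x1.
have hE : exp_step x (M z) - exp_step_mean x = g (M z) - M z * f (M z).
  by rewrite /stein_der; ring.
have F1' := ler_wpM2l n0 F1.
rewrite hE; move: G F1' F2.
set a := near0 _ _; set b := near0 _ _; set F := f (M z).
set gt := g t; set ft := f t; set gM := g (M z).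
lra.
Qed.

Let near0_int s : \int[rho]_u near0 s u <= 6 * `|s| + 26 * kap.
Proof.
have ss : - `|s| <= `|s| by rewrite (le_trans _ (normr_ge0 s))// oppr_le0.
by rewrite (le_trans (concentration ss))//; lra.
Qed.

(* P(|M'| <= c(y)) with c(y) independent of M' is controlled by Fubini and the
   concentration inequality applied for each fixed y. *)
Let near0_fubini (w c : T1 -> R) : (forall y, 0 <= w y) -> integrableR nu w ->
  measurable_fun setT c -> integrableR nu (fun y => w y * `|c y|) ->
  integrableR PP (fun z => w z.1 * near0 (c z.1) z.2) /\
  \int[PP]_z (w z.1 * near0 (c z.1) z.2) <=
    6 * \int[nu]_y (w y * `|c y|) + 26 * kap * \int[nu]_y w y.
Proof.
move=> w0 iw mc iwc; have mw := integrableR_measurable iw.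
have m1 : measurable_fun setT (fun z : T1 * T2 => near0 (c z.1) z.2).
  rewrite /near0 /band.
  have mc1 : measurable_fun setT (fun z : T1 * T2 => c z.1).
    by apply: measurableT_comp.
  have mM1 : measurable_fun setT (fun z : T1 * T2 => M' z.2).
    by apply: measurableT_comp.
  by mfun.
have b1 s u : `|near0 s u| <= 1 by exact: band_bounded.
have i1 : integrableR PP (fun z => w z.1 * near0 (c z.1) z.2).
  apply: (@integrableR_le _ _ _ _ _ (fun z => w z.1)).
  - by apply: measurable_funM => //; apply: measurableT_comp.
  - exact: integrableR_fst.
  - by move=> z; rewrite normrM (ger0_norm (w0 _)) ler_piMr.
have i2 s : integrableR rho (near0 s).
  exact: integrableR_bounded (measurable_band _ _) (b1 s).
split=> //; rewrite (Rfubini i1); last first.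
  by move=> y /=; exact: (integrableRZ (w y) (i2 (c y))).
rewrite -!RintZ// -RintD; [|exact: integrableRZ..].
apply: le_Rint.
- apply: (integrableR_fubini (f := fun z => w z.1 * near0 (c z.1) z.2)) => //.
  by move=> y /=; exact: (integrableRZ (w y) (i2 (c y))).
- by apply: integrableRD; exact: integrableRZ.
- move=> y /=; rewrite (RintZ (w y) (i2 (c y))).
  by have := ler_wpM2l (w0 y) (near0_int (c y)); lra.
Qed.

Let M'_mean : integrableR rho (fun u => `|M' u|) /\
  \int[rho]_u `|M' u| <= 2 + 2 * kap.
Proof.
have iM'PP : integrableR PP (fun z => `|M' z.2|).
  apply: (@integrableR_le _ _ _ _ _
      (fun z => (M z - L z) + (`|L z| + (`|xi z.1| + e z.1)))).
  - by apply: measurableT_comp => //; apply: measurableT_comp.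
  - apply: integrableRD => //; apply: integrableRD; first exact: integrableR_norm.
    apply: (integrableR_fst _ (a := fun y => `|xi y| + e y)).
    by apply: integrableRD => //; exact: integrableR_norm.
  - move=> z; rewrite normr_id.
    have -> : M' z.2 = (M z - L z) + (L z + (- xi z.1 - (M z - M' z.2 - xi z.1))).
      by ring.
    rewrite (le_trans (ler_normD _ _))// ger0_norm ?subr_ge0// lerD2l.
    rewrite (le_trans (ler_normD _ _))// lerD2l.
    by rewrite (le_trans (ler_normB _ _))// normrN lerD2l.
have iM' : integrableR rho (fun u => `|M' u|).
  apply: integrableR_ge0 => //; first exact: measurableT_comp.
  case/integrableP : iM'PP => _; rewrite fubini_tonelli2//=; last first.
    apply/measurable_EFinP; do 2 apply: measurableT_comp => //.
    exact: measurableT_comp.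
  rewrite /fubini_G /=; congr (_ < _)%E; apply: eq_integral => u _.
  by rewrite integral_cst//= probability_setT mule1 normr_id.
split=> //; rewrite -(Rint_snd nu iM').
have isum : integrableR PP (fun z => `|xi z.1| + e z.1).
  apply: (integrableR_fst _ (a := fun y => `|xi y| + e y)).
  by apply: integrableRD => //; exact: integrableR_norm.
apply: (@le_trans _ _ (\int[PP]_z
    ((M z - L z) + (`|L z| + (`|xi z.1| + e z.1))))).
  apply: le_Rint => //.
    apply: integrableRD => //; apply: integrableRD => //.
    exact: integrableR_norm.
  move=> z.
  have -> : M' z.2 = (M z - L z) + (L z + (- xi z.1 - (M z - M' z.2 - xi z.1))).
    by ring.
  rewrite (le_trans (ler_normD _ _))// ger0_norm ?subr_ge0// lerD2l.
  rewrite (le_trans (ler_normD _ _))// lerD2l.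
  by rewrite (le_trans (ler_normB _ _))// normrN lerD2l.
have iLn : integrableR PP (fun z => `|L z|) by exact: integrableR_norm.
have iy : integrableR nu (fun y => `|xi y| + e y).
  by apply: integrableRD => //; exact: integrableR_norm.
have /= E := Rint_fst rho iy.
rewrite (RintD iD (integrableRD iLn isum)) (RintD iLn isum) E.
by have := xiDe; have := L2; have := MBL; lra.
Qed.

(** The variance error [be] is weighted by the bound 2 on [stein_der], the mean error [al] by the
    bound [x^-1] on [stein_sol], and all other errors are multiples of [kap]. *)
Theorem stein_bound : integrableR PP (fun z => exp_step x (M z)) /\
  \int[PP]_z exp_step x (M z) <=
    exp_step_mean x + 2 * be + al / x + 209 * kap * x.
Proof.
have mf : measurable_fun setT f := measurable_stein_sol x.
have mfM : measurable_fun setT (fun z => f (M z)) by exact: measurableT_comp.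
have mfM' : measurable_fun setT (fun u => f (M' u)) by exact: measurableT_comp.
have mh : measurable_fun setT (exp_step x) := measurable_exp_step x.
have mhM' : measurable_fun setT (fun u => exp_step x (M' u)).
  exact: measurableT_comp.
have mgM' : measurable_fun setT (fun u => g (M' u)).
  by rewrite /stein_der; mfun.
have ih : integrableR PP (fun z => exp_step x (M z)).
  apply: (@integrableR_bounded _ _ _ _ _ 1); first exact: measurableT_comp.
  by move=> z; rewrite ger0_norm; case/andP: (exp_step_01 x1 (M z)).
split=> //.
have iM (a h : T1 * T2 -> R) c : integrableR PP a -> measurable_fun setT h ->
    (forall z, `|h z| <= c) -> integrableR PP (fun z => a z * h z).
  move=> ia mh' hc; have ma := integrableR_measurable ia.
  apply: (@integrableR_le _ _ _ _ _ (fun z => c * `|a z|)).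
  - exact: measurable_funM.
  - exact/integrableRZ/integrableR_norm.
  - by move=> z; rewrite normrM mulrC ler_wpM2r.
have [iM'n M'2] := M'_mean.
have ixin : integrableR nu (fun y => `|xi y|) by exact: integrableR_norm.
have ish : integrableR nu sh by exact: integrableRD.
have ic c : integrableR nu (fun=> c) by exact: integrableR_cst.
have iF1 : integrableR PP (fun z => xi z.1 * f (M z)).
  exact: iM (integrableR_fst _ ixi) mfM (fun=> stein_sol_le x1 _).
have iF2 : integrableR PP (fun z => L z * f (M z)).
  exact: iM iL mfM (fun=> stein_sol_le x1 _).
have igM' : integrableR rho (fun u => g (M' u)).
  exact: integrableR_bounded mgM' (fun=> stein_der_le x1 _).
have ifM' : integrableR rho (fun u => f (M' u)).
  exact: integrableR_bounded mfM' (fun=> stein_sol_le x1 _).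
have ia1 : integrableR nu (fun y => 1 - n * xi y ^+ 2).
  by apply: integrableRB => //; exact: integrableRZ.
have ia2 : integrableR nu (fun y => sh y + n * `|xi y| ^+ 3).
  by apply: integrableRD => //; exact: integrableRZ.
have ib2 : integrableR rho (fun u => 1 + x + 2 * `|M' u|).
  by apply: integrableRD; [exact: integrableR_cst|exact: integrableRZ].
have j1 := integrableR_prodM ia1 igM'.
have j2 := integrableR_prodM ixi ifM'.
have j3 := integrableR_prodM ia2 ib2.
have j4 := integrableR_fst rho ixie.
have [j5 J5] := @near0_fubini (fun=> 1) sh (fun=> ler01) (ic 1) (integrableR_measurable ish)
  (integrableRZ 1 (integrableR_norm ish)).
have ixi3' : integrableR nu (fun y => xi y ^+ 2 * `|xi y|).
  apply: eq_integrableR ixi3 => y.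
  by rewrite -[xi y ^+ 2](real_normK (num_real _)) -exprSr.
have [j6 J6] := @near0_fubini (fun y => xi y ^+ 2) xi (fun y => sqr_ge0 (xi y)) ixi2 mxi ixi3'.
have j5' : integrableR PP (fun z => near0 (sh z.1) z.2).
  by apply: eq_integrableR j5 => z; rewrite mul1r.
have J5' : \int[PP]_z near0 (sh z.1) z.2 <= 32 * kap.
  rewrite (eq_Rintegral PP (g := fun z => 1 * near0 (sh z.1) z.2)); last first.
    by move=> z _; rewrite mul1r.
  rewrite (le_trans J5)// Rint_cst.
  rewrite (eq_Rintegral nu (g := sh)); last first.
    by move=> y _; rewrite mul1r ger0_norm// addr_ge0.
  by have := xiDe; rewrite -/sh; lra.
have X2 := xi2; rewrite ler_norml in X2.
have J6' : n * \int[PP]_z (xi z.1 ^+ 2 * near0 (xi z.1) z.2) <= 77 / 2 * kap.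
  rewrite (le_trans (ler_wpM2l n0 J6))//.
  rewrite (eq_Rintegral nu (g := fun y => `|xi y| ^+ 3)); last first.
    by move=> y _; rewrite -[xi y ^+ 2](real_normK (num_real _)) -exprSr.
  set A2 := \int[nu]_y (xi y ^+ 2) in X2 *; set A3 := \int[nu]_y (_ ^+ 3).
  have A3k : n * A3 <= kap by [].
  have nA2 : n * A2 <= 5 / 4 by have := be14; move: X2; lra.
  have := ler_wpM2l (ltW kap0) nA2; lra.
have k5 := integrableRD j5' (integrableRZ (4 * n) j6).
have k4 := integrableRD (integrableRZ (2 * n) j4) iD.
have k45 := integrableRD k4 k5.
have k3 := integrableRD j3 k45.
have k12 := integrableRD j1 (integrableRZ (- n) j2).
have k123 := integrableRD k12 k3.
have kF := integrableRB (integrableRZ n iF1) iF2.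
have kall := integrableRD kF k123.
have := le_Rint (integrableRB ih (integrableR_cst _ (exp_step_mean x))) kall
  stein_pointwise.
rewrite (RintB ih (integrableR_cst _ _)) Rint_cst.
rewrite (RintD kF k123) (RintB (integrableRZ n iF1) iF2) (RintZ n iF1).
rewrite (exchange mf); last by exists x^-1 => t; exact: stein_sol_le.
rewrite subrr add0r.
rewrite (RintD k12 k3) (RintD j1 (integrableRZ (- n) j2)) (RintZ (- n) j2).
rewrite (RintD j3 k45) (RintD k4 k5) (RintD (integrableRZ (2 * n) j4) iD).
rewrite (RintZ (2 * n) j4) (RintD j5' (integrableRZ (4 * n) j6)).
rewrite (RintZ (4 * n) j6).
rewrite (Rint_prodM ia1 igM') (Rint_prodM ixi ifM') (Rint_prodM ia2 ib2).
rewrite (Rint_fst rho ixie).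
rewrite (RintB (ic 1) (integrableRZ n ixi2)) (RintZ n ixi2) Rint_cst.
rewrite (RintD ish (integrableRZ n ixi3)) (RintZ n ixi3).
rewrite (RintD (integrableR_cst rho (1 + x)) (integrableRZ 2 iM'n)).
rewrite Rint_cst (RintZ 2 iM'n).
have G2 : `|\int[rho]_u g (M' u)| <= 2.
  exact: Rint_bounded mgM' (fun=> stein_der_le x1 _).
have F2 : `|\int[rho]_u f (M' u)| <= x^-1.
  exact: Rint_bounded mfM' (fun=> stein_sol_le x1 _).
have x0 : 0 < x by exact: lt_le_trans x1.
set A1 := \int[nu]_y xi y; set A2 := \int[nu]_y (xi y ^+ 2) in X2 *.
set A3 := \int[nu]_y (`|xi y| ^+ 3); set A4 := \int[nu]_y (_ * e y).
set Gm := \int[rho]_u g (M' u) in G2 *; set Fm := \int[rho]_u f (M' u) in F2 *.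
set S := \int[nu]_y sh y; set Mm := \int[rho]_u `|M' u| in M'2 *.
set I5 := \int[PP]_z near0 _ _ in J5' *.
set I6 := \int[PP]_z (_ * near0 _ _) in J6' *.
clear iF1 iF2 igM' ifM' ia1 ia2 ib2 j1 j2 j3 j4 j5 J5 ixi3' j6 J6 j5' k5 k4 k45 k3
  k12 k123 kF kall.
have S1 : S <= kap by exact: xiDe.
have A3k : n * A3 <= kap by exact: xi3.
have A4k : n * A4 <= kap by exact: xie.
have Dk : \int[PP]_z (M z - L z) <= kap by exact: MBL.
have t1 : (1 - n * A2) * Gm <= 2 * be.
  rewrite (le_trans (ler_norm _))// normrM mulrC ler_pM// distrC.
  exact: xi2.
have t2 : - n * (A1 * Fm) <= al / x.
  rewrite mulrA (le_trans (ler_norm _))// normrM ler_pM//.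
  by rewrite normrM normrN (ger0_norm n0).
have Mm0 : 0 <= Mm by apply: Rintegral_ge0.
have t3 : (S + n * A3) * (1 + x + 2 * Mm) <= 2 * kap * (9 + x).
  have S0 : 0 <= S by apply: Rintegral_ge0 => y _; rewrite addr_ge0.
  have A30 : 0 <= n * A3.
    by rewrite mulr_ge0//; apply: Rintegral_ge0 => y _; rewrite exprn_ge0.
  apply: ler_pM; first exact: addr_ge0.
  - exact: addr_ge0 (addr_ge0 ler01 (ltW x0)) (mulr_ge0 (ler0n _ 2) Mm0).
  - by rewrite mulr_natl mulr2n lerD.
  - by have := kap1; lra.
(* In units of [kap] the remaining terms are [18 + 2 * x] from the smooth part, 3 from [e] and
   [M - L], and 32 + 154 from the jump: at most [209 * x] in all. *)
have kx : kap <= kap * x by rewrite ler_peMr// ltW.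
by have := kap0; lra.
Qed.

End almost_additive.

(** * Quadratic-exponential tilts *)

Section exp_taylor.
Context {R : realType}.
Implicit Types (t z k : R).

(** The mean value theorem gains one power of [|t|] per order and keeps the exponential factor;
    factorials are given away. *)
Lemma taylor_step (r q : R -> R) (n : nat) : (forall t, is_derive t 1 r (q t)) ->
  r 0 = 0 -> (forall t, `|q t| <= `|t| ^+ n * expR `|t|) ->
  forall t, `|r t| <= `|t| ^+ n.+1 * expR `|t|.
Proof.
move=> dr r0 qb t.
have cr a c : {within `[a, c], continuous r}.
  by apply: derivable_within_continuous => y _; have [] := dr y.
have key c : `|c| <= `|t| -> r t = q c * t ->
    `|r t| <= `|t| ^+ n.+1 * expR `|t|.
  move=> ct ->; rewrite normrM exprSr mulrAC ler_wpM2r//.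
  rewrite (le_trans (qb c))// ler_pM ?exprn_ge0 ?expR_ge0 ?ler_expR//.
  by rewrite lerXn2r// nnegrE.
have [t0|t0] := leP 0 t.
  have [c] := MVT_segment t0 (fun y _ => dr y) (cr _ _).
  rewrite in_itv /= r0 !subr0 => /andP[c0 ct] E; apply: key E.
  by rewrite !ger0_norm.
have [c] := MVT_segment (ltW t0) (fun y _ => dr y) (cr _ _).
rewrite in_itv /= r0 !sub0r => /andP[ct c0] E; apply: (key c).
  by rewrite !ler0_norm ?lerN2// ltW.
by apply: oppr_inj; rewrite E mulrN.
Qed.

Lemma expR_taylor1 t : `|expR t - 1| <= `|t| * expR `|t|.
Proof.
apply: (@taylor_step (fun t => expR t - 1) expR 0).
- by move=> u; apply: is_derive_eq; rewrite ?subr0 ?scaler1 ?mul1r ?addr0.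
- by rewrite /= expR0 subrr.
- by move=> u; rewrite expr0 mul1r ger0_norm ?expR_ge0// ler_expR ler_norm.
Qed.

Lemma expR_taylor2 t : `|expR t - 1 - t| <= `|t| ^+ 2 * expR `|t|.
Proof.
apply: (@taylor_step (fun t => expR t - 1 - t) (fun t => expR t - 1) 1).
- by move=> u; apply: is_derive_eq; rewrite ?subr0 ?scaler1 ?mul1r ?addr0.
- by rewrite /= expR0 subrr subr0.
- by move=> u; rewrite expr1 expR_taylor1.
Qed.

Lemma expR_taylor3 t : `|expR t - 1 - t - t ^+ 2 / 2| <= `|t| ^+ 3 * expR `|t|.
Proof.
apply: (@taylor_step (fun t => expR t - 1 - t - t ^+ 2 / 2)
  (fun t => expR t - 1 - t) 2).
- move=> u; apply: is_derive_eq; rewrite /GRing.scale/=; by field.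
- by rewrite expR0 subrr expr0n /= mul0r !subr0.
- exact: expR_taylor2.
Qed.

Lemma expR_taylor4 t :
  `|expR t - 1 - t - t ^+ 2 / 2 - t ^+ 3 / 6| <= `|t| ^+ 4 * expR `|t|.
Proof.
apply: (@taylor_step (fun t => expR t - 1 - t - t ^+ 2 / 2 - t ^+ 3 / 6)
  (fun t => expR t - 1 - t - t ^+ 2 / 2) 3).
- move=> u; apply: is_derive_eq; rewrite /GRing.scale/=; by field.
- by rewrite /= expR0 subrr !expr0n /= !mul0r !subr0.
- exact: expR_taylor3.
Qed.

(** The weight of the tilt at [z = b * y]. Its quadratic term keeps it bounded, so that the tilt
    exists without exponential moments. *)
Definition quadexp k z : R := expR (z - k * z ^+ 2).

Fact qc_key : unit. Proof. exact: tt. Qed.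
(** One constant for all estimates on the weight, locked so that arithmetic tactics treat it as an
    atom. *)
Definition qc : R := locked_with qc_key (2048 * expR 2).

Lemma qcE : qc = 2048 * expR 2. Proof. by rewrite /qc unlock. Qed.

Lemma expR2_ge1 : 1 <= expR 2 :> R.
Proof. by rewrite -[leLHS]expR0 ler_expR. Qed.

Lemma qc_ge : 2048 <= qc.
Proof. by rewrite qcE; have := expR2_ge1; lra. Qed.

(** An eighth of [z ^+ 2] is set aside: [z - z ^+ 2 / 8] peaks at [z = 4] with value 2, whence
    [expR 2]. The rest dominates the cube, since [expR (z ^+ 2 / 8) >= (1 + z ^+ 2 / 16) ^+ 2], and
    2048 = 8 * 16 ^+ 2. *)
Lemma quadexp_poly k z : 1 / 4 <= k -> (1 + `|z|) ^+ 3 * quadexp k z <= qc.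
Proof.
move=> k4; rewrite /quadexp qcE.
have -> : z - k * z ^+ 2 = (z - k * z ^+ 2 + z ^+ 2 / 8) + - (z ^+ 2 / 8) by ring.
rewrite expRD mulrCA [leRHS]mulrC; apply: ler_pM.
- exact: expR_ge0.
- by rewrite mulr_ge0 ?expR_ge0 ?exprn_ge0// addr_ge0.
- by rewrite ler_expR; have := sqr_ge0 (z - 4); have := sqr_ge0 z; nra.
rewrite expRN ler_pdivrMr ?expR_gt0//.
have -> : z ^+ 2 / 8 = z ^+ 2 / 16 + z ^+ 2 / 16 by field.
have := expR_ge1Dx (z ^+ 2 / 16); rewrite expRD -(real_normK (num_real z)).
have := normr_ge0 z; set a := `|z|; set e := expR _ => a0 ea.
have e2 : (1 + a ^+ 2 / 16) * (1 + a ^+ 2 / 16) <= e * e.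
  by rewrite ler_pM// addr_ge0// divr_ge0// sqr_ge0.
apply: (@le_trans _ _ (2048 * ((1 + a ^+ 2 / 16) * (1 + a ^+ 2 / 16)))); last lra.
have [a1|a1] := leP a 1.
  have : (1 + a) ^+ 3 <= 2 ^+ 3 by rewrite lerXn2r ?nnegrE ?addr_ge0//; lra.
  have := sqr_ge0 (a ^+ 2); have := sqr_ge0 a; nra.
have : (1 + a) ^+ 3 <= (2 * a) ^+ 3.
  by rewrite lerXn2r ?nnegrE ?addr_ge0 ?mulr_ge0//; lra.
have : a ^+ 3 <= a ^+ 4 by rewrite [leRHS]exprS ler_peMl ?exprn_ge0// ltW.
have := sqr_ge0 a; rewrite exprMn.
have -> : a ^+ 4 = a ^+ 2 * a ^+ 2 by rewrite -exprD.
nra.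
Qed.

Lemma quadexp_gt0 k z : 0 < quadexp k z.
Proof. exact: expR_gt0. Qed.

Lemma quadexp_le k z : 1 / 4 <= k -> quadexp k z <= qc.
Proof.
move=> k4; apply: le_trans (quadexp_poly z k4).
rewrite ler_peMl ?(ltW (quadexp_gt0 _ _))//.
by apply: exprn_ege1; rewrite lerDl.
Qed.

Let small k z : 0 <= k <= 1 -> `|z| <= 1 ->
  `|z - k * z ^+ 2| <= 2 * `|z| /\ expR `|z - k * z ^+ 2| <= expR 2.
Proof.
move=> k01 z1; have B : `|z - k * z ^+ 2| <= 2 * `|z|.
  have -> : z - k * z ^+ 2 = z * (1 - k * z) by ring.
  rewrite normrM mulrC ler_wpM2r//; move: z1; rewrite !ler_norml; nra.
by split=> //; rewrite ler_expR (le_trans B)//; lra.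
Qed.

(** Taylor's bound serves for [|z| <= 1]; beyond, the weight is at most [qc] and the power of [|z|]
    exceeds 1. The next three expansions split in the same way. *)
Lemma quadexp_taylor1 k z : 1 / 4 <= k <= 1 -> `|quadexp k z - 1| <= qc * `|z|.
Proof.
move=> /andP[k4 k1]; have k0 : 0 <= k <= 1 by apply/andP; split=> //; lra.
have E2 := expR2_ge1; have q0 := qc_ge.
have [z1|z1] := leP `|z| 1.
  have [B1 B2] := small k0 z1.
  rewrite (le_trans (expR_taylor1 _))//.
  apply: (@le_trans _ _ ((2 * `|z|) * expR 2)); first exact: ler_pM.
  by rewrite qcE; have := normr_ge0 z; nra.
have := quadexp_le z k4; have := quadexp_gt0 k z.
by rewrite ler_norml; nra.
Qed.

Lemma quadexp_taylor2 k z : 1 / 4 <= k <= 1 ->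
  `|quadexp k z - 1 - z| <= 2 * qc * z ^+ 2.
Proof.
move=> /andP[k4 k1]; have k0 : 0 <= k <= 1 by apply/andP; split=> //; lra.
have E2 := expR2_ge1; have q0 := qc_ge; have z20 := sqr_ge0 z.
have [z1|z1] := leP `|z| 1.
  have [B1 B2] := small k0 z1.
  have := expR_taylor2 (z - k * z ^+ 2); rewrite -/(quadexp k z).
  have : `|z - k * z ^+ 2| ^+ 2 * expR `|z - k * z ^+ 2| <=
      (2 * `|z|) ^+ 2 * expR 2.
    by rewrite ler_pM ?exprn_ge0 ?expR_ge0// lerXn2r ?nnegrE ?mulr_ge0.
  rewrite exprMn (real_normK (num_real z)) => H /le_trans/(_ H).
  rewrite qcE !ler_norml; nra.
have := quadexp_le z k4; have := quadexp_gt0 k z.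
have zz : `|z| <= z ^+ 2.
  by rewrite -(real_normK (num_real z)) expr2 ler_peMl// ltW.
have : 0 <= (qc - 1) * (z ^+ 2 - 1) by rewrite mulr_ge0//; lra.
have : 0 <= (qc - 1) * z ^+ 2 by rewrite mulr_ge0//; lra.
have := ler_norm z; have := ler_norm (- z); rewrite normrN.
by rewrite (ler_norml (_ - _ - _)); lra.
Qed.

Lemma quadexp_taylor3 k z : 1 / 4 <= k <= 1 ->
  quadexp k z <= 1 + z + (1 / 2 - k) * z ^+ 2 + 3 * qc * `|z| ^+ 3.
Proof.
move=> /andP[k4 k1]; have k0 : 0 <= k <= 1 by apply/andP; split=> //; lra.
have E2 := expR2_ge1; have q0 := qc_ge; have z20 := sqr_ge0 z.
have [z1|z1] := leP `|z| 1.
  have [B1 B2] := small k0 z1.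
  have := expR_taylor3 (z - k * z ^+ 2); rewrite -/(quadexp k z).
  have : `|z - k * z ^+ 2| ^+ 3 * expR `|z - k * z ^+ 2| <=
      (2 * `|z|) ^+ 3 * expR 2.
    by rewrite ler_pM ?exprn_ge0 ?expR_ge0// lerXn2r ?nnegrE ?mulr_ge0.
  rewrite exprMn => H /le_trans/(_ H); rewrite ler_norml => /andP[_].
  have -> : (z - k * z ^+ 2) ^+ 2 / 2 =
      z ^+ 2 / 2 - k * z ^+ 3 + k ^+ 2 * z ^+ 4 / 2 by field.
  have zz3 : `|z ^+ 3| = `|z| ^+ 3 by rewrite normrX.
  have : - (k * z ^+ 3) <= `|z| ^+ 3.
    rewrite (le_trans (ler_norm _))// normrN normrM zz3 ler_piMl ?exprn_ge0//.
    by rewrite ger0_norm//; lra.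
  have : k ^+ 2 * z ^+ 4 / 2 <= `|z| ^+ 3.
    have -> : z ^+ 4 = `|z| ^+ 3 * `|z|.
      by rewrite (exprM z 2 2) -(real_normK (num_real z)); ring.
    have : k ^+ 2 <= 1 by rewrite expr_le1//; lra.
    have := exprn_ge0 3 (normr_ge0 z); have := normr_ge0 z.
    set a := `|z| in z1 *; set a3 := a ^+ 3; have := sqr_ge0 k => k20 a0 a30 k21.
    have : k ^+ 2 * (a3 * a) <= a3.
      rewrite mulrCA ler_piMr// mulr_ile1//.
    have := mulr_ge0 k20 (mulr_ge0 a30 a0).
    lra.
  have := exprn_ge0 3 (normr_ge0 z); rewrite qcE; nra.
have := quadexp_le z k4.
have : `|z| <= `|z| ^+ 3 by rewrite exprS ler_peMr// exprn_ege1// ltW.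
have : z ^+ 2 <= `|z| ^+ 3.
  by rewrite -(real_normK (num_real z)) [leRHS]exprS ler_peMl ?sqr_ge0// ltW.
have := ler_norm (- z); rewrite normrN.
have : 1 <= `|z| ^+ 3 by rewrite exprn_ege1// ltW.
nra.
Qed.

(** At [k = 1 / 2] the quadratic term vanishes and the cubic coefficient is 1/6 - 1/2. The minimum
    in the remainder switches from fourth to third order at [|z| = 1], so a third moment suffices to
    integrate it. *)
Lemma quadexp_taylor4 z :
  quadexp (1 / 2) z <=
  1 + z - z ^+ 3 / 3 + 3 * qc * (`|z| ^+ 3 * Num.min 1 `|z|).
Proof.
have k0 : 0 <= (1 / 2 : R) <= 1 by lra.
have k4 : (1 : R) / 4 <= 1 / 2 by lra.
have E2 := expR2_ge1; have q0 := qc_ge; have z20 := sqr_ge0 z.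
have a30 := exprn_ge0 3 (normr_ge0 z).
have zz3 : `|z ^+ 3| = `|z| ^+ 3 by rewrite normrX.
have [z1|z1] := leP `|z| 1.
  rewrite -exprSr.
  have [B1 B2] := small k0 z1.
  have := expR_taylor4 (z - 1 / 2 * z ^+ 2); rewrite -/(quadexp _ z).
  have : `|z - 1 / 2 * z ^+ 2| ^+ 4 * expR `|z - 1 / 2 * z ^+ 2| <=
      (2 * `|z|) ^+ 4 * expR 2.
    by rewrite ler_pM ?exprn_ge0 ?expR_ge0// lerXn2r ?nnegrE ?mulr_ge0.
  rewrite exprMn => H /le_trans/(_ H); rewrite ler_norml => /andP[_].
  have -> : (z - 1 / 2 * z ^+ 2) ^+ 2 / 2 =
      z ^+ 2 / 2 - z ^+ 3 / 2 + z ^+ 4 / 8 by field.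
  have -> : (z - 1 / 2 * z ^+ 2) ^+ 3 / 6 =
      z ^+ 3 / 6 - z ^+ 4 / 4 + z ^+ 5 / 8 - z ^+ 6 / 48 by field.
  have -> : z ^+ 4 = `|z| ^+ 4.
    by rewrite (exprM z 2 2) -(real_normK (num_real z)); ring.
  have : `|z ^+ 5| <= `|z| ^+ 4.
    by rewrite normrX exprS ler_piMl// exprn_ge0.
  have : 0 <= z ^+ 6 by rewrite exprn_even_ge0.
  have : z ^+ 6 <= `|z| ^+ 4.
    rewrite (le_trans (ler_norm _))// normrX (exprD _ 2 4) ler_piMl ?exprn_ge0//.
    by rewrite expr_le1.
  have := exprn_ge0 4 (normr_ge0 z); rewrite qcE ler_norml.
  set a := `|z| ^+ 4; set z6 := z ^+ 6; set z5 := z ^+ 5; nra.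
rewrite mulr1.
have := quadexp_le z k4.
have : `|z| <= `|z| ^+ 3 by rewrite exprS ler_peMr// exprn_ege1// ltW.
have := ler_norm (- z); rewrite normrN; have := ler_norm (z ^+ 3); rewrite zz3.
have : 1 <= `|z| ^+ 3 by rewrite exprn_ege1// ltW.
nra.
Qed.

End exp_taylor.

(** The density formula for nonnegative functions extends to signed ones through positive and
    negative parts. *)
Lemma integrableR_density d (T : measurableType d) (R : realType)
    (mu nu : probability T R) (h : T -> R) :
  measurable_fun setT h -> (forall y, 0 <= h y) ->
  (forall f : T -> \bar R, measurable_fun setT f -> (forall y, 0 <= f y)%E ->
    (\int[nu]_y f y = \int[mu]_y (f y * (h y)%:E))%E) ->
  forall g : T -> R, measurable_fun setT g ->
    integrableR mu (fun y => g y * h y) ->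
  integrableR nu g /\ \int[nu]_y g y = \int[mu]_y (g y * h y).
Proof.
move=> mh h0 E g mg ig.
have ge0 (a : T -> R) : measurable_fun setT a -> (forall y, 0 <= a y) ->
    integrableR mu (fun y => a y * h y) ->
    integrableR nu a /\ \int[nu]_y a y = \int[mu]_y (a y * h y).
  move=> ma a0 ia.
  have Ea : (\int[nu]_y (a y)%:E = \int[mu]_y (a y * h y)%:E)%E.
    rewrite E//; first by apply/measurable_EFinP.
  split; last by rewrite /Rintegral Ea.
  by apply: integrableR_ge0 => //; rewrite Ea -EFin_Rintegral// ltry.
have pm y : g y = Num.max (g y) 0 - Num.max (- g y) 0.
  by case: (leP (g y) 0); case: (leP (- g y) 0); lra.
have nm y : Num.max (g y) 0 <= `|g y| /\ Num.max (- g y) 0 <= `|g y|.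
  by rewrite !ge_max !normr_ge0 !andbT ler_norm -normrN ler_norm.
have [m1 m2] : measurable_fun setT (fun y => Num.max (g y) 0) /\
    measurable_fun setT (fun y => Num.max (- g y) 0) by split; mfun.
have p0 y : 0 <= Num.max (g y) 0 by rewrite le_max lexx orbT.
have n0 y : 0 <= Num.max (- g y) 0 by rewrite le_max lexx orbT.
have ip : integrableR mu (fun y => Num.max (g y) 0 * h y).
  apply: integrableR_le (integrableR_norm ig) _; first exact: measurable_funM.
  by move=> y; rewrite !normrM ler_wpM2r// ger0_norm//; case: (nm y).
have im : integrableR mu (fun y => Num.max (- g y) 0 * h y).
  apply: integrableR_le (integrableR_norm ig) _; first exact: measurable_funM.
  by move=> y; rewrite !normrM ler_wpM2r// ger0_norm//; case: (nm y).
have [jp Ep] := ge0 _ m1 p0 ip; have [jm Em] := ge0 _ m2 n0 im.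
split.
  apply: (@eq_integrableR _ _ _ _ (fun y => Num.max (g y) 0 - Num.max (- g y) 0)).
    by move=> y; rewrite -pm.
  exact: integrableRB.
transitivity (\int[nu]_y (Num.max (g y) 0 - Num.max (- g y) 0)).
  by apply: eq_Rintegral => y _; rewrite -pm.
rewrite RintB// Ep Em -RintB//; apply: eq_Rintegral => y _.
by rewrite -mulrBl -pm.
Qed.

(** * Moments of the entries against the tilting weight *)

Section tilted_moments.
Context {R : realType}.
Variable mu : probability R R.
Local Notation P := (fun y : R => (1 + `|y|) ^+ 3).
Hypothesis iP : integrableR mu P.
Hypothesis mu1 : \int[mu]_y y = 0.
Hypothesis mu2 : \int[mu]_y (y ^+ 2) = 1.

(** A single constant, at least 1, that dominates all absolute moments up to the third. *)
Definition rho3 : R := \int[mu]_y (1 + `|y|) ^+ 3.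
Local Notation c := (@qc R).
Local Notation rho := rho3.

Let P1 y : 1 <= P y. Proof. by apply: exprn_ege1; rewrite lerDl. Qed.

Lemma rho3_ge1 : 1 <= rho.
Proof.
rewrite -[leLHS](Rint_cst mu); apply: le_Rint => //; exact: integrableR_cst.
Qed.

Lemma poly3_le (f : R -> R) A : measurable_fun setT f ->
  (forall y, `|f y| <= A * P y) ->
  integrableR mu f /\ `|\int[mu]_y f y| <= A * rho.
Proof.
move=> mf fA; have fi : integrableR mu f.
  by apply: integrableR_le mf _ fA; exact: integrableRZ.
split=> //; rewrite (le_trans (Rint_norm fi))// -RintZ//.
by apply: le_Rint => //; [exact: integrableR_norm|exact: integrableRZ].
Qed.

Let iy : integrableR mu (fun y => y).
Proof.
apply: (poly3_le (A := 1) _ _).1; first by mfun.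
move=> y; rewrite mul1r; have := normr_ge0 y; set a := `|y| => a0.
by rewrite !exprS expr0; nra.
Qed.

Let iy2 : integrableR mu (fun y => y ^+ 2).
Proof.
apply: (poly3_le (A := 1) _ _).1; first by mfun.
move=> y; rewrite mul1r normrX; have := normr_ge0 y; set a := `|y| => a0.
by rewrite !exprS expr0; nra.
Qed.

Variables (b k : R).
Hypotheses (b0 : 0 < b) (b1 : b <= 1) (bs : 4 * c * rho * b <= 1).
Hypothesis k14 : 1 / 4 <= k <= 1.
Local Notation w := (fun y => quadexp k (b * y)).

Definition tilt_mass : R := \int[mu]_y quadexp k (b * y).
Local Notation m := tilt_mass.

Lemma measurable_tilt : measurable_fun setT w.
Proof. by rewrite /quadexp; mfun. Qed.
Let mw := measurable_tilt.

Let w0 y : 0 < w y. Proof. exact: quadexp_gt0. Qed.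
Let k4 : 1 / 4 <= k. Proof. by case/andP: k14. Qed.
Let wc y : w y <= c. Proof. exact: quadexp_le. Qed.
Let c0 : 0 <= c. Proof. by have := @qc_ge R; lra. Qed.

Let iw : integrableR mu w.
Proof.
apply: (poly3_le (A := c) _ _).1 => // y.
by rewrite ger0_norm ?(ltW (w0 y))// (le_trans (wc y))// ler_peMr.
Qed.

Let y2P (y : R) : y ^+ 2 <= P y.
Proof.
rewrite -(real_normK (num_real y)); have := normr_ge0 y; set a := `|y| => a0.
by rewrite !exprS expr0; nra.
Qed.

Let y3P (y : R) : `|y| * (y ^+ 2 + 1) <= P y.
Proof.
rewrite -(real_normK (num_real y)); have := normr_ge0 y; set a := `|y| => a0.
by rewrite !exprS expr0; nra.
Qed.

(** Since the mean vanishes, [1 + b * y] integrates to 1 and only the quadratic remainder of the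
    weight is left. *)
Lemma tilt_mass_sub1 : `|m - 1| <= 2 * c * b ^+ 2 * rho.
Proof.
have -> : m - 1 = \int[mu]_y (w y - 1 - b * y).
  rewrite RintB; [|exact: integrableRB iw (integrableR_cst _ _)|exact: integrableRZ].
  rewrite RintB ?RintZ//; last exact: integrableR_cst.
  by rewrite Rint_cst mu1 mulr0 subr0.
apply: (poly3_le _ _).2; first by mfun.
move=> y; rewrite (le_trans (quadexp_taylor2 _ k14))// exprMn.
rewrite [leLHS]mulrA ler_wpM2l//.
by rewrite mulr_ge0 ?sqr_ge0// mulr_ge0.
Qed.

Lemma tilt_mass_ge : 1 / 2 <= m.
Proof.
have := tilt_mass_sub1; rewrite ler_norml => /andP[+ _].
have : 2 * c * b ^+ 2 * rho <= 1 / 2.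
  have -> : 2 * c * b ^+ 2 * rho = (4 * c * rho * b) * (b / 2) by field.
  by have := bs; have := b1; have := b0; nra.
lra.
Qed.

Lemma tilt_mass_le : m <= 1 + (1 / 2 - k) * b ^+ 2 + 3 * c * b ^+ 3 * rho.
Proof.
have -> : 1 + (1 / 2 - k) * b ^+ 2 + 3 * c * b ^+ 3 * rho =
   \int[mu]_y (1 + b * y + (1 / 2 - k) * b ^+ 2 * y ^+ 2 + 3 * c * b ^+ 3 * P y).
  rewrite !RintD ?RintZ ?Rint_cst ?mu1 ?mu2 ?mulr0 ?addr0 ?mulr1 //;
    by do ?[exact: integrableR_cst | exact: integrableRZ |
            apply: integrableRD].
apply: le_Rint => //.
  by do ?[exact: integrableR_cst | exact: integrableRZ | apply: integrableRD].
move=> y; rewrite (le_trans (quadexp_taylor3 _ k14))// exprMn [_ * (b ^+ 2 * _)]mulrA.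
rewrite lerD2l normrM (ger0_norm (ltW b0)) exprMn [leLHS]mulrA ler_wpM2l//.
  by rewrite mulr_ge0 ?exprn_ge0 ?(ltW b0)// mulr_ge0.
by rewrite lerXn2r ?nnegrE ?addr_ge0// lerDr.
Qed.

Lemma Rint_quadexp_le (f : R -> R) A : measurable_fun setT f ->
  (forall y, `|f y| * w y <= A * P y) ->
  integrableR mu (fun y => f y * w y) /\ `|\int[mu]_y (f y * w y)| <= A * rho.
Proof.
move=> mf fA; apply: poly3_le; first exact: measurable_funM.
by move=> y; rewrite normrM (ger0_norm (ltW (w0 y))).
Qed.

(** As [y ^+ 2 - 1] has mean zero, the weight may be replaced by its difference from 1, of order
    [b * y]; the integrand stays cubic. *)
Lemma Rint_sqr_sub1_quadexp :
  `|\int[mu]_y ((y ^+ 2 - 1) * w y)| <= c * b * rho.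
Proof.
have i1 : integrableR mu (fun y => y ^+ 2 - 1).
  by apply: integrableRB => //; exact: integrableR_cst.
have mE : measurable_fun setT (fun y : R => (y ^+ 2 - 1) * (w y - 1)) by mfun.
have [i2 B] : integrableR mu (fun y => (y ^+ 2 - 1) * (w y - 1)) /\
    `|\int[mu]_y ((y ^+ 2 - 1) * (w y - 1))| <= c * b * rho.
  apply: poly3_le => // y; rewrite normrM.
  have T1 := quadexp_taylor1 (b * y) k14.
  have y21 : `|y ^+ 2 - 1| <= y ^+ 2 + 1.
    by rewrite ler_norml; have := sqr_ge0 y; lra.
  rewrite (le_trans (ler_pM _ _ y21 T1))// normrM (ger0_norm (ltW b0)).
  have := ler_wpM2l (mulr_ge0 c0 (ltW b0)) (y3P y); lra.
suff <- : \int[mu]_y ((y ^+ 2 - 1) * (w y - 1)) =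
          \int[mu]_y ((y ^+ 2 - 1) * w y) by [].
transitivity (\int[mu]_y ((y ^+ 2 - 1) * (w y - 1) + (y ^+ 2 - 1))).
  rewrite RintD// RintB//; last exact: integrableR_cst.
  by rewrite Rint_cst mu2 subrr addr0.
by apply: eq_Rintegral => y _; ring.
Qed.

(** Divided by [sqrt n], with [b = x / sqrt n], this is the contribution of one entry to the
    linearization of the normalized sum minus [x] times the normalized root of the sum of
    squares. *)
Definition tilt_lin (y : R) : R := y - b / 2 * (y ^+ 2 + 1).
Local Notation q := tilt_lin.

Let mq : measurable_fun setT q.
Proof. by rewrite /tilt_lin; mfun. Qed.

Let q_le y : `|q y| <= (1 + `|y|) * (1 + `|b * y|).
Proof.
rewrite /tilt_lin (le_trans (ler_normB _ _))// normrM !normrM.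
rewrite [`|b|]ger0_norm ?(ltW b0)// ger0_norm ?invr_ge0//.
rewrite ger0_norm ?addr_ge0 ?sqr_ge0// -(real_normK (num_real y)).
have := normr_ge0 y; set a := `|y| => a0.
by have := b1; have := b0; nra.
Qed.

Let poly_w y : (1 + `|b * y|) ^+ 3 * w y <= c.
Proof. exact: quadexp_poly. Qed.

Let one_w y j : (j <= 3)%N -> (1 + `|b * y|) ^+ j * w y <= c.
Proof.
move=> j3; apply: le_trans (poly_w y); rewrite ler_wpM2r ?(ltW (w0 y))//.
by apply: ler_weXn2l => //; rewrite lerDl.
Qed.

(** Up to three powers of [b * y] are absorbed by the weight, and up to three powers of [y] by the
    third moment. *)
Let onew_P y i j A : (i <= 3)%N -> (j <= 3)%N ->
  A <= (1 + `|y|) ^+ i * (1 + `|b * y|) ^+ j -> A * w y <= c * P y.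
Proof.
move=> i3 j3 /(ler_wpM2r (ltW (w0 y)))/le_trans; apply.
rewrite -mulrA [c * _]mulrC; apply: ler_pM.
- by rewrite exprn_ge0// addr_ge0.
- by rewrite mulr_ge0 ?(ltW (w0 y))// exprn_ge0// addr_ge0.
- by apply: ler_weXn2l => //; rewrite lerDl.
- exact: one_w.
Qed.

Lemma lin3_quadexp y : `|q y| ^+ 3 * w y <= c * P y.
Proof.
apply: (@onew_P y 3 3) => //; rewrite -exprMn.
by rewrite lerXn2r ?nnegrE ?mulr_ge0 ?addr_ge0.
Qed.

Lemma lin_quadexp y : `|q y| * w y <= c * P y.
Proof.
apply: (@onew_P y 1 1) => //; exact: q_le.
Qed.

Lemma lin_sqr_quadexp y : `|q y| * y ^+ 2 * w y <= c * P y.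
Proof.
apply: (@onew_P y 3 1) => //.
rewrite [(1 + `|y|) ^+ 3]exprS expr1 mulrAC; apply: ler_pM => //; first exact: sqr_ge0.
by rewrite -(real_normK (num_real y)) lerXn2r ?nnegrE ?addr_ge0// lerDr.
Qed.

Lemma sqr_quadexp y : y ^+ 2 * w y <= c * P y.
Proof.
apply: (@onew_P y 3 0) => //; rewrite expr0 mulr1; exact: y2P.
Qed.

(** One of the four factors is written [(b * y) / b] and absorbed by the weight, at the price of
    [b^-1]. *)
Lemma pow4_quadexp y : y ^+ 4 * w y <= c / b * P y.
Proof.
have -> : c / b * P y = b^-1 * (c * P y) by ring.
rewrite -ler_pdivrMl ?invr_gt0// invrK mulrA; apply: (@onew_P y 3 1) => //.
have -> : b * y ^+ 4 = `|y| ^+ 3 * `|b * y|.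
  rewrite (exprM y 2 2) -(real_normK (num_real y)) normrM (ger0_norm (ltW b0)).
  by ring.
by rewrite expr1 ler_pM ?exprn_ge0// ?lerXn2r ?nnegrE ?addr_ge0// lerDr.
Qed.

Lemma lin2_quadexp y : q y ^+ 2 * w y <= c * P y.
Proof.
apply: (@onew_P y 2 2) => //; rewrite -(real_normK (num_real (q y))) -exprMn.
by rewrite lerXn2r ?nnegrE ?mulr_ge0 ?addr_ge0.
Qed.

(** To first order the weight shifts the mean of [y] by [b], which is also the mean of the
    subtracted [b / 2 * (y ^+ 2 + 1)]. In the proof, [r] is what remains of [q * w] without the part
    of zero mean. *)
Lemma Rint_lin_quadexp : `|\int[mu]_y (q y * w y)| <= 3 * c * b ^+ 2 * rho.
Proof.
pose r y := y * (w y - 1 - b * y) - b / 2 * ((y ^+ 2 + 1) * (w y - 1)).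
have mr : measurable_fun setT r by rewrite /r; mfun.
have [ir B] : integrableR mu r /\ `|\int[mu]_y r y| <= 3 * c * b ^+ 2 * rho.
  apply: poly3_le => // y; rewrite /r (le_trans (ler_normB _ _))// !normrM.
  have T1 := quadexp_taylor1 (b * y) k14.
  have T2 := quadexp_taylor2 (b * y) k14.
  have := ler_wpM2l (normr_ge0 y) T2.
  have y210 : 0 <= y ^+ 2 + 1 by rewrite addr_ge0 ?sqr_ge0.
  have := ler_wpM2l y210 T1; rewrite normrM !(ger0_norm (ltW b0)).
  rewrite (ger0_norm y210) (@ger0_norm _ 2^-1) ?invr_ge0// exprMn.
  set v := `|w y - 1|; set v' := `|w y - 1 - b * y|.
  move=> /(ler_wpM2l (ltW b0)) U1 U2.
  have Y := ler_wpM2l (mulr_ge0 c0 (sqr_ge0 b)) (y3P y).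
  have Y2 := mulr_ge0 (mulr_ge0 c0 (sqr_ge0 b)) (normr_ge0 y).
  have PY := mulr_ge0 (mulr_ge0 c0 (sqr_ge0 b)) (le_trans ler01 (P1 y)).
  lra.
suff -> : \int[mu]_y (q y * w y) = \int[mu]_y r y by [].
transitivity (\int[mu]_y (r y + (y + b / 2 * (y ^+ 2 - 1)))).
  by apply: eq_Rintegral => y _; rewrite /r /tilt_lin; field.
have i1 : integrableR mu (fun y => y ^+ 2 - 1).
  by apply: integrableRB => //; exact: integrableR_cst.
rewrite (RintD ir (integrableRD iy (integrableRZ (b / 2) i1))).
rewrite (RintD iy (integrableRZ (b / 2) i1)) (RintZ _ i1).
by rewrite (RintB iy2 (integrableR_cst _ _)) Rint_cst mu1 mu2 subrr mulr0 !addr0.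
Qed.

Lemma Rint_lin2_quadexp :
  `|\int[mu]_y ((q y ^+ 2 - 1) * w y)| <= 3 * c * b * rho.
Proof.
have m1 : measurable_fun setT (fun y : R => (q y ^+ 2 - y ^+ 2)) by mfun.
have m2 : measurable_fun setT (fun y : R => y ^+ 2 - 1) by mfun.
have [i1 B1] : integrableR mu (fun y => (q y ^+ 2 - y ^+ 2) * w y) /\
    `|\int[mu]_y ((q y ^+ 2 - y ^+ 2) * w y)| <= 2 * b * c * rho.
  apply: Rint_quadexp_le => // y.
  have -> : 2 * b * c * P y = (2 * b) * (c * P y) by ring.
  rewrite -ler_pdivrMl ?mulr_gt0// mulrA; apply: (@onew_P y 3 1) => //.
  rewrite expr1 ler_pdivrMl ?mulr_gt0//.
  have -> : q y ^+ 2 - y ^+ 2 =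
      b * ((b * y ^+ 2 + b) * (y ^+ 2 + 1) / 4 - y * (y ^+ 2 + 1)).
    by rewrite /tilt_lin; field.
  rewrite (normrM b) (ger0_norm (ltW b0)).
  set Z := (1 + `|y|) ^+ 3 * _.
  have -> : 2 * b * Z = b * (2 * Z) by ring.
  rewrite {}/Z ler_wpM2l ?(ltW b0)//.
  have y210 : 0 <= y ^+ 2 + 1 by rewrite addr_ge0 ?sqr_ge0.
  have by20 : 0 <= b * y ^+ 2 + b.
    by rewrite addr_ge0 ?(ltW b0)// mulr_ge0 ?sqr_ge0 ?(ltW b0).
  have X0 : 0 <= (b * y ^+ 2 + b) * (y ^+ 2 + 1) / 4.
    by rewrite divr_ge0// mulr_ge0.
  rewrite (le_trans (ler_normB _ _))// (ger0_norm X0) (normrM y).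
  rewrite (ger0_norm y210) normrM (ger0_norm (ltW b0)).
  rewrite -(real_normK (num_real y)).
  have := normr_ge0 y; set a := `|y| => a0.
  have B0 := b0; have BB := b1.
  have t1 : b * a ^+ 2 + b <= (1 + a) * (1 + b * a) by nra.
  have t2 : a ^+ 2 + 1 <= (1 + a) ^+ 2 by nra.
  have t3 : (b * a ^+ 2 + b) * (a ^+ 2 + 1) <=
            ((1 + a) * (1 + b * a)) * (1 + a) ^+ 2.
    apply: ler_pM => //; first by rewrite addr_ge0 ?mulr_ge0 ?sqr_ge0 ?(ltW B0).
    by rewrite addr_ge0 ?sqr_ge0.
  have t4 : a * (a ^+ 2 + 1) <= (1 + a) ^+ 3 * (1 + b * a).
    apply: (@le_trans _ _ ((1 + a) ^+ 3)); first by rewrite !exprS expr0; nra.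
    by rewrite ler_peMr ?exprn_ge0 ?addr_ge0// lerDl mulr_ge0 ?(ltW B0).
  have t0 : 0 <= (b * a ^+ 2 + b) * (a ^+ 2 + 1).
    by rewrite mulr_ge0 ?addr_ge0 ?mulr_ge0 ?sqr_ge0 ?(ltW B0).
  lra.
have [i2 _] : integrableR mu (fun y => (y ^+ 2 - 1) * w y) /\
    `|\int[mu]_y ((y ^+ 2 - 1) * w y)| <= 2 * c * rho.
  apply: Rint_quadexp_le => // y.
  have y21 : `|y ^+ 2 - 1| <= y ^+ 2 + 1.
    by rewrite ler_norml; have := sqr_ge0 y; lra.
  have := ler_wpM2r (ltW (w0 y)) y21; have := sqr_quadexp y.
  have : w y <= c * P y by rewrite (le_trans (wc y))// ler_peMr.
  by rewrite mulrDl mul1r; lra.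
have := Rint_sqr_sub1_quadexp => B2.
have -> : \int[mu]_y ((q y ^+ 2 - 1) * w y) =
    \int[mu]_y ((q y ^+ 2 - y ^+ 2) * w y) + \int[mu]_y ((y ^+ 2 - 1) * w y).
  by rewrite -RintD//; apply: eq_Rintegral => y _; ring.
rewrite (le_trans (ler_normD _ _))//; lra.
Qed.

End tilted_moments.

Section tilt.
Context {R : realType}.
Variable mu : probability R R.
Local Notation P := (fun y : R => (1 + `|y|) ^+ 3).
Hypothesis iP : integrableR mu P.
Hypothesis mu1 : \int[mu]_y y = 0.
Hypothesis mu2 : \int[mu]_y (y ^+ 2) = 1.
Local Notation c := (@qc R).
Local Notation rho := (rho3 mu).
Local Notation m := (tilt_mass mu).

(** The normalized tilt through what is used of it: the inverse density, to change measure back, and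
    a rule that turns pointwise bounds under the weight into moments. The factor 2 bounds the
    inverse of the mass. *)
Lemma tilt_exists (b k : R) : 0 < b -> b <= 1 -> 4 * c * rho * b <= 1 ->
  1 / 4 <= k <= 1 ->
  exists nu : probability R R,
  (forall f : R -> \bar R, measurable_fun setT f -> (forall y, 0 <= f y)%E ->
    (\int[mu]_y f y =
     \int[nu]_y (f y * (m b k * expR (- (b * y - k * b ^+ 2 * y ^+ 2)))%:E))%E) /\
  (forall (f : R -> R) A, measurable_fun setT f ->
    (forall y, `|f y| * quadexp k (b * y) <= A * P y) ->
    [/\ integrableR nu f,
        \int[nu]_y f y = (m b k)^-1 * \int[mu]_y (f y * quadexp k (b * y)) &
        `|\int[nu]_y f y| <= 2 * A * rho]).
Proof.
move=> b0 b1 bs k14; set M := m b k.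
have M2 : 1 / 2 <= M by exact: tilt_mass_ge.
have M0 : 0 < M by lra.
have mw := measurable_tilt b k.
pose h y := M^-1 * quadexp k (b * y).
have h0 y : 0 <= h y by rewrite mulr_ge0 ?invr_ge0 ?(ltW M0)// ltW// quadexp_gt0.
have mh : measurable_fun setT h by rewrite /h; mfun.
have k4 : 1 / 4 <= k by case/andP: k14.
have P1 y : 1 <= P y by apply: exprn_ege1; rewrite lerDl.
have [iw _] : integrableR mu (fun y => quadexp k (b * y)) /\
    `|\int[mu]_y quadexp k (b * y)| <= c * rho.
  apply: poly3_le => // y; have w0 := quadexp_gt0 k (b * y).
  have := quadexp_le (b * y) k4; rewrite ger0_norm ?(ltW w0)// => H.
  by rewrite (le_trans H)// ler_peMr// (le_trans (ltW w0) H).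
have ih : integrableR mu h by exact: integrableRZ.
have h1 : \int[mu]_y h y = 1 by rewrite /h RintZ// mulVf// gt_eqF.
have [nu E] := density_probability h0 ih h1.
exists nu; split.
  move=> f mf f0; rewrite E.
  - apply: eq_integral => y _; rewrite -muleA -EFinM -[LHS]mule1.
    congr (_ * _%:E)%E; rewrite mulrACA divff ?gt_eqF// mul1r /quadexp -expRD.
    by rewrite (_ : _ + _ = 0) ?expR0//; ring.
  - by mfun.
  - by move=> y; rewrite mule_ge0// lee_fin mulr_ge0 ?expR_ge0 ?(ltW M0).
move=> f A mf fA; have [i1 B1] := Rint_quadexp_le iP mf fA.
have i2 : integrableR mu (fun y => f y * h y).
  by apply: eq_integrableR (integrableRZ M^-1 i1) => y; rewrite /h mulrCA.
have [j1 J1] := integrableR_density mh h0 E mf i2.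
have E1 : \int[nu]_y f y = M^-1 * \int[mu]_y (f y * quadexp k (b * y)).
  by rewrite J1 -RintZ//; apply: eq_Rintegral => y _; rewrite /h mulrCA.
split=> //; rewrite E1 normrM ger0_norm ?invr_ge0 ?(ltW M0)//.
rewrite mulrC ler_pdivrMr// (le_trans B1)//.
have : 0 <= A * rho by apply: le_trans B1.
nra.
Qed.

(** Dominated convergence along [b = 1 / (N + 1)], then monotonicity in [b]. A third moment gives no
    rate, so the threshold depends on [mu]. *)
Lemma cubic_truncation (eps : R) : 0 < eps ->
  exists2 b0, 0 < b0 & forall b, 0 <= b -> b <= b0 ->
    \int[mu]_y (`|y| ^+ 3 * Num.min 1 `|b * y|) <= eps.
Proof.
move=> eps0.
have i3 : integrableR mu (fun y => `|y| ^+ 3).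
  apply: (poly3_le iP (A := 1) _ _).1; first by mfun.
  move=> y; rewrite mul1r normrX normr_id lerXn2r ?nnegrE ?addr_ge0//.
  by rewrite lerDr.
have min01 (b y : R) : 0 <= Num.min 1 `|b * y| <= 1.
  by rewrite le_min ler01 normr_ge0 ge_min lexx.
pose F (n : nat) (y : R) : \bar R := (`|y| ^+ 3 * Num.min 1 `|n.+1%:R^-1 * y|)%:E.
have mF (b : R) : measurable_fun setT (fun y : R => `|y| ^+ 3 * Num.min 1 `|b * y|).
  by mfun.
have iF (b : R) : integrableR mu (fun y => `|y| ^+ 3 * Num.min 1 `|b * y|).
  apply: integrableR_le i3 _ => // y; have /andP[m0 m1] := min01 b y.
  by rewrite normrM normrX normr_id (ger0_norm m0) ler_piMr// exprn_ge0.
have cvF : (\int[mu]_y F n y)%E @[n --> \oo] --> (\int[mu]_y (fun=> 0) y)%E.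
  apply: (@dominated_cvg _ _ _ mu setT measurableT F (fun=> 0%E)
    (fun y => (`|y| ^+ 3)%:E)).
  - by move=> n; apply/measurable_EFinP; exact: mF.
  - move=> y _; apply/fine_cvgP; split; first exact: nearW.
    rewrite /F /=.
    have : `|y| ^+ 3 * `|n.+1%:R^-1 * y| @[n --> \oo] --> (0 : R).
      have -> : (fun n => `|y| ^+ 3 * `|n.+1%:R^-1 * y|) =
                (fun n : nat => `|y| ^+ 3 * `|y| * n.+1%:R^-1).
        apply/funext => n; rewrite normrM ger0_norm ?invr_ge0//; ring.
      rewrite -(mulr0 (`|y| ^+ 3 * `|y|)).
      by apply: cvgMr; exact: cvg_harmonic.
    apply: squeeze_cvgr; last exact: cvg_cst.
    apply: nearW => n; have /andP[m0 m1] := min01 n.+1%:R^-1 y.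
    by rewrite mulr_ge0 ?exprn_ge0//= ler_wpM2l ?exprn_ge0// ge_min lexx orbT.
  - by [].
  - exact: i3.
  - move=> n y _; have /andP[m0 m1] := min01 n.+1%:R^-1 y.
    rewrite /F /= lee_fin ger0_norm ?mulr_ge0 ?exprn_ge0//.
    by rewrite ler_piMr// exprn_ge0.
move: cvF; rewrite integral0 => /fine_cvgP[_ /cvgr_lt/(_ _ eps0)[N _ hN]].
exists N.+1%:R^-1; first by rewrite invr_gt0.
move=> b bge0 bN; apply: le_trans (ltW (hN N (leqnn N))).
apply: le_Rint => // y; rewrite ler_wpM2l ?exprn_ge0//.
rewrite le_min ge_min lexx/= ge_min; apply/orP; right.
by rewrite !normrM ler_wpM2r// !ger0_norm// ?invr_ge0.
Qed.

Lemma tilt_mass_skew : 0 < \int[mu]_y (y ^+ 3) ->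
  exists2 b0, 0 < b0 & forall b, 0 < b -> b <= b0 ->
    m b (1 / 2) <= 1 - (\int[mu]_y (y ^+ 3)) * b ^+ 3 / 6.
Proof.
set ga := \int[mu]_y (y ^+ 3) => ga0.
have c0 : 0 < c by have := @qc_ge R; lra.
(* With this accuracy the remainder [3 * c * b ^+ 3 * Jb] is at most [ga * b ^+ 3 / 6], half of the
   cubic term [ga * b ^+ 3 / 3]. *)
have e0 : 0 < ga / (18 * c) by rewrite divr_gt0// mulr_gt0.
have [b0 b00 hb0] := cubic_truncation e0.
exists b0 => // b bp bb; have /(_ bb) J := hb0 b (ltW bp).
have iy : integrableR mu (fun y => y).
  apply: (poly3_le iP (A := 1) _ _).1; first by mfun.
  move=> y; rewrite mul1r; have := normr_ge0 y; set a := `|y| => a0.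
  by rewrite !exprS expr0; nra.
have i3 : integrableR mu (fun y => y ^+ 3).
  apply: (poly3_le iP (A := 1) _ _).1; first by mfun.
  by move=> y; rewrite mul1r normrX lerXn2r ?nnegrE ?addr_ge0// lerDr.
have min01 y : 0 <= Num.min 1 `|b * y| <= 1.
  by rewrite le_min ler01 normr_ge0 ge_min lexx.
have iF : integrableR mu (fun y => `|y| ^+ 3 * Num.min 1 `|b * y|).
  apply: (poly3_le iP (A := 1) _ _).1; first by mfun.
  move=> y; have /andP[m0 m1] := min01 y.
  rewrite mul1r normrM normrX normr_id (ger0_norm m0).
  apply: (@le_trans _ _ (`|y| ^+ 3)); first by rewrite ler_piMr ?exprn_ge0.
  by rewrite lerXn2r ?nnegrE ?addr_ge0// lerDr.
have iw : integrableR mu (fun y => quadexp (1 / 2) (b * y)).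
  apply: (poly3_le iP (A := c) _ _).1; first exact: measurable_tilt.
  move=> y; have w0 := quadexp_gt0 (1 / 2) (b * y).
  have k4 : (1 : R) / 4 <= 1 / 2 by lra.
  have := quadexp_le (b * y) k4; rewrite ger0_norm ?(ltW w0)// => H.
  rewrite (le_trans H)// ler_peMr ?(ltW c0)//.
  by apply: exprn_ege1; rewrite lerDl.
have i1 := integrableRD (integrableR_cst mu 1) (integrableRZ b iy).
have i2 := integrableRZ (b ^+ 3 / 3) i3.
have i4 := integrableRZ (3 * c * b ^+ 3) iF.
have : m b (1 / 2) <= \int[mu]_y (1 + b * y - b ^+ 3 / 3 * y ^+ 3 +
    3 * c * b ^+ 3 * (`|y| ^+ 3 * Num.min 1 `|b * y|)).
  apply: le_Rint => //; first exact: integrableRD (integrableRB i1 i2) i4.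
  move=> y; rewrite (le_trans (quadexp_taylor4 _))// normrM !exprMn.
  rewrite (ger0_norm (ltW bp)).
  rewrite le_eqVlt; apply/orP; left; apply/eqP.
  by set mi := Num.min _ _; field.
rewrite (RintD (integrableRB i1 i2) i4) (RintB i1 i2).
rewrite (RintD (integrableR_cst mu 1) (integrableRZ b iy)) !RintZ// Rint_cst.
rewrite mu1 -/ga; set Jb := \int[mu]_y _ in J *.
move=> /le_trans; apply.
have := ler_wpM2l (ltW (mulr_gt0 (mulr_gt0 (ltr0n _ 3) c0) (exprn_gt0 3 bp))) J.
have -> : 3 * c * b ^+ 3 * (ga / (18 * c)) = ga * b ^+ 3 / 6.
  by field; rewrite gt_eqF.
lra.
Qed.

End tilt.

(** * Exceptional values of the sum of squares *)

Section chord.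
Context {R : realType}.
Variable mu : probability R R.
Local Notation P := (fun y : R => (1 + `|y|) ^+ 3).
Hypothesis iP : integrableR mu P.
Hypothesis mu1 : \int[mu]_y y = 0.
Hypothesis mu2 : \int[mu]_y (y ^+ 2) = 1.
Local Notation c := (@qc R).
Local Notation rho := (rho3 mu).
Local Notation m := (tilt_mass mu).

Let c1 : 1 <= c. Proof. by have := @qc_ge R; lra. Qed.
Let rho1 : 1 <= rho. Proof. exact: rho3_ge1. Qed.

(** Under the tilt [y ^+ 2 - 1] has second moment of order [1 / b] and mean of order [b]. The two
    terms come from the [n] squares and from the off-diagonal products. *)
Lemma tilted_deviation (n : nat) (b k : R) (nu : probability R R) :
  (0 < n)%N -> 0 < b -> b <= 1 -> 4 * c * rho * b <= 1 -> 1 / 4 <= k <= 1 ->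
  (forall (f : R -> R) A, measurable_fun setT f ->
    (forall y, `|f y| * quadexp k (b * y) <= A * P y) ->
    [/\ integrableR nu f,
        \int[nu]_y f y = (m b k)^-1 * \int[mu]_y (f y * quadexp k (b * y)) &
        `|\int[nu]_y f y| <= 2 * A * rho]) ->
  integrableR (sumlaw nu n) (fun u => (u.2 - n%:R) ^+ 2) /\
  \int[sumlaw nu n]_u ((u.2 - n%:R) ^+ 2) <=
    n%:R ^+ 2 * (4 * c * rho / (b * n%:R) + 4 * c ^+ 2 * rho ^+ 2 * b ^+ 2).
Proof.
move=> n0 b0 b1 bs k14 nuf.
have mge : 1 / 2 <= m b k by exact: tilt_mass_ge.
have m0 : 0 < m b k by lra.
have n0' : 0 < n%:R :> R by rewrite ltr0n.
pose g := summand (0 : R) 1 (-1); pose S := addstat (0 : R) 1 (-1) n.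
have SE u : S u = u.2 - n%:R by rewrite /S /addstat mul0r add0r mul1r mulN1r.
have gE y : g y = y ^+ 2 - 1 by rewrite /g /summand mul0r add0r mul1r.
have P1 y : 1 <= P y by apply: exprn_ege1; rewrite lerDl.
have k4 : 1 / 4 <= k by case/andP: k14.
have w0 y := ltW (quadexp_gt0 k (b * y)).
have [i4 _ B4] : [/\ integrableR nu (fun y => y ^+ 4 + 1),
    \int[nu]_y (y ^+ 4 + 1) = (m b k)^-1 * \int[mu]_y ((y ^+ 4 + 1) * quadexp k (b * y)) &
    `|\int[nu]_y (y ^+ 4 + 1)| <= 2 * (c / b + c) * rho].
  apply: nuf; first by mfun.
  move=> y; rewrite ger0_norm ?addr_ge0 ?exprn_even_ge0// mulrDl mul1r mulrDl.
  apply: lerD; first exact: (pow4_quadexp b0 k14).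
  by rewrite (le_trans (quadexp_le _ k4))// ler_peMr// (le_trans ler01 c1).
have [i2 E2 _] : [/\ integrableR nu (fun y => y ^+ 2 - 1),
    \int[nu]_y (y ^+ 2 - 1) = (m b k)^-1 * \int[mu]_y ((y ^+ 2 - 1) * quadexp k (b * y)) &
    `|\int[nu]_y (y ^+ 2 - 1)| <= 2 * (2 * c) * rho].
  apply: nuf; first by mfun.
  move=> y.
  have y21 : `|y ^+ 2 - 1| <= y ^+ 2 + 1.
    by rewrite ler_norml; have := sqr_ge0 y; lra.
  have := ler_wpM2r (w0 y) y21; have := sqr_quadexp b k14 y.
  have : quadexp k (b * y) <= c * P y.
    by rewrite (le_trans (quadexp_le _ k4))// ler_peMr// (le_trans ler01 c1).
  by rewrite mulrDl mul1r; lra.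
have g2b : `|\int[nu]_y g y| <= 2 * c * rho * b.
  rewrite (eq_Rintegral nu (g := fun y => y ^+ 2 - 1)); last by move=> y _; rewrite gE.
  rewrite E2 normrM ger0_norm ?invr_ge0 ?(ltW m0)// mulrC ler_pdivrMr//.
  have := Rint_sqr_sub1_quadexp iP mu2 b0 k14.
  have := mulr_ge0 (mulr_ge0 (le_trans ler01 c1) (le_trans ler01 rho1)) (ltW b0).
  nra.
have ig2 : integrableR nu (fun y => g y ^+ 2).
  apply: integrableR_le i4 _; first by rewrite /g /summand; mfun.
  move=> y; rewrite gE ger0_norm ?sqr_ge0//.
  by rewrite (exprM y 2 2); have := sqr_ge0 y; set t := y ^+ 2 => t0; nra.
have g4 : \int[nu]_y (g y ^+ 2) <= 2 * (c / b + c) * rho.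
  apply: le_trans (le_trans (ler_norm _) B4).
  apply: le_Rint => // y; rewrite gE.
  by rewrite (exprM y 2 2); have := sqr_ge0 y; set t := y ^+ 2 => t0; nra.
have iS : integrableR (sumlaw nu n) (fun u => S u ^+ 2).
  exact: integrableR_addstat2.
have ES : \int[sumlaw nu n]_u (S u ^+ 2) <=
    n%:R ^+ 2 * (4 * c * rho / (b * n%:R) + 4 * c ^+ 2 * rho ^+ 2 * b ^+ 2).
  rewrite Rint_addstat2//; set G2 := \int[nu]_y _ ^+ 2 in g4 *.
  set G1 := \int[nu]_y _ in g2b *.
  have G20 : 0 <= G2 by apply: Rintegral_ge0 => y _; exact: sqr_ge0.
  have cr1 := mulr_ge0 (le_trans ler01 c1) (le_trans ler01 rho1).
  have g4' : G2 <= 4 * c * rho / b.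
    rewrite (le_trans g4)// ler_pdivlMr//.
    have -> : 2 * (c / b + c) * rho * b = 2 * (c * rho) * (1 + b).
      by field; rewrite gt_eqF.
    nra.
  have G1s : G1 ^+ 2 <= 4 * c ^+ 2 * rho ^+ 2 * b ^+ 2.
    rewrite -(real_normK (num_real G1)).
    have -> : 4 * c ^+ 2 * rho ^+ 2 * b ^+ 2 = (2 * c * rho * b) ^+ 2 by ring.
    by rewrite lerXn2r ?nnegrE// (le_trans (normr_ge0 G1)).
  have -> : n%:R ^+ 2 * (4 * c * rho / (b * n%:R) + 4 * c ^+ 2 * rho ^+ 2 * b ^+ 2)
      = n%:R * (4 * c * rho / b) + n%:R ^+ 2 * (4 * c ^+ 2 * rho ^+ 2 * b ^+ 2).
    by field; rewrite !gt_eqF.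
  apply: lerD; first by rewrite ler_wpM2l.
  apply: (@le_trans _ _ (n%:R ^+ 2 * G1 ^+ 2)).
    by rewrite ler_wpM2r ?sqr_ge0// gerBl.
  by rewrite ler_wpM2l// sqr_ge0.
have fE : (fun u : R * R => (u.2 - n%:R) ^+ 2) = (fun u => S u ^+ 2).
  by apply/funext => u; rewrite SE.
by rewrite fE.
Qed.

(* Exponential tilting, then Chebyshev's inequality for [u.2] under the tilted law. *)
Lemma chord_bound (n : nat) (b k al r : R) (A : set (R * R)) :
  (0 < n)%N -> 0 < b -> b <= 1 -> 4 * c * rho * b <= 1 -> 1 / 4 <= k <= 1 ->
  0 < r -> measurable A ->
  (forall u, A u -> al <= b * u.1 - k * b ^+ 2 * u.2) ->
  (forall u, A u -> r * n%:R <= `|u.2 - n%:R|) ->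
  fine (sumlaw mu n A) <= m b k ^+ n * expR (- al) *
    ((4 * c * rho / (b * n%:R) + 4 * c ^+ 2 * rho ^+ 2 * b ^+ 2) / r ^+ 2).
Proof.
move=> n0 b0 b1 bs k14 r0 mA Aal Ar.
have [nu [nuE nuf]] := tilt_exists iP mu1 b0 b1 bs k14.
have mge : 1 / 2 <= m b k by exact: tilt_mass_ge.
have m0 : 0 < m b k by lra.
have n0' : 0 < n%:R :> R by rewrite ltr0n.
pose S := addstat (0 : R) 1 (-1) n.
have SE u : S u = u.2 - n%:R by rewrite /S /addstat mul0r add0r mul1r mulN1r.
have [iS ES] := tilted_deviation n0 b0 b1 bs k14 nuf.
have fE : (fun u : R * R => (u.2 - n%:R) ^+ 2) = (fun u => S u ^+ 2).
  by apply/funext => u; rewrite SE.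
rewrite fE in iS ES.
have rn0 : 0 < (r * n%:R) ^+ 2 by rewrite exprn_gt0// mulr_gt0.
pose K := m b k ^+ n * expR (- al) / (r * n%:R) ^+ 2.
have K0 : 0 <= K.
  by rewrite !mulr_ge0 ?expR_ge0 ?exprn_ge0 ?invr_ge0 ?(ltW m0)// ltW.
have mS : measurable_fun setT S by exact: measurable_addstat.
have main : (sumlaw mu n A <= (K * \int[sumlaw nu n]_u (S u ^+ 2))%:E)%E.
  have -> : sumlaw mu n A = (\int[sumlaw mu n]_u (\1_A u)%:E)%E.
    by rewrite integral_indic// setIT.
  rewrite (sumlaw_tilt (ltW m0) nuE); last 2 first.
  - by apply/measurable_EFinP; exact: measurable_indic.
  - by move=> u; rewrite lee_fin.
  rewrite -RintZ// EFin_Rintegral; last exact: integrableRZ.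
  apply: ge0_le_integral => //.
  - by move=> u _; rewrite -EFinM lee_fin !mulr_ge0 ?expR_ge0 ?exprn_ge0 ?(ltW m0).
  - by have := @measurable_indic _ _ R setT A mA => ?; mfun.
  - by mfun.
  move=> u _; rewrite -EFinM lee_fin indicE.
  have S0 := sqr_ge0 (S u); have [/set_mem Au|_] := boolP (u \in A); last first.
    by rewrite mul0r mulr_ge0.
  rewrite mul1r /K -!mulrA ler_wpM2l ?exprn_ge0 ?(ltW m0)//.
  apply: (@le_trans _ _ (expR (- al))).
    by rewrite ler_expR lerN2; have := Aal _ Au; lra.
  rewrite ler_peMr ?expR_ge0// mulrC ler_pdivlMr// mul1r.
  rewrite -[leRHS](real_normK (num_real _)) lerXn2r ?nnegrE//.
    by rewrite mulr_ge0 ?(ltW r0).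
  by rewrite SE Ar.
have main2 : fine (sumlaw mu n A) <= K * \int[sumlaw nu n]_u (S u ^+ 2).
  rewrite -lee_fin fineK// fin_num_measure//.
apply: le_trans main2 _; apply: le_trans (ler_wpM2l K0 ES) _.
rewrite /K le_eqVlt; apply/orP; left; apply/eqP.
by field; rewrite !gt_eqF.
Qed.

(** With [n * b ^+ 3 <= 1] the cubic remainder of the mass costs only a constant factor in its
    [n]-th power. *)
Lemma tilt_mass_pow (n : nat) (b k : R) : (0 < n)%N -> 0 < b -> b <= 1 ->
  4 * c * rho * b <= 1 -> 1 / 4 <= k <= 1 -> n%:R * b ^+ 3 <= 1 ->
  m b k ^+ n <= expR ((1 / 2 - k) * (n%:R * b ^+ 2)) * expR (3 * c * rho).
Proof.
move=> n0 b0 b1 bs k14 nb.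
have mge : 1 / 2 <= m b k by exact: tilt_mass_ge.
have E := tilt_mass_le iP mu1 mu2 b0 k14.
rewrite -expRD; set t := (1 / 2 - k) * b ^+ 2 + 3 * c * b ^+ 3 * rho.
have mt : m b k <= expR t by rewrite (le_trans _ (expR_ge1Dx t))// /t addrA.
apply: (@le_trans _ _ (expR t ^+ n)).
  by rewrite lerXn2r ?nnegrE ?expR_ge0//; lra.
rewrite -expRM_natl ler_expR /t mulrDr.
have cr := mulr_ge0 (le_trans ler01 c1) (le_trans ler01 rho1).
have := ler_wpM2l cr nb.
set N := n%:R; set B := b ^+ 2; set B3 := b ^+ 3.
lra.
Qed.

End chord.

Section comparison_sets.
Context d (T : measurableType d) (R : realType).
Implicit Types f g : T -> R.

Lemma measurable_lt_set f g : measurable_fun setT f -> measurable_fun setT g ->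
  measurable [set u | f u < g u].
Proof.
move=> mf mg; rewrite -[X in measurable X]setTI.
have -> : [set u | f u < g u] = (fun u => f u < g u) @^-1` [set true].
  by apply/seteqP; split => u.
have : measurable_fun setT (fun u => f u < g u) by mfun.
exact.
Qed.

Lemma measurable_le_set f g : measurable_fun setT f -> measurable_fun setT g ->
  measurable [set u | f u <= g u].
Proof.
move=> mf mg; rewrite -[X in measurable X]setTI.
have -> : [set u | f u <= g u] = (fun u => f u <= g u) @^-1` [set true].
  by apply/seteqP; split => u.
have : measurable_fun setT (fun u => f u <= g u) by mfun.
exact.
Qed.

End comparison_sets.

Section bad_events.
Context {R : realType}.
Variable mu : probability R R.
Local Notation P := (fun y : R => (1 + `|y|) ^+ 3).
Hypothesis iP : integrableR mu P.
Hypothesis mu1 : \int[mu]_y y = 0.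
Hypothesis mu2 : \int[mu]_y (y ^+ 2) = 1.
Local Notation c := (@qc R).
Local Notation rho := (rho3 mu).
Local Notation m := (tilt_mass mu).
Variables (n : nat) (x : R).
Hypothesis n0 : (0 < n)%N.
Local Notation sn := (Num.sqrt (n%:R : R)).
Hypothesis x1 : 1 <= x.
Hypothesis xn : x ^+ 3 <= sn.
Hypothesis xs : 4 * c * rho * x <= sn.

Let c1 : 1 <= c. Proof. by have := @qc_ge R; lra. Qed.
Let rho1 : 1 <= rho. Proof. exact: rho3_ge1. Qed.
Let cr1 : 1 <= c * rho. Proof. by rewrite mulr_ege1. Qed.
Let cr4 : 0 <= 4 * c * rho.
Proof. by have := cr1; rewrite -mulrA; lra. Qed.
Let x0 : 0 < x. Proof. exact: lt_le_trans x1. Qed.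
Let n0' : 0 < n%:R :> R. Proof. by rewrite ltr0n. Qed.
Let sn0 : 0 < sn. Proof. by rewrite sqrtr_gt0. Qed.
Let sn2 : sn ^+ 2 = n%:R. Proof. by rewrite sqr_sqrtr// ltW. Qed.

(** The event that the self-normalized sum exceeds [x], cleared of its denominator; a sample of
    zeros is outside, in accordance with 0/0 = 0. *)
Definition selfnorm_event : set (R * R) := [set u | x * Num.sqrt u.2 < u.1].
Definition bad_const : R := expR (3 * c * rho) * (4 * c * rho + 4 * c ^+ 2 * rho ^+ 2).

Lemma measurable_sqrt : measurable_fun setT (@Num.sqrt R).
Proof.
by apply: continuous_measurable_fun; exact: sqrt_continuous.
Qed.

Lemma measurable_selfnorm_event : measurable selfnorm_event.
Proof.
have ms : measurable_fun setT (fun u : R * R => Num.sqrt u.2).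
  by apply: measurableT_comp; [exact: measurable_sqrt|exact: measurable_snd].
by apply: measurable_lt_set; mfun.
Qed.

(** This [b] is adapted to sums of squares of order [cc ^+ 2 * n]. Chebyshev's ratio at relative
    deviation [cc / x] is then of order [x / sn / cc]; the decay in [cc] makes the sum over
    geometric scales converge. *)
Let tilt_factor (cc : R) : 1 <= cc ->
  let b := x / (cc * sn) in
  [/\ 0 < b <= 1, 4 * c * rho * b <= 1, n%:R * b ^+ 2 = x ^+ 2 / cc ^+ 2,
    n%:R * b ^+ 3 <= 1 &
    (4 * c * rho / (b * n%:R) + 4 * c ^+ 2 * rho ^+ 2 * b ^+ 2) / (cc / x) ^+ 2 <=
    (4 * c * rho + 4 * c ^+ 2 * rho ^+ 2) * (x / sn / cc)].
Proof.
move=> cc1 b; have cc0 : 0 < cc by exact: lt_le_trans cc1.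
have b0 : 0 < b by rewrite divr_gt0// mulr_gt0.
have csn : sn <= cc * sn by rewrite ler_peMl// ltW.
have bs : 4 * c * rho * b <= 1.
  by rewrite /b mulrA ler_pdivrMr ?mulr_gt0// mul1r (le_trans xs).
have b1 : b <= 1.
  by have := cr1; move: bs; have -> : 4 * c * rho * b = 4 * (c * rho) * b by [ring]; nra.
have nb2 : n%:R * b ^+ 2 = x ^+ 2 / cc ^+ 2.
  by move: sn0 sn2; rewrite /b; move: (sn) => s' s0' <-; field; rewrite !gt_eqF.
have nb3 : n%:R * b ^+ 3 = x ^+ 3 / sn / cc ^+ 3.
  by move: sn0 sn2; rewrite /b; move: (sn) => s' s0' <-; field; rewrite !gt_eqF.
have xsn : 0 <= x ^+ 3 / sn <= 1.
  by rewrite (divr_ge0 (exprn_ge0 3 (ltW x0)) (ltW sn0)) ler_pdivrMr// mul1r.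
split=> //; first by rewrite b0.
  rewrite nb3 ler_pdivrMr ?exprn_gt0// mul1r.
  by case/andP: xsn => _ H; rewrite (le_trans H)// exprn_ege1.
have -> : (4 * c * rho / (b * n%:R) + 4 * c ^+ 2 * rho ^+ 2 * b ^+ 2) / (cc / x) ^+ 2 =
  (4 * c * rho + 4 * c ^+ 2 * rho ^+ 2 * (x ^+ 3 / sn / cc ^+ 3)) * (x / sn / cc).
  by move: sn0 sn2; rewrite /b; move: (sn) => s' s0' <-; field; rewrite !gt_eqF.
apply: ler_wpM2r; first exact: divr_ge0 (divr_ge0 (ltW x0) (ltW sn0)) (ltW cc0).
rewrite lerD2l ler_piMr//; first by rewrite mulr_ge0 ?sqr_ge0// mulr_ge0 ?sqr_ge0.
rewrite ler_pdivrMr ?exprn_gt0// mul1r.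
by case/andP: xsn => _ H; rewrite (le_trans H)// exprn_ege1.
Qed.

(** With coefficient 1 the exponent is nonnegative on the event, because
    [b ^+ 2 * v <= b * x * sqrt v] for [v <= n]. The factor [expR (- (x ^+ 2 / 2))] comes entirely
    from the mass of the tilt. *)
Lemma bad_low : fine (sumlaw mu n
    (selfnorm_event `&` [set u | u.2 < n%:R * (1 - x^-1)])) <=
  expR (- (x ^+ 2 / 2)) * bad_const * (x / sn).
Proof.
have [] := tilt_factor (lexx 1); rewrite mul1r; set b := x / sn.
move=> /andP[b0 b1] bs nb2 nb3 fac.
have k14 : 1 / 4 <= (1 : R) <= 1 by lra.
have mA : measurable (selfnorm_event `&` [set u : R * R | u.2 < n%:R * (1 - x^-1)]).
  apply: measurableI; first exact: measurable_selfnorm_event.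
  by apply: measurable_lt_set; mfun.
have r0 : 0 < 1 / x by rewrite divr_gt0.
have := chord_bound iP mu1 mu2 n0 b0 b1 bs k14 r0 mA (al := 0).
rewrite oppr0 expR0 mulr1 => H; apply: le_trans (H _ _) _.
- move=> [s v] [] /=; rewrite /selfnorm_event /= mul1r => sv vn.
  (* Negative [v] do not occur as sums of squares, but the bound is demanded on the whole set; there
     [sqrt v] is 0 by convention. *)
  have [v0|v0] := leP v 0.
    have s0 : 0 <= s.
      by rewrite ltW// (le_lt_trans _ sv)// mulr_ge0 ?sqrtr_ge0// ltW.
    have bs0 : 0 <= b * s by rewrite mulr_ge0// ltW.
    have : 0 <= b ^+ 2 * (- v) by rewrite mulr_ge0 ?sqr_ge0// oppr_ge0.
    by rewrite mulrN; lra.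
  have vn' : v <= n%:R.
    rewrite (le_trans (ltW vn))// ler_piMr ?(ltW n0')// gerBl invr_ge0.
    exact: ltW.
  have sv' : Num.sqrt v <= sn by rewrite ler_wsqrtr.
  have q0 := sqrtr_ge0 v; have q2 : Num.sqrt v ^+ 2 = v by rewrite sqr_sqrtr// ltW.
  rewrite subr_ge0 (@le_trans _ _ (b * (x * Num.sqrt v)))//; last first.
    by rewrite ler_wpM2l ?(ltW b0)// ltW.
  rewrite expr2 -mulrA ler_wpM2l ?(ltW b0)// -[in leLHS]q2 /b.
  rewrite mulrAC ler_pdivrMr// -mulrA ler_wpM2l ?(ltW x0)//.
  by rewrite expr2 ler_wpM2l.
- move=> [s v] [] _ /= vn; rewrite ler0_norm; last first.
    rewrite subr_le0 (le_trans (ltW vn))// ler_piMr ?(ltW n0')// gerBl invr_ge0.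
    exact: ltW.
  by move: vn; rewrite div1r mulrBr mulr1 [_ * x^-1]mulrC; lra.
have mp := tilt_mass_pow iP mu1 mu2 n0 b0 b1 bs k14 nb3.
rewrite nb2 expr1n divr1 in mp.
move: fac; rewrite divr1 => fac.
have C0 : 0 <= (4 * c * rho / (b * n%:R) + 4 * c ^+ 2 * rho ^+ 2 * b ^+ 2) / (1 / x) ^+ 2.
  rewrite divr_ge0 ?sqr_ge0// addr_ge0//.
    exact: divr_ge0 cr4 (mulr_ge0 (ltW b0) (ltW n0')).
  by rewrite mulr_ge0 ?sqr_ge0// mulr_ge0 ?sqr_ge0// mulr_ge0 ?sqr_ge0.
have mge : 0 <= m b 1 by have := tilt_mass_ge iP mu1 b0 b1 bs k14; lra.
apply: le_trans (ler_pM _ C0 mp fac) _; first exact: exprn_ge0.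
rewrite /bad_const le_eqVlt; apply/orP; left; apply/eqP.
rewrite (_ : (1 / 2 - 1) * x ^+ 2 = - (x ^+ 2 / 2)); last by field.
by ring.
Qed.

(** The last condition serves the innermost ring [cc = 1], which touches [n]; at the scales
    [cc >= 3] it follows from the first. *)
Definition ring_event (cc : R) : set (R * R) :=
  selfnorm_event `&` [set u | [&& cc ^+ 2 * n%:R <= u.2,
    u.2 <= 9 * cc ^+ 2 * n%:R & cc / x * n%:R <= u.2 - n%:R]].

Lemma measurable_ring_event cc : measurable (ring_event cc).
Proof.
apply: measurableI; first exact: measurable_selfnorm_event.
have -> : [set u : R * R | [&& cc ^+ 2 * n%:R <= u.2,
    u.2 <= 9 * cc ^+ 2 * n%:R & cc / x * n%:R <= u.2 - n%:R]] =
  [set u | cc ^+ 2 * n%:R <= u.2] `&` ([set u | u.2 <= 9 * cc ^+ 2 * n%:R] `&`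
  [set u | cc / x * n%:R <= u.2 - n%:R]).
  apply/seteqP; split=> u /=; first by move=> /and3P[].
  by move=> [? [? ?]]; apply/and3P.
by apply: measurableI; [|apply: measurableI]; apply: measurable_le_set; mfun.
Qed.

(* For [1 <= t <= 3] the concave [t - t^2/4] is at least [3/4]; it is the exponent
   of the tilt, in units of [x^2], when [u.2 = t^2 cc^2 n] on the event. *)
Lemma bad_ring cc : 1 <= cc -> fine (sumlaw mu n (ring_event cc)) <=
  expR (- (x ^+ 2 / 2)) * bad_const * (x / sn) / cc.
Proof.
move=> cc1; have cc0 : 0 < cc by exact: lt_le_trans cc1.
have [] := tilt_factor cc1; set b := x / (cc * sn).
move=> /andP[b0 b1] bs nb2 nb3 fac.
have k14 : 1 / 4 <= (1 / 4 : R) <= 1 by lra.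
have r0 : 0 < cc / x by rewrite divr_gt0.
have mA := measurable_ring_event cc.
have H := chord_bound iP mu1 mu2 n0 b0 b1 bs k14 r0 mA (al := 3 / 4 * x ^+ 2).
apply: le_trans (H _ _) _.
- move=> [s v] [] /=; rewrite /selfnorm_event /= => sv /and3P[v1 v9 _].
  have v0 : 0 <= v by rewrite (le_trans _ v1)// mulr_ge0 ?sqr_ge0// ltW.
  have q0 := sqrtr_ge0 v; have q2 : Num.sqrt v ^+ 2 = v by rewrite sqr_sqrtr.
  set t := Num.sqrt v / (cc * sn).
  have csn : 0 < cc * sn by rewrite mulr_gt0.
  have qt : Num.sqrt v = t * (cc * sn) by rewrite /t mulfVK// gt_eqF.
  have t0 : 0 <= t by rewrite divr_ge0// ltW.
  have vt : v = t ^+ 2 * (cc ^+ 2 * n%:R) by rewrite -q2 qt !exprMn sn2; ring.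
  have cn : 0 < cc ^+ 2 * n%:R by rewrite mulr_gt0 ?exprn_gt0.
  have t1 : 1 <= t.
    rewrite /t ler_pdivlMr// mul1r -(ler_sqr (x := cc * sn)) ?nnegrE ?(ltW csn)//.
    by rewrite exprMn sn2 q2.
  have t3 : t <= 3.
    rewrite /t ler_pdivrMr// -ler_sqr ?nnegrE//; last first.
      by rewrite mulr_ge0 ?(ltW csn).
    rewrite q2 !exprMn sn2; apply: le_trans v9 _.
    by rewrite le_eqVlt; apply/orP; left; apply/eqP; ring.
  have bv : 1 / 4 * b ^+ 2 * v = x ^+ 2 * t ^+ 2 / 4.
    by rewrite vt; move: sn0 sn2; rewrite /b; move: (sn) => s' s0' <-; field; rewrite !gt_eqF.
  have bq : b * (x * Num.sqrt v) = x ^+ 2 * t.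
    by rewrite qt /b; field; rewrite !gt_eqF.
  have : b * (x * Num.sqrt v) <= b * s by rewrite ler_wpM2l ?(ltW b0)// ltW.
  rewrite bq bv => Hs.
  have : 0 <= x ^+ 2 * ((t - 1) * (3 - t)).
    apply: mulr_ge0; first exact: sqr_ge0.
    by apply: mulr_ge0; rewrite subr_ge0.
  rewrite (_ : x ^+ 2 * ((t - 1) * (3 - t)) =
      4 * (x ^+ 2 * t) - x ^+ 2 * t ^+ 2 - 3 * x ^+ 2); last by ring.
  by move: Hs; rewrite !(mulrC _ (x ^+ 2)); lra.
- move=> [s v] [] _ /= /and3P[_ _ h].
  by rewrite (le_trans h)// ler_norm.
have mp := tilt_mass_pow iP mu1 mu2 n0 b0 b1 bs k14 nb3.
have C0 : 0 <= (4 * c * rho / (b * n%:R) + 4 * c ^+ 2 * rho ^+ 2 * b ^+ 2) / (cc / x) ^+ 2.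
  rewrite divr_ge0 ?sqr_ge0// addr_ge0//.
    exact: divr_ge0 cr4 (mulr_ge0 (ltW b0) (ltW n0')).
  by rewrite mulr_ge0 ?sqr_ge0// mulr_ge0 ?sqr_ge0// mulr_ge0 ?sqr_ge0.
have mge : 0 <= m b (1/4) by have := tilt_mass_ge iP mu1 b0 b1 bs k14; lra.
have mp' : m b (1 / 4) ^+ n * expR (- (3 / 4 * x ^+ 2)) <= expR (- (x ^+ 2 / 2)) * expR (3 * c * rho).
  apply: le_trans (ler_wpM2r (expR_ge0 _) mp) _.
  rewrite -!expRD ler_expR nb2.
  have : x ^+ 2 / cc ^+ 2 <= x ^+ 2.
    by rewrite ler_pdivrMr ?exprn_gt0// ler_peMr ?sqr_ge0// exprn_ege1.
  by lra.
have e0 : 0 <= m b (1 / 4) ^+ n * expR (- (3 / 4 * x ^+ 2)).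
  by rewrite mulr_ge0 ?expR_ge0// exprn_ge0.
apply: le_trans (ler_pM e0 C0 mp' fac) _.
rewrite /bad_const le_eqVlt; apply/orP; left; apply/eqP.
by ring.
Qed.

Let badK := expR (- (x ^+ 2 / 2)) * bad_const * (x / sn).

Let upper_cut (J : nat) : set (R * R) := selfnorm_event `&`
  [set u | n%:R * (1 + x^-1) < u.2 /\ u.2 <= 9 ^+ J * n%:R].

Let measurable_upper : measurable
  (selfnorm_event `&` [set u : R * R | n%:R * (1 + x^-1) < u.2]).
Proof.
apply: measurableI; first exact: measurable_selfnorm_event.
by apply: measurable_lt_set; mfun.
Qed.

Let measurable_upper_cut J : measurable (upper_cut J).
Proof.
have -> : upper_cut J = (selfnorm_event `&` [set u : R * R | n%:R * (1 + x^-1) < u.2])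
    `&` [set u | u.2 <= 9 ^+ J * n%:R].
  by apply/seteqP; split=> u; rewrite /upper_cut /=; tauto.
apply: measurableI; first exact: measurable_upper.
by apply: measurable_le_set; mfun.
Qed.

(** The rings at scales [3 ^+ j] cover the cut and contribute [badK / 3 ^+ j] each; the right side
    is the partial sum of the geometric series. *)
Let upper_cut_le J : fine (sumlaw mu n (upper_cut J)) <=
  badK * (3 / 2 * (1 - (3 ^+ J)^-1)).
Proof.
elim: J => [|J IH].
  have -> : upper_cut 0 = set0.
    apply/seteqP; split=> // u [] _ /= [h1]; rewrite expr0 mul1r => h2.
    have : 0 < n%:R * x^-1 by rewrite mulr_gt0// invr_gt0.
    by move: h1; rewrite mulrDr mulr1; lra.
  by rewrite measure0 expr0 invr1 subrr !mulr0.
pose cc : R := 3 ^+ J.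
have cc1 : 1 <= cc by rewrite exprn_ege1//; lra.
have cc0 : 0 < cc by exact: lt_le_trans cc1.
have c9 : 9 ^+ J = cc ^+ 2 :> R.
  by rewrite /cc -exprM mulnC exprM; congr (_ ^+ _); ring.
have sub : upper_cut J.+1 `<=` upper_cut J `|` ring_event cc.
  move=> u [] su [/= h1 h2].
  have [h3|h3] := leP u.2 (9 ^+ J * n%:R); first by left.
  right; split=> //=; move: h2 h3; rewrite exprS c9 => h2 h3.
  rewrite (ltW h3) h2/=.
  have [J0|J0] := posnP J.
    by move: h1; rewrite /cc J0 expr0 mulrDr mulr1 div1r (mulrC x^-1); lra.
  have cc3 : 3 <= cc.
    by rewrite /cc -(prednK J0) exprS ler_peMr// exprn_ege1//; lra.
  have h4 : cc / x * n%:R <= cc * n%:R.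
    by rewrite ler_wpM2r ?(ltW n0')// ler_piMr ?(ltW cc0)// invf_le1.
  have : 0 <= (cc ^+ 2 - cc - 1) * n%:R.
    by apply: mulr_ge0; [nra|exact: ltW].
  by rewrite !mulrBl mul1r; lra.
have fm := @fin_num_measure _ _ _ (sumlaw mu n).
have mU := measurable_upper_cut J; have mr := measurable_ring_event cc.
have : fine (sumlaw mu n (upper_cut J.+1)) <=
    fine (sumlaw mu n (upper_cut J)) + fine (sumlaw mu n (ring_event cc)).
  rewrite -fineD ?fm//; apply: fine_le; rewrite ?fm//.
    by rewrite fin_numD !fm.
  apply: (le_trans (le_measure _ _ _ sub)); rewrite ?inE//.
    exact: measurableU.
  exact: measureU2.
move/le_trans; apply; apply: le_trans (lerD IH (bad_ring cc1)) _.
rewrite -/badK exprS -/cc le_eqVlt; apply/orP; left; apply/eqP.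
by field; rewrite gt_eqF.
Qed.

Lemma bad_up : fine (sumlaw mu n
    (selfnorm_event `&` [set u | n%:R * (1 + x^-1) < u.2])) <=
  3 / 2 * expR (- (x ^+ 2 / 2)) * bad_const * (x / sn).
Proof.
set A := (X in sumlaw mu n X).
have AE : A = \bigcup_J upper_cut J.
  apply/seteqP; split=> [u [su /= h]|u [J _ [su [h _]]]]; last by [].
  have [J _ HJ] : exists2 J : nat, True & u.2 <= 9 ^+ J * n%:R.
    have [k hk] : exists k : nat, u.2 / n%:R <= k%:R.
      exists (Num.bound `|u.2 / n%:R|).
      by rewrite (le_trans (ler_norm _))// ltW// archi_boundP.
    exists k => //; rewrite -ler_pdivrMr// (le_trans hk)//.
    rewrite -natrX ler_nat; apply: ltnW; exact: ltn_expl.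
  by exists J.
have Kge : 0 <= badK.
  rewrite mulr_ge0 ?(divr_ge0 (ltW x0) (ltW sn0))//.
  rewrite mulr_ge0 ?expR_ge0// mulr_ge0 ?expR_ge0// addr_ge0//.
  by rewrite mulr_ge0 ?sqr_ge0// mulr_ge0 ?sqr_ge0.
have bnd J : fine (sumlaw mu n (upper_cut J)) <= 3 / 2 * badK.
  apply: le_trans (upper_cut_le J) _; rewrite [leRHS]mulrC; apply: ler_wpM2l => //.
  have : 0 < (3 ^+ J)^-1 :> R by rewrite invr_gt0 exprn_gt0.
  by lra.
have mA : measurable A by exact: measurable_upper.
have fm := @fin_num_measure _ _ _ (sumlaw mu n).
(* Continuity from below removes the cutoff, the bounds being uniform in it. *)
have cv : sumlaw mu n \o upper_cut @ \oo --> sumlaw mu n A.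
  rewrite AE; apply: nondecreasing_cvg_mu => //.
  - by apply: bigcupT_measurable.
  - apply/nondecreasing_seqP => J; apply/subsetPset => u [su [h1 h2]].
    split=> //; split=> //; apply: le_trans h2 _.
    by rewrite ler_wpM2r ?(ltW n0')// exprS ler_peMl ?exprn_ge0//; lra.
suff : (sumlaw mu n A <= (3 / 2 * badK)%:E)%E.
  by rewrite -lee_fin fineK ?fm// /badK !mulrA.
rewrite -(cvg_lim _ cv)//; apply: lime_le; first by apply/cvg_ex; exists (sumlaw mu n A).
near=> J; rewrite /= -(fineK (fm _ (measurable_upper_cut J))) lee_fin.
exact: bnd.
Unshelve. all: by end_near.
Qed.

End bad_events.

(** * Sums of squares close to n *)

Section half_deviation.
Context {R : realType}.
Variables (n x : R).
Hypotheses (n0 : 0 < n) (x0 : 0 < x).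

(* The second-order error of [selfnorm_lin] below, truncated to be Lipschitz in [v]. *)
Definition half_dev (v : R) : R := x / 2 * Num.min `|v / n - 1| x^-1 ^+ 2.
Local Notation d := half_dev.

Let xV0 : 0 < x^-1. Proof. by rewrite invr_gt0. Qed.
Let x20 : 0 <= x / 2. Proof. by rewrite divr_ge0// ltW. Qed.

(** The truncation at [x^-1] bounds the slope: [x / 2 * (p + p') <= 1]. *)
Lemma half_dev_lip v v' : `|d v - d v'| <= `|v - v'| / n.
Proof.
have xV := xV0; rewrite /half_dev; set w := v / n - 1; set w' := v' / n - 1.
set p := Num.min `|w| x^-1; set p' := Num.min `|w'| x^-1.
have pp (t : R) : 0 <= Num.min `|t| x^-1 <= x^-1.
  by rewrite le_min normr_ge0 (ltW xV0)/= ge_min lexx orbT.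
have hp := pp w; have hp' := pp w'; rewrite -/p in hp; rewrite -/p' in hp'.
have lip : `|p - p'| <= `|w - w'|.
  apply: le_trans (ler_dist_dist w w'); rewrite /p /p'.
  move: (`|w|) (`|w'|) => u u'.
  have [h1|/ltW h1] := leP u x^-1; have [h2|/ltW h2] := leP u' x^-1;
    rewrite ?subrr ?normr0// ?normr_ge0//.
  - by rewrite !ler0_norm; lra.
  - by rewrite !ger0_norm; lra.
have -> : `|v - v'| / n = `|w - w'|.
  rewrite (_ : w - w' = (v - v') / n); last by rewrite /w /w'; ring.
  by rewrite normrM (@ger0_norm _ n^-1)// invr_ge0 ltW.
apply: le_trans lip.
rewrite (_ : x / 2 * p ^+ 2 - x / 2 * p' ^+ 2 = (x / 2 * (p + p')) * (p - p')); last by ring.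
rewrite normrM ler_piMl// ger0_norm; last by rewrite mulr_ge0//; lra.
rewrite (le_trans (ler_wpM2l x20 (_ : _ <= 2 * x^-1)))//; first by lra.
by rewrite le_eqVlt; apply/orP; left; apply/eqP; field; rewrite gt_eqF.
Qed.

Lemma half_dev_ge0 v : 0 <= d v.
Proof. by rewrite mulr_ge0 ?sqr_ge0. Qed.

Lemma half_dev_le v : d v <= x / 2 * (v / n - 1) ^+ 2.
Proof.
rewrite ler_wpM2l// -(real_normK (num_real (v / n - 1))) lerXn2r ?nnegrE//.
  by rewrite le_min normr_ge0 ltW.
by rewrite ge_min lexx.
Qed.

Lemma half_dev_small v : x * d v <= 1 / 2.
Proof.
apply: (@le_trans _ _ (x * (x / 2 * (x^-1 ^+ 2)))).
  rewrite ler_wpM2l ?(ltW x0)// ler_wpM2l// lerXn2r ?nnegrE ?(ltW xV0)//.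
    by rewrite le_min normr_ge0 ltW.
  by rewrite ge_min lexx orbT.
by rewrite le_eqVlt; apply/orP; left; apply/eqP; field; rewrite gt_eqF.
Qed.

Lemma half_devE v : `|v / n - 1| <= x^-1 -> d v = x / 2 * (v / n - 1) ^+ 2.
Proof. by move=> h; rewrite /half_dev (min_idPl h) real_normK ?num_real. Qed.

Lemma measurable_half_dev : measurable_fun setT d.
Proof. by rewrite /half_dev; mfun. Qed.

(* [z - (x/2)(w + 1)] is the tangent approximation of [z - x sqrt w] at [w = 1]. *)
Lemma selfnorm_lin z v : 0 <= v -> x * Num.sqrt v < z * Num.sqrt n ->
  0 < z - x / 2 * (v / n + 1) + x / 2 * (v / n - 1) ^+ 2.
Proof.
move=> v0; have sn0 : 0 < Num.sqrt n by rewrite sqrtr_gt0.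
rewrite -ltr_pdivrMr// => tz; pose t := Num.sqrt v / Num.sqrt n.
rewrite -mulrA -/t in tz.
have t0 : 0 <= t by rewrite divr_ge0.
have -> : v / n = t ^+ 2.
  by rewrite expr_div_n !sqr_sqrtr// ltW.
(* The tangent error in [t] is [(t - 1) ^+ 2], and the quadratic correction contributes
   [(t - 1) ^+ 2 * (t + 1) ^+ 2], which is larger. *)
have : 0 <= x / 2 * ((t - 1) ^+ 2 * (t * (t + 2))).
  by rewrite mulr_ge0// mulr_ge0 ?sqr_ge0// mulr_ge0// addr_ge0.
rewrite (_ : x / 2 * ((t - 1) ^+ 2 * (t * (t + 2))) =
  x * t - x / 2 * (t ^+ 2 + 1) + x / 2 * (t ^+ 2 - 1) ^+ 2); last by field.
lra.
Qed.

End half_deviation.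

Section moderate_deviation.
Context {R : realType}.
Variable mu : probability R R.
Local Notation P := (fun y : R => (1 + `|y|) ^+ 3).
Hypothesis iP : integrableR mu P.
Hypothesis mu1 : \int[mu]_y y = 0.
Hypothesis mu2 : \int[mu]_y (y ^+ 2) = 1.
Local Notation c := (@qc R).
Local Notation rho := (rho3 mu).
Local Notation m := (tilt_mass mu).
Variables (k : nat) (x s : R).
Local Notation n := k.+1.
Hypotheses (s0 : 0 < s) (s2 : s ^+ 2 = n%:R).
Hypothesis x1 : 1 <= x.
Hypothesis xs : 24 * (c * rho) * x ^+ 3 <= s.
Local Notation b := (x / s).

Let c1 : 1 <= c. Proof. by have := @qc_ge R; lra. Qed.
Let c0 : 0 <= c. Proof. exact: le_trans c1. Qed.
Let rho1 : 1 <= rho. Proof. exact: rho3_ge1. Qed.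
Let cr1 : 1 <= c * rho. Proof. by rewrite mulr_ege1. Qed.
Let x0 : 0 < x. Proof. exact: lt_le_trans x1. Qed.
Let n0 : 0 < n%:R :> R. Proof. by rewrite ltr0n. Qed.
Let x3 : x <= x ^+ 3. Proof. by rewrite ler_eXnr. Qed.
Let x23 : x ^+ 2 <= x ^+ 3. Proof. by rewrite ler_weXn2l. Qed.

Let crx (y : R) : 1 <= y -> y <= x ^+ 3 -> 24 * (c * rho * y) <= s.
Proof.
move=> y1 yx; apply: le_trans xs; rewrite mulrA ler_wpM2l// mulr_ge0//.
exact: le_trans cr1.
Qed.

Let b0 : 0 < b. Proof. by rewrite divr_gt0. Qed.
Let bs : 4 * c * rho * b <= 1.
Proof.
rewrite mulrA ler_pdivrMr// mul1r; have h := crx x1 x3; have cr := cr1.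
have := mulr_ge0 (le_trans ler01 cr) (ltW x0).
by rewrite (_ : 4 * c * rho * x = 4 * (c * rho * x)); [lra|ring].
Qed.
Let b1 : b <= 1.
Proof.
have := bs; have := cr1; have := b0; rewrite (_ : 4 * c * rho * b = 4 * (c * rho * b)); last by ring.
by move=> B CR; have := ler_pM ler01 (ltW B) CR (lexx b); lra.
Qed.
Let k14 : 1 / 4 <= (1 / 2 : R) <= 1. Proof. by lra. Qed.

(** The common error size. Here 6 is twice the 3 of the tilted moment bounds, and the mean and
    variance errors are [kap * x ^+ 2] and [kap * x]. *)
Let kap := 6 * (c * rho) / s.
Let kap0 : 0 < kap.
Proof. by rewrite divr_gt0// mulr_gt0// (lt_le_trans ltr01). Qed.
Let kap1 : kap <= 1.
Proof.
rewrite /kap ler_pdivrMr// mul1r; have h := crx (lexx 1) (exprn_ege1 3 x1).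
by have := cr1; lra.
Qed.
Let al1 : kap * x ^+ 2 <= 1.
Proof.
rewrite /kap mulrAC ler_pdivrMr// mul1r; have h := crx (exprn_ege1 2 x1) x23.
by have := mulr_ge0 (le_trans ler01 cr1) (sqr_ge0 x); lra.
Qed.
Let be14 : kap * x <= 1 / 4.
Proof.
rewrite /kap mulrAC ler_pdivrMr//; have h := crx x1 x3.
by have := mulr_ge0 (le_trans ler01 cr1) (ltW x0); lra.
Qed.

Let mge : 1 / 2 <= m b (1 / 2). Proof. exact: tilt_mass_ge. Qed.
Let m0 : 0 < m b (1 / 2). Proof. by have := mge; lra. Qed.

Variable nu : probability R R.
Hypothesis nuE : forall f : R -> \bar R, measurable_fun setT f ->
  (forall y, 0 <= f y)%E ->
  (\int[mu]_y f y = \int[nu]_y (f y *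
     (m b (1 / 2) * expR (- (b * y - 1 / 2 * b ^+ 2 * y ^+ 2)))%:E))%E.
Hypothesis nuf : forall (f : R -> R) A, measurable_fun setT f ->
  (forall y, `|f y| * quadexp (1 / 2) (b * y) <= A * P y) ->
  [/\ integrableR nu f,
      \int[nu]_y f y = (m b (1 / 2))^-1 * \int[mu]_y (f y * quadexp (1 / 2) (b * y)) &
      `|\int[nu]_y f y| <= 2 * A * rho].

Local Notation q := (tilt_lin b).
(** With these coefficients the additive statistic is [u.1 / s - x / 2 * (u.2 / n + 1)], the linear
    part in [selfnorm_lin]. *)
Let al := s^-1.
Let be := - (x / (2 * n%:R)).
Local Notation xi := (summand al be be).
Local Notation A := (addstat al be be).
Let d := half_dev n%:R x.
Let e (y : R) := n%:R^-1 * y ^+ 2.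

Let xiE : xi = (fun y => s^-1 * q y).
Proof.
apply/funext => y; rewrite /summand /tilt_lin /al /be -s2.
by field; rewrite gt_eqF.
Qed.

Let mq : measurable_fun setT q.
Proof. by rewrite /tilt_lin; mfun. Qed.
Let w0 y : 0 <= quadexp (1 / 2) (b * y). Proof. exact/ltW/quadexp_gt0. Qed.
Let P1 (y : R) : 1 <= P y. Proof. by apply: exprn_ege1; rewrite lerDl. Qed.

Let invm (t B : R) : `|t| <= B -> `|(m b (1 / 2))^-1 * t| <= 2 * B.
Proof.
move=> tB; rewrite normrM ger0_norm ?invr_ge0 ?(ltW m0)//.
apply: ler_pM => //; first by rewrite invr_ge0 ltW.
rewrite -[leRHS]invrK lef_pV2 ?posrE ?invr_gt0//.
by have := mge; lra.
Qed.

Let iq : integrableR nu q /\ `|\int[nu]_y q y| <= kap * x ^+ 2 / s.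
Proof.
have [i E _] := nuf mq (lin_quadexp b0 b1 k14); split=> //; rewrite E.
apply: le_trans (invm (Rint_lin_quadexp iP mu1 mu2 b0 k14)) _.
rewrite le_eqVlt; apply/orP; left; apply/eqP.
by rewrite /kap; field; rewrite gt_eqF.
Qed.

Let iq2 : integrableR nu (fun y => q y ^+ 2) /\
  `|\int[nu]_y (q y ^+ 2) - 1| <= kap * x.
Proof.
have mq2 : measurable_fun setT (fun y => q y ^+ 2) by mfun.
have [i _ _] : [/\ integrableR nu (fun y => q y ^+ 2),
   \int[nu]_y (q y ^+ 2) = (m b (1 / 2))^-1 * \int[mu]_y (q y ^+ 2 * quadexp (1 / 2) (b * y)) &
   `|\int[nu]_y (q y ^+ 2)| <= 2 * c * rho].
  apply: nuf => // y; rewrite ger0_norm ?sqr_ge0//; exact: lin2_quadexp.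
split=> //.
rewrite -[X in _ - X](Rint_cst nu) -RintB//; last exact: integrableR_cst.
have [_ -> _] : [/\ integrableR nu (fun y => q y ^+ 2 - 1),
   \int[nu]_y (q y ^+ 2 - 1) = (m b (1 / 2))^-1 * \int[mu]_y ((q y ^+ 2 - 1) * quadexp (1 / 2) (b * y)) &
   `|\int[nu]_y (q y ^+ 2 - 1)| <= 2 * (2 * c) * rho].
  apply: nuf; first by mfun.
  move=> y; have H1 := lin2_quadexp b0 b1 k14 y.
  have H2 : quadexp (1 / 2) (b * y) <= c * P y.
    have k4 : 1 / 4 <= (1 / 2 : R) by lra.
    by rewrite (le_trans (quadexp_le _ k4))// ler_peMr.
  have H3 : `|q y ^+ 2 - 1| <= q y ^+ 2 + 1.
    by rewrite ler_norml; have := sqr_ge0 (q y); lra.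
  have := ler_wpM2r (w0 y) H3; rewrite mulrDl (mul1r (quadexp _ _)) => /le_trans; apply.
  by apply: le_trans (lerD H1 H2) _; rewrite -mulrA mulr_natl mulr2n.
apply: le_trans (invm (Rint_lin2_quadexp iP mu2 b0 b1 k14)) _.
rewrite le_eqVlt; apply/orP; left; apply/eqP.
by rewrite /kap; field; rewrite gt_eqF.
Qed.

Let nonneg_moment (f : R -> R) : measurable_fun setT f -> (forall y, 0 <= f y) ->
  (forall y, f y * quadexp (1 / 2) (b * y) <= c * P y) ->
  integrableR nu f /\ \int[nu]_y f y <= 2 * (c * rho).
Proof.
move=> mf f0 fP; have [] := nuf (f := f) (A := c) mf _.
  by move=> y; rewrite ger0_norm.
by move=> i _ B; split=> //; rewrite mulrA (le_trans (ler_norm _)).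
Qed.

Let iq3 : integrableR nu (fun y => `|q y| ^+ 3) /\
  \int[nu]_y (`|q y| ^+ 3) <= 2 * (c * rho).
Proof.
apply: nonneg_moment => [|y|y]; [by mfun|by rewrite exprn_ge0|exact: lin3_quadexp].
Qed.

Let iqy2 : integrableR nu (fun y => `|q y| * y ^+ 2) /\
  \int[nu]_y (`|q y| * y ^+ 2) <= 2 * (c * rho).
Proof.
apply: nonneg_moment => [|y|y]; [by mfun|by rewrite mulr_ge0 ?sqr_ge0|].
exact: lin_sqr_quadexp.
Qed.

Let iqa : integrableR nu (fun y => `|q y|) /\ \int[nu]_y `|q y| <= 2 * (c * rho).
Proof.
apply: nonneg_moment => [|y|y]; [by mfun|by []|].
exact: lin_quadexp.
Qed.

Let iy2 : integrableR nu (fun y => y ^+ 2) /\ \int[nu]_y (y ^+ 2) <= 2 * (c * rho).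
Proof.
apply: nonneg_moment => [|y|y]; [by mfun|exact: sqr_ge0|].
exact: sqr_quadexp.
Qed.

(** These play the roles of the same names in the general normal approximation: [half_dev] is the
    nonlinear correction, and [M'] is evaluated on the [k] entries other than the first. *)
Let L (z : R * (R * R)) := A n (sum_step z).
Let M (z : R * (R * R)) := A n (sum_step z) + d (sum_step z).2.
Let M' (u : R * R) := A k u + d u.2.

Let md : measurable_fun setT d. Proof. exact: measurable_half_dev. Qed.
Let mA j : measurable_fun setT (A j). Proof. exact: measurable_addstat. Qed.
Let mM' : measurable_fun setT M'. Proof. by apply: measurable_funD => //; exact: measurableT_comp. Qed.
Let mM1 : measurable_fun setT (fun u => A n u + d u.2).
Proof. by apply: measurable_funD => //; exact: measurableT_comp. Qed.
Let mM : measurable_fun setT M.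
Proof. by apply: (measurableT_comp mM1); exact: measurable_sum_step. Qed.

Let ME z : `|M z - M' z.2 - xi z.1| <= e z.1.
Proof.
rewrite /M /M' addstatS (_ : _ - _ - _ = d (sum_step z).2 - d z.2.2); last by ring.
rewrite (le_trans (half_dev_lip n0 x0 _ _))// /= addrAC subrr add0r.
by rewrite ger0_norm ?sqr_ge0// mulrC.
Qed.

Let LM z : L z <= M z.
Proof. by rewrite lerDl; exact: half_dev_ge0. Qed.

Let ixi : integrableR nu xi.
Proof. by rewrite xiE; apply: integrableRZ; have [] := iq. Qed.

Let xi2E : (fun y => xi y ^+ 2) = (fun y => n%:R^-1 * q y ^+ 2).
Proof. by apply/funext => y; rewrite xiE exprMn exprVn s2. Qed.

Let ixi2 : integrableR nu (fun y => xi y ^+ 2).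
Proof. by rewrite xi2E; apply: integrableRZ; have [] := iq2. Qed.

Let exchange (F : R -> R) : measurable_fun setT F ->
  (exists C, forall t, `|F t| <= C) ->
  \int[(nu \x sumlaw nu k)%E]_z (L z * F (M z)) =
  n%:R * \int[(nu \x sumlaw nu k)%E]_z (xi z.1 * F (M z)).
Proof.
move=> mF [C FC]; pose f u := F (A n u + d u.2).
have mf : measurable_fun setT f by exact: (measurableT_comp mF).
have fC u : `|f u| <= C by exact: FC.
rewrite -(Rint_addstatM ixi k mf fC) (Rint_sumlawS (f := fun u => A n u * f u))//.
apply: integrableR_le (integrableRZ C (integrableR_norm (integrableR_addstat n ixi))) _.
  by mfun.
by move=> u; rewrite normrM mulrC ler_wpM2r.
Qed.

Let xi1 : n%:R * `|\int[nu]_y xi y| <= kap * x ^+ 2.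
Proof.
have [i B] := iq; rewrite xiE RintZ// normrM ger0_norm ?invr_ge0 ?(ltW s0)//.
apply: (@le_trans _ _ (n%:R * (s^-1 * (kap * x ^+ 2 / s)))).
  by rewrite !ler_wpM2l ?invr_ge0 ?(ltW s0)// ltW.
rewrite -s2 le_eqVlt; apply/orP; left; apply/eqP.
by field; rewrite gt_eqF.
Qed.

Let xi2 : `|n%:R * (\int[nu]_y xi y ^+ 2) - 1| <= kap * x.
Proof. by have [i B] := iq2; rewrite xi2E RintZ// mulVKf// gt_eqF. Qed.

Let xi3E : (fun y => `|xi y| ^+ 3) = (fun y => s^-1 ^+ 3 * `|q y| ^+ 3).
Proof.
apply/funext => y; rewrite xiE normrM exprMn ger0_norm// invr_ge0.
exact: ltW.
Qed.

Let ixi3 : integrableR nu (fun y => `|xi y| ^+ 3).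
Proof. by rewrite xi3E; apply: integrableRZ; have [] := iq3. Qed.

Let small (t : R) : t <= 2 * (c * rho) -> s^-1 * t <= kap.
Proof.
move=> h; rewrite /kap [leRHS]mulrC ler_wpM2l ?invr_ge0 ?(ltW s0)//.
by have := cr1; lra.
Qed.

Let xi3 : n%:R * (\int[nu]_y `|xi y| ^+ 3) <= kap.
Proof.
have [i B] := iq3; rewrite xi3E RintZ// mulrA.
rewrite (_ : n%:R * s^-1 ^+ 3 = s^-1); first exact: small.
by rewrite -s2; field; rewrite gt_eqF.
Qed.

Let xieE : (fun y => `|xi y| * e y) = (fun y => s^-1 ^+ 3 * (`|q y| * y ^+ 2)).
Proof.
apply/funext => y; rewrite xiE normrM ger0_norm ?invr_ge0 ?(ltW s0)//.
by rewrite /e -s2; field; rewrite gt_eqF.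
Qed.

Let ixie : integrableR nu (fun y => `|xi y| * e y).
Proof. by rewrite xieE; apply: integrableRZ; have [] := iqy2. Qed.

Let xie : n%:R * (\int[nu]_y (`|xi y| * e y)) <= kap.
Proof.
have [i B] := iqy2; rewrite xieE RintZ// mulrA.
rewrite (_ : n%:R * s^-1 ^+ 3 = s^-1); first exact: small.
by rewrite -s2; field; rewrite gt_eqF.
Qed.

Let ie : integrableR nu e.
Proof. by apply: integrableRZ; have [] := iy2. Qed.

Let sV1 : s^-1 <= 1.
Proof.
rewrite invf_le1//; have h := crx (lexx 1) (exprn_ege1 3 x1).
by have := cr1; lra.
Qed.

Let xiDe : \int[nu]_y (`|xi y| + e y) <= kap.
Proof.
have [i1 B1] := iqa; have [i2 B2] := iy2.
rewrite RintD//; last exact: integrableR_norm.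
rewrite (_ : (fun y => `|xi y|) = (fun y => s^-1 * `|q y|)); last first.
  by apply/funext => y; rewrite xiE normrM ger0_norm// invr_ge0 ltW.
rewrite /e !RintZ// -s2.
set I1 := \int[nu]_y `|q y| in B1 *; set I2 := \int[nu]_y _ in B2 *.
have I20 : 0 <= I2 by apply: Rintegral_ge0 => y _; exact: sqr_ge0.
have sV0 : 0 <= s^-1 by rewrite invr_ge0 ltW.
apply: (@le_trans _ _ (s^-1 * (I1 + I2))).
  rewrite mulrDr lerD2l -exprVn ler_wpM2r// expr2.
  by rewrite ler_piMr.
rewrite /kap [leRHS]mulrC ler_wpM2l//.
by have := cr1; lra.
Qed.

Let iLs : integrableR (nu \x sumlaw nu k)%E L.
Proof. exact: integrableR_sumlawSW (integrableR_addstat n ixi). Qed.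

Let L2 : \int[(nu \x sumlaw nu k)%E]_z `|L z| <= 2.
Proof.
have iA2 := integrableR_addstat2 n ixi2.
have iA := integrableR_addstat n ixi.
rewrite -(Rint_sumlawS (f := fun u => `|A n u|)); last exact: integrableR_norm.
apply: (@le_trans _ _ (\int[sumlaw nu n]_u (1 + 4^-1 * A n u ^+ 2))).
  apply: le_Rint; first exact: integrableR_norm.
    by apply: integrableRD; [exact: integrableR_cst|exact: integrableRZ].
  move=> u; rewrite -(real_normK (num_real (A n u))).
  by have := sqr_ge0 (`|A n u| - 2); set t := `|_|; nra.
rewrite (RintD (integrableR_cst _ _) (integrableRZ _ iA2)) Rint_cst RintZ//.
rewrite Rint_addstat2//.
have := xi2; have := xi1; set I2 := \int[nu]_y _ ^+ 2; set I1 := \int[nu]_y _.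
move=> h1; rewrite ler_norml => h2.
have I1n : (n%:R * `|I1|) ^+ 2 <= 1.
  have h3 := le_trans h1 al1; have h4 := mulr_ge0 (ltW n0) (normr_ge0 I1).
  by rewrite expr2 mulr_ile1.
have : (n%:R ^+ 2 - n%:R) * I1 ^+ 2 <= 1.
  apply: le_trans I1n; rewrite exprMn real_normK ?num_real//.
  by rewrite ler_wpM2r ?sqr_ge0// gerBl ltW.
by have := be14; lra.
Qed.

Let dE (z : R * (R * R)) : M z - L z = d (sum_step z).2.
Proof. by rewrite /M /L addrC addKr. Qed.

(** The mean of [d] is at most [x / 2] times the relative variance of the sum of squares, hence of
    order [1 / s]: the cost [1 / b] of the fourth moment is just affordable. *)
Let i_d : integrableR (sumlaw nu n) (fun u => d u.2) /\
  \int[sumlaw nu n]_u d u.2 <= kap.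
Proof.
have [iv Bv] := tilted_deviation iP mu1 mu2 (ltn0Sn k) b0 b1 bs k14 nuf.
pose C := x / 2 / n%:R ^+ 2.
have dv u : d u <= C * (u - n%:R) ^+ 2.
  apply: le_trans (half_dev_le _ _ _) _ => //.
  rewrite le_eqVlt; apply/orP; left; apply/eqP; rewrite /C.
  by field; rewrite gt_eqF.
have C0 : 0 <= C.
  by rewrite divr_ge0 ?sqr_ge0// divr_ge0// ltW.
have d0 u : 0 <= d u by exact: half_dev_ge0.
have id : integrableR (sumlaw nu n) (fun u => d u.2).
  apply: integrableR_le (integrableRZ C iv) _.
    exact: measurableT_comp.
  by move=> u; rewrite ger0_norm.
split=> //; apply: (@le_trans _ _ (\int[sumlaw nu n]_u (C * (u.2 - n%:R) ^+ 2))).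
  by apply: le_Rint => //; exact: integrableRZ.
rewrite RintZ//; apply: le_trans (ler_wpM2l C0 Bv) _.
have s0' := gt_eqF s0; have x0' := gt_eqF x0.
rewrite (_ : C * _ = 2 * (c * rho) / s * (1 + (c * rho * x ^+ 3) / s)); last first.
  by rewrite /C -s2; field; rewrite s0' x0'.
rewrite /kap mulrAC ler_wpM2r ?invr_ge0 ?(ltW s0)//.
have h : c * rho * x ^+ 3 / s <= 1.
  rewrite ler_pdivrMr// mul1r; apply: le_trans xs.
  have := mulr_ge0 (le_trans ler01 cr1) (exprn_ge0 3 (ltW x0)).
  by rewrite -mulrA; lra.
by have := cr1; nra.
Qed.

Let iD : integrableR (nu \x sumlaw nu k)%E (fun z => M z - L z).
Proof.
by rewrite (funext dE); exact: (integrableR_sumlawSW (proj1 i_d)).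
Qed.

Let MBL : \int[(nu \x sumlaw nu k)%E]_z (M z - L z) <= kap.
Proof.
have [i B] := i_d; rewrite (funext dE).
by rewrite -(Rint_sumlawS (f := fun u => d u.2)).
Qed.

Let stein_tilted :
  integrableR (sumlaw nu n) (fun u => exp_step x (A n u + d u.2)) /\
  \int[sumlaw nu n]_u exp_step x (A n u + d u.2) <=
    exp_step_mean x + 212 * kap * x.
Proof.
have [i B] := stein_bound (ltW n0) mM' mM ME LM exchange ixi ixi2 ixi3 ie ixie
  iLs iD kap0 kap1 al1 be14 xi1 xi2 xi3 xie xiDe L2 MBL x1.
have me : measurable_fun setT (fun u => exp_step x (A n u + d u.2)).
  exact: (measurableT_comp (measurable_exp_step x)).
have i' : integrableR (sumlaw nu n) (fun u => exp_step x (A n u + d u.2)).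
  exact: integrableR_sumlawS.
split=> //; rewrite Rint_sumlawS//; apply: le_trans B _.
(* Here 212 = 209 + 2 + 1, the last two from the variance and mean errors. *)
rewrite (_ : kap * x ^+ 2 / x = kap * x); last by field; rewrite gt_eqF.
lra.
Qed.

(** Changing to the tilted law leaves the weight [expR (- (x * M))] on [M > 0], up to the correction
    [expR (x * d)]; Stein's bound evaluates the former. *)
Lemma moderate_tilted :
  fine (sumlaw mu n (selfnorm_event x `&` [set u | `|u.2 - n%:R| <= n%:R / x])) <=
  m b (1 / 2) ^+ n * expR (- (x ^+ 2 / 2)) *
    (exp_step_mean x + 214 * kap * x).
Proof.
set E := _ `&` _.
have [ih Bh] := stein_tilted; have [id Bd] := i_d.
have mE : measurable E.
  apply: measurableI; first exact: measurable_selfnorm_event.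
  by apply: measurable_le_set; mfun.
pose K := m b (1 / 2) ^+ n * expR (- (x ^+ 2 / 2)).
have K0 : 0 <= K by rewrite mulr_ge0 ?expR_ge0// exprn_ge0// ltW.
pose G (u : R * R) := K * (exp_step x (A n u + d u.2) + 2 * x * d u.2).
have iG : integrableR (sumlaw nu n) G.
  by apply: integrableRZ; apply: integrableRD => //; exact: integrableRZ.
have h0 u := exp_step_01 x1 u.
have d0 v : 0 <= d v by exact: half_dev_ge0.
have G0 u : 0 <= G u.
  rewrite mulr_ge0// addr_ge0//; first by case/andP: (h0 (A n u + d u.2)).
  by rewrite mulr_ge0// mulr_ge0// ltW.
have main : (sumlaw mu n E <= (\int[sumlaw nu n]_u G u)%:E)%E.
  have -> : sumlaw mu n E = (\int[sumlaw mu n]_u (\1_E u)%:E)%E.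
    by rewrite integral_indic// setIT.
  rewrite (sumlaw_tilt (ltW m0) nuE); last 2 first.
  - by apply/measurable_EFinP; exact: measurable_indic.
  - by move=> u; rewrite lee_fin.
  rewrite EFin_Rintegral//.
  apply: ge0_le_integral => //.
  - by move=> u _; rewrite -EFinM lee_fin !mulr_ge0 ?expR_ge0 ?exprn_ge0 ?(ltW m0).
  - by have := @measurable_indic _ _ R setT E mE => ?; mfun.
  - by have := integrableR_measurable iG => ?; mfun.
  move=> u _; rewrite -EFinM lee_fin indicE.
  have [/set_mem [Eu1 /= Eu2]|_] := boolP (u \in E); last by rewrite mul0r.
  rewrite [leLHS]mul1r /G /K -[leRHS]mulrA ler_wpM2l ?exprn_ge0 ?(ltW m0)//.
  have v0 : 0 <= u.2.
    have : n%:R / x <= n%:R by rewrite ler_pdivrMr// ler_peMr// ltW.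
    by move: Eu2; rewrite ler_norml => /andP[+ _]; lra.
  have dvE : d u.2 = x / 2 * (u.2 / n%:R - 1) ^+ 2.
    apply: half_devE => //.
    rewrite (_ : u.2 / n%:R - 1 = (u.2 - n%:R) / n%:R); last by field; rewrite gt_eqF.
    by rewrite normrM (@ger0_norm _ n%:R^-1) ?invr_ge0 ?(ltW n0)// ler_pdivrMr// mulrC.
  have AE : A n u = u.1 / s - x / 2 * (u.2 / n%:R + 1).
    by rewrite /addstat /al /be; field; rewrite !gt_eqF.
  have ssn : Num.sqrt n%:R = s by rewrite -s2 sqrtr_sqr ger0_norm// ltW.
  have M0 : 0 < A n u + d u.2.
    rewrite AE dvE; apply: selfnorm_lin => //.
    by rewrite ssn mulfVK ?gt_eqF.
  (* The exponent is linear in the additive statistic; adding and subtracting [x * d] brings in [M],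
     which is positive on the event. *)
  have -> : - (b * u.1 - 1 / 2 * b ^+ 2 * u.2) =
      - (x ^+ 2 / 2) + (- (x * (A n u + d u.2)) + x * d u.2).
    by rewrite AE -s2; field; rewrite !gt_eqF.
  rewrite expRD expRD ler_wpM2l ?expR_ge0// /exp_step M0.
  have hs := half_dev_small n%:R x0 u.2; rewrite -/(d u.2) in hs.
  have t0 : 0 <= x * d u.2 by rewrite mulr_ge0// ltW.
  have eM : expR (- (x * (A n u + d u.2))) <= 1.
    by rewrite -[leRHS]expR0 ler_expR oppr_le0 mulr_ge0 ?(ltW x0)// ltW.
  (* Valid since the truncation keeps [x * d] below 1/2. *)
  have et : expR (x * d u.2) <= 1 + 2 * (x * d u.2).
    rewrite -[leLHS]invrK -expRN invf_ple ?posrE ?expR_gt0//; last by lra.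
    apply: le_trans (expR_ge1Dx _).
    rewrite -[leLHS]mul1r ler_pdivrMr; last by lra.
    by nra.
  have eM0 := expR_ge0 (- (x * (A n u + d u.2))).
  apply: le_trans (ler_wpM2l eM0 et) _.
  rewrite mulrDr mulr1 lerD2l -mulrA -[leRHS]mul1r ler_wpM2r//.
  by rewrite mulr_ge0.
have main2 : fine (sumlaw mu n E) <= \int[sumlaw nu n]_u G u.
  by rewrite -lee_fin fineK// fin_num_measure.
apply: le_trans main2 _.
rewrite /G RintZ; last by apply: integrableRD => //; exact: integrableRZ.
rewrite ler_wpM2l// (RintD ih (integrableRZ (2 * x) id)) RintZ//.
(* The correction adds [2 * x * kap], turning 212 into 214. *)
have x20 : 0 <= 2 * x by rewrite mulr_ge0// ltW.
have := ler_wpM2l x20 Bd.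
by have := Bh; lra.
Qed.

End moderate_deviation.

(** * The tail bound *)

(** The mass of [[x, x + 1/x]] suffices: there [t ^+ 2 / 2] is at most [x ^+ 2 / 2 + 3 / 2]. *)
Lemma gtail_exp_lb {R : realType} : exists2 p0 : R, 0 < p0 &
  forall x, 1 <= x -> p0 * expR (- (x ^+ 2 / 2)) <= x * gtail x.
Proof.
exists (normal_peak 1 * expR (- (3 / 2))).
  by rewrite mulr_gt0 ?expR_gt0// normal_peak_gt0// oner_eq0.
move=> x x1; have x0 : 0 < x by exact: lt_le_trans x1.
have xV0 : 0 < x^-1 by rewrite invr_gt0.
have := gtail_lb (ltW x0) (ltW xV0); rewrite ler_pdivrMl//.
apply: le_trans; rewrite pdfE -mulrA ler_wpM2l ?normal_peak_ge0//.
rewrite -expRD ler_expR.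
have xV1 : x^-1 ^+ 2 <= 1 by rewrite exprn_ile1 ?(ltW xV0)// invf_le1.
have -> : - (x + x^-1) ^+ 2 / 2 = - (x ^+ 2 / 2) - 1 - x^-1 ^+ 2 / 2.
  by field; rewrite gt_eqF.
lra.
Qed.

Lemma expRN_le1B {R : realType} (t : R) : 0 <= t -> t <= 1 -> expR (- t) <= 1 - t / 2.
Proof.
move=> t0 t1; rewrite expRN invf_ple ?posrE ?expR_gt0//; last by lra.
apply: le_trans (expR_ge1Dx _); rewrite -[leLHS]mul1r ler_pdivrMr; last by lra.
nra.
Qed.

Section tail.
Context {R : realType}.
Variable mu : probability R R.
Local Notation P := (fun y : R => (1 + `|y|) ^+ 3).
Hypothesis iP : integrableR mu P.
Hypothesis mu1 : \int[mu]_y y = 0.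
Hypothesis mu2 : \int[mu]_y (y ^+ 2) = 1.
Hypothesis skew : 0 < \int[mu]_y (y ^+ 3).
Local Notation c := (@qc R).
Local Notation rho := (rho3 mu).
Local Notation m := (tilt_mass mu).
Local Notation ga := (\int[mu]_y (y ^+ 3)).

Lemma selfnorm_tail_split (n : nat) (x : R) : 0 < x -> (0 < n)%N ->
  fine (sumlaw mu n (selfnorm_event x)) <=
  fine (sumlaw mu n (selfnorm_event x `&` [set u | `|u.2 - n%:R| <= n%:R / x])) +
  fine (sumlaw mu n (selfnorm_event x `&` [set u | u.2 < n%:R * (1 - x^-1)])) +
  fine (sumlaw mu n (selfnorm_event x `&` [set u | n%:R * (1 + x^-1) < u.2])).
Proof.
move=> x0 n0.
have mS := measurable_selfnorm_event x.
have m1 : measurable (selfnorm_event x `&` [set u : R * R | `|u.2 - n%:R| <= n%:R / x]).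
  by apply: measurableI => //; apply: measurable_le_set; mfun.
have m2 : measurable (selfnorm_event x `&` [set u : R * R | u.2 < n%:R * (1 - x^-1)]).
  by apply: measurableI => //; apply: measurable_lt_set; mfun.
have m3 : measurable (selfnorm_event x `&` [set u : R * R | n%:R * (1 + x^-1) < u.2]).
  by apply: measurableI => //; apply: measurable_lt_set; mfun.
have fm := @fin_num_measure _ _ _ (sumlaw mu n).
rewrite -fineD ?fm// -fineD ?fm//; last by rewrite fin_numD !fm.
apply: fine_le; rewrite ?fm// ?fin_numD ?fm//.
have m12 := measurableU _ _ m1 m2.
have U12 := @measureU2 _ _ _ (sumlaw mu n) _ _ m1 m2.
have U3 := @measureU2 _ _ _ (sumlaw mu n) _ _ m12 m3.
apply: le_trans (le_trans U3 (leeD2r _ U12)).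
apply: le_measure; rewrite ?inE//; first exact: measurableU.
move=> u Su; have [h1|h1] := ltP u.2 (n%:R * (1 - x^-1)); first by left; right.
have [h2|h2] := ltP (n%:R * (1 + x^-1)) u.2; first by right.
left; left; split=> //=.
by rewrite ler_norml; move: h1 h2; rewrite mulrBr mulrDr !mulr1; lra.
Qed.

(** With [t = ga * x ^+ 3 / (6 * s)], the mass of the tilt gains the factor [1 - t / 2]. The errors
    are [C3 * (x / s)] times the exponential and, for [x] large, at most [t / 4] of the tail, so
    half of the gain survives. *)
Theorem selfnorm_tail_lt : exists x0 e0 c0 : R, [/\ 0 < x0, 0 < e0, 0 < c0 &
  forall (n : nat) x, (0 < n)%N -> x0 <= x -> x ^+ 3 <= e0 * Num.sqrt n%:R ->
    fine (sumlaw mu n (selfnorm_event x)) <=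
    gtail x * (1 - c0 * (x ^+ 3 / Num.sqrt n%:R))].
Proof.
have [b0 b00 mskew] := tilt_mass_skew iP mu1 skew.
have [p0 p00 glb] := @gtail_exp_lb R.
have c1 : 1 <= c by have := @qc_ge R; lra.
have rho1 : 1 <= rho by exact: rho3_ge1.
have cr1 : 1 <= c * rho by rewrite mulr_ege1.
have ga0 := skew.
(* The moderate part, then the low and high sums of squares with weights 1 and 3/2. *)
pose C3 := 214 * (6 * (c * rho)) + 5 / 2 * bad_const mu.
have bad0 : 0 <= bad_const mu.
  rewrite /bad_const mulr_ge0 ?expR_ge0// addr_ge0//; first by rewrite -mulrA; lra.
  by rewrite mulr_ge0 ?sqr_ge0// mulr_ge0 ?sqr_ge0.
have C30 : 0 < C3 by rewrite /C3; lra.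
have q0 : 0 < 24 * (c * rho) by lra.
(* The three terms of the minimum ensure, in turn, the smallness required by [moderate_tilted], the
   range [x / s <= b0] of the skewness estimate, and [t <= 1]. *)
exists (1 + 24 * C3 / (ga * p0)), (Num.min (24 * (c * rho))^-1 (Num.min b0 (6 / ga))), (ga / 24).
have a0 : 0 < 24 * C3 / (ga * p0) by rewrite divr_gt0 ?mulr_gt0.
split; first by lra.
- by rewrite !lt_min invr_gt0 q0 b00 divr_gt0.
- by rewrite divr_gt0.
move=> n x n0 xge xe.
have x1 : 1 <= x by lra.
have x0 : 0 < x by lra.
have xC : 24 * C3 <= ga * p0 * x.
  by rewrite -ler_pdivrMl ?mulr_gt0// mulrC; lra.
set s := Num.sqrt n%:R in xe *.
have n0' : 0 < n%:R :> R by rewrite ltr0n.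
have s0 : 0 < s by rewrite sqrtr_gt0.
have s2 : s ^+ 2 = n%:R by rewrite sqr_sqrtr// ltW.
have x3 : x <= x ^+ 3 by rewrite ler_eXnr.
have bound e1 : Num.min (24 * (c * rho))^-1 (Num.min b0 (6 / ga)) <= e1 -> x ^+ 3 <= e1 * s.
  by move=> h; rewrite (le_trans xe)// ler_wpM2r// ltW.
have xs : 24 * (c * rho) * x ^+ 3 <= s.
  by rewrite -ler_pdivlMl//; apply: bound; rewrite ge_min lexx.
have xb : x <= b0 * s.
  by apply: (le_trans x3); apply: bound; rewrite !ge_min lexx orbT.
have xg : ga * x ^+ 3 <= 6 * s.
  by rewrite -ler_pdivlMl// mulrA [ga^-1 * 6]mulrC; apply: bound; rewrite !ge_min lexx !orbT.
have x30 : 0 <= x ^+ 3 by rewrite exprn_ge0// ltW.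
have xn : x ^+ 3 <= s by have := ler_wpM2r x30 cr1; have := xs; rewrite -mulrA; lra.
have xs' : 4 * c * rho * x <= s.
  have h := ler_wpM2l (le_trans ler01 cr1) x3.
  have h0 := mulr_ge0 (le_trans ler01 cr1) (ltW x0).
  rewrite (_ : 4 * c * rho * x = 4 * (c * rho * x)); last by ring.
  by move: xs; rewrite -mulrA; lra.
have b_gt0 : 0 < x / s by rewrite divr_gt0.
have bb0 : x / s <= b0 by rewrite ler_pdivrMr.
have bs : 4 * c * rho * (x / s) <= 1 by rewrite mulrA ler_pdivrMr// mul1r.
have b1 : x / s <= 1 by rewrite ler_pdivrMr// mul1r (le_trans x3).
have k14 : 1 / 4 <= (1 / 2 : R) <= 1 by lra.
have mge : 1 / 2 <= m (x / s) (1 / 2) by exact: tilt_mass_ge.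
pose t := ga * x ^+ 3 / (6 * s).
have t0 : 0 <= t by rewrite divr_ge0 ?mulr_ge0// ltW.
have t1 : t <= 1 by rewrite /t ler_pdivrMr ?mulr_gt0// mul1r.
have mn : m (x / s) (1 / 2) ^+ n <= 1 - t / 2.
  apply: le_trans (expRN_le1B t0 t1).
  apply: (@le_trans _ _ (expR (- (ga * (x / s) ^+ 3 / 6)) ^+ n)).
    rewrite lerXn2r ?nnegrE ?expR_ge0//; first by lra.
    by apply: le_trans (mskew _ b_gt0 bb0) _; exact: expR_ge1Dx.
  rewrite -expRM_natl ler_expR /t -mulr_natl -s2 le_eqVlt; apply/orP; left; apply/eqP.
  by field; rewrite gt_eqF.
have [k nk] : exists k, n = k.+1 by exists n.-1; rewrite prednK.
have [nu [nuE nuf]] := tilt_exists iP mu1 b_gt0 b1 bs k14.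
have M1 : fine (sumlaw mu n (selfnorm_event x `&` [set u | `|u.2 - n%:R| <= n%:R / x])) <=
  m (x / s) (1 / 2) ^+ n * expR (- (x ^+ 2 / 2)) *
    (exp_step_mean x + 214 * (6 * (c * rho) / s) * x).
  by subst n; exact: (moderate_tilted iP mu1 mu2 s0 s2 x1 xs nuE nuf).
have M2 := bad_low iP mu1 mu2 n0 x1 xn xs'.
have M3 := bad_up iP mu1 mu2 n0 x1 xn xs'.
apply: le_trans (selfnorm_tail_split x0 n0) _.
apply: le_trans (lerD (lerD M1 M2) M3) _; rewrite -/s.
set E := expR (- (x ^+ 2 / 2)).
have E0 : 0 < E by exact: expR_gt0.
have NE : E * exp_step_mean x = gtail x.
  by rewrite /exp_step_mean mulrA -expRD addNr expR0 mul1r.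
set mm := m _ _ ^+ n in mn *.
have g0 := gtail_ge0 x.
have mm1 : mm <= 1 by rewrite (le_trans mn)// gerBl divr_ge0.
have xs0 : 0 <= x / s by rewrite ltW.
have h1 : mm * (E * exp_step_mean x) <= (1 - t / 2) * gtail x.
  by rewrite NE ler_wpM2r.
have h2 : mm * (E * (214 * (6 * (c * rho)) * (x / s))) <= E * (214 * (6 * (c * rho)) * (x / s)).
  apply: ler_piMl mm1; apply: mulr_ge0 (ltW E0) (mulr_ge0 _ xs0).
  exact: mulr_ge0 (ler0n _ 214) (mulr_ge0 (ler0n _ 6) (le_trans ler01 cr1)).
have h3 : E * (C3 * (x / s)) <= t / 4 * gtail x.
  have h := glb x x1; rewrite -/E in h.
  have q1 : 0 <= ga * x ^+ 2 / (24 * s).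
    by rewrite divr_ge0 ?mulr_ge0 ?sqr_ge0// ltW.
  apply: le_trans (_ : _ <= ga * x ^+ 2 / (24 * s) * (x * gtail x)) _; last first.
    rewrite le_eqVlt; apply/orP; left; apply/eqP; rewrite /t; field.
    by rewrite gt_eqF.
  apply: le_trans (ler_wpM2l q1 h).
  have q2 : 0 <= E * x / (24 * s) by rewrite divr_ge0 ?mulr_ge0// ?(ltW E0)// ltW.
  have := ler_wpM2l q2 xC.
  rewrite (_ : E * x / (24 * s) * (24 * C3) = E * (C3 * (x / s))); last first.
    by field; rewrite gt_eqF.
  move/le_trans; apply; rewrite le_eqVlt; apply/orP; left; apply/eqP.
  by field; rewrite gt_eqF.
have -> : gtail x * (1 - ga / 24 * (x ^+ 3 / s)) = (1 - t / 2) * gtail x + t / 4 * gtail x.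
  by rewrite /t; field; rewrite gt_eqF.
have -> : mm * E * (exp_step_mean x + 214 * (6 * (c * rho) / s) * x) +
  E * bad_const mu * (x / s) + 3 / 2 * E * bad_const mu * (x / s) =
  mm * (E * exp_step_mean x) + mm * (E * (214 * (6 * (c * rho)) * (x / s))) +
  5 / 2 * (E * bad_const mu * (x / s)).
  by field; rewrite gt_eqF.
have C3E : E * (C3 * (x / s)) = E * (214 * (6 * (c * rho)) * (x / s)) + 5 / 2 * (E * bad_const mu * (x / s)).
  by rewrite /C3; field; rewrite gt_eqF.
rewrite -addrA; apply: lerD h1 _; apply: le_trans h3.
by rewrite C3E lerD2r.
Qed.

End tail.

(** * Independence of the columns *)

Section independence.
Context d (T : measurableType d) (R : realType) (P : probability T R).
Variables (I : finType) (X : I -> {RV P >-> R}) (mu : probability R R).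
Local Open Scope ereal_scope.

(** An event from the past, independent of the i.i.d. variables indexed by [A]. The product form
    avoids conditioning on [E], which may be null. *)
Definition indep_from (E : set T) (A : {set I}) := measurable E /\
  forall (J : {set I}) (B : I -> set R), J \subset A ->
  (forall i, measurable (B i)) ->
  P (E `&` \bigcap_(i in [set` J]) X i @^-1` B i) = P E * \prod_(i in J) mu (B i).

Let mX (i : I) B : measurable B -> measurable (X i @^-1` B).
Proof. by move=> mB; rewrite -[X in measurable X]setTI; exact: measurable_funP. Qed.

Let mcap (J : {set I}) (B : I -> set R) : (forall i, measurable (B i)) ->
  measurable (\bigcap_(i in [set` J]) X i @^-1` B i).
Proof. by move=> mB; apply: fin_bigcap_measurable => // i _; exact: mX. Qed.

Lemma indep_fromI E A (J : {set I}) B : indep_from E A -> J \subset A ->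
  (forall i, measurable (B i)) ->
  indep_from (E `&` \bigcap_(i in [set` J]) X i @^-1` B i) (A :\: J)%SET.
Proof.
move=> [mE iE] JA mB; split; first by apply: measurableI => //; exact: mcap.
move=> K C KA mC; pose D i := if i \in J then B i else C i.
have dJK : fintype.disjoint (mem J) (mem K).
  rewrite disjoint_sym disjoint_subset; apply/fintype.subsetP => i /(fintype.subsetP KA).
  by rewrite inE => /andP[].
have KA' : K \subset A by rewrite (fintype.subset_trans KA)// finset.subsetDl.
have UA : (J :|: K)%SET \subset A by rewrite finset.subUset JA.
have mD i : measurable (D i) by rewrite /D; case: ifP.
have -> : E `&` \bigcap_(i in [set` J]) X i @^-1` B i `&`
    \bigcap_(i in [set` K]) X i @^-1` C i =
  E `&` \bigcap_(i in [set` (J :|: K)%SET]) X i @^-1` D i.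
  apply/seteqP; split => w.
    move=> [[Ew Bw] Cw]; split=> // i /=; rewrite inE /D => iJK.
    case: ifPn => iJ; first exact: Bw.
    by apply: Cw; move: iJK; rewrite (negbTE iJ).
  move=> [Ew Dw]; split; [split=> //|] => i /= iK.
    by have := Dw i; rewrite /= inE iK /D iK; exact.
  have := Dw i; rewrite /= inE iK orbT /D.
  by rewrite (disjointFl dJK iK); exact.
rewrite iE// iE// -muleA; congr (_ * _).
rewrite (eq_bigl (fun i => (i \in J) || (i \in K))); last by move=> i; rewrite inE.
rewrite bigU//=; congr (_ * _); apply: eq_bigr => i iJ; rewrite /D ?iJ//.
by rewrite (disjointFl dJK iJ).
Qed.

Definition sumpair (s : seq I) (w : T) : R * R :=
  (\sum_(i <- s) X i w, \sum_(i <- s) X i w ^+ 2)%R.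

Lemma measurable_sumpair s : measurable_fun setT (sumpair s).
Proof.
apply/measurable_fun_pairP; split => /=.
  by apply: measurable_sum => i; exact: measurable_funP.
by apply: measurable_sum => i; apply: measurable_funX; exact: measurable_funP.
Qed.

Let msum_pre s C : measurable C -> measurable (sumpair s @^-1` C).
Proof.
by move=> mC; rewrite -[X in measurable X]setTI; exact: measurable_sumpair.
Qed.

(** Restricted to [E], the joint law of [X i] and the sums over the other indices agrees on
    rectangles with [P E] times a product: the event on [X i] joins [E], and induction applies.
    Uniqueness of product measures carries this over to every [C]. *)
Lemma sumpair_indep E A (s : seq I) C : indep_from E A -> uniq s ->
  {subset s <= A} -> measurable C ->
  P (E `&` sumpair s @^-1` C) = P E * sumlaw mu (size s) C.
Proof.
elim: s E A C => [|i s IH] E A C iE /=.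
  move=> _ _ mC; rewrite diracE.
  have [/set_mem C0|C0] := boolP ((0%R, 0%R) \in C).
    rewrite mule1; congr (P _); apply/seteqP; split=> [w []//|w Ew].
    by split=> //; rewrite /sumpair /= !big_nil.
  rewrite mule0 -[RHS](measure0 P); congr (P _); apply/seteqP; split=> // w [_].
  by rewrite /sumpair /= !big_nil => /mem_set; rewrite (negbTE C0).
move=> /andP[i_s us] sA mC.
have iA : i \in A by apply: sA; rewrite mem_head.
have mE := iE.1.
pose Y w := (X i w, sumpair s w).
have mY : measurable_fun setT Y.
  apply/measurable_fun_pairP; split; first exact: measurable_funP.
  exact: measurable_sumpair.
pose mY' : {mfun T >-> (R * (R * R))%type} :=
  HB.pack Y (isMeasurableFun.Build _ _ _ _ Y mY).
have PE0 : (0 <= fine (P E))%R by exact: fine_ge0.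
pose r := NngNum PE0.
have rE : r%:num%:E = P E by rewrite /= fineK// fin_num_measure.
pose m' := pushforward (mrestr P mE) mY'.
have uniq_m := @product_measure_unique _ _ R (R * R)%type R
  (mscale r mu) (sumlaw mu (size s)).
pose D := sum_step @^-1` C.
have mD : measurable D.
  by rewrite -[X in measurable X]setTI; exact: measurable_sum_step.
have E1 : (mscale r mu \x sumlaw mu (size s)) D = m' D.
  apply: uniq_m => // A1 B mA mB.
  have PB : P (E `&` X i @^-1` A1) = P E * mu A1.
    have := iE.2 [set i]%SET (fun=> A1); rewrite finset.sub1set big_set1.
    move=> /(_ iA (fun=> mA)) <-; congr (P (_ `&` _)).
    apply/seteqP; split=> w; last by apply; rewrite /= inE.
    by move=> Aw k /=; rewrite inE => /eqP ->.
  have iB : indep_from (E `&` X i @^-1` A1) (A :\: [set i])%SET.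
    have := indep_fromI (J := [set i]%SET) (B := fun=> A1) iE.
    rewrite finset.sub1set => /(_ iA (fun=> mA)).
    rewrite (_ : \bigcap_(k in [set` [set i]%SET]) X k @^-1` A1 = X i @^-1` A1)//.
    apply/seteqP; split=> w; first by apply; rewrite /= inE.
    by move=> Aw k /=; rewrite inE => /eqP ->.
  have sA' : {subset s <= (A :\ i)%SET}.
    move=> k ks; rewrite !inE sA ?inE ?ks ?orbT// andbT.
    by apply: contraNneq i_s => <-.
  have := IH _ _ B iB us sA' mB; rewrite PB.
  rewrite /= /pushforward /mrestr /mscale rE => <-; congr (P _).
  apply/seteqP; split=> w; rewrite /Y /=; tauto.
(* Uniqueness is used again to pull the scalar [P E] out of the first factor. *)
have E2 : (mscale r mu \x sumlaw mu (size s)) D =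
    mscale r (mu \x sumlaw mu (size s))%E D.
  apply: uniq_m => // A1 B mA mB.
  change (r%:num%:E * (mu \x sumlaw mu (size s)) (A1 `*` B) =
    r%:num%:E * mu A1 * sumlaw mu (size s) B).
  by rewrite product_measure1E// muleA.
transitivity (m' D).
  rewrite /m' /pushforward /mrestr setIC; congr (P (_ `&` _)).
  apply/seteqP; split=> w; rewrite /= /D /= /sum_step /sumpair /= !big_cons.
    by rewrite addrC [X in (_, X)]addrC.
  by rewrite addrC [X in (_, X)]addrC.
by rewrite -E1 E2 /mscale rE.
Qed.

Lemma sumpair_indep_from E A (s : seq I) C : indep_from E A -> uniq s ->
  {subset s <= A} -> measurable C ->
  indep_from (E `&` sumpair s @^-1` C) (A :\: [set i in s])%SET.
Proof.
move=> iE us sA mC; split; first by apply: measurableI; [exact: iE.1|exact: msum_pre].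
move=> J B JA mB.
have JA' : J \subset A by rewrite (fintype.subset_trans JA)// finset.subsetDl.
have iEJ := indep_fromI iE JA' mB.
rewrite setIAC (sumpair_indep iEJ us _ mC); last first.
  move=> i i_s; rewrite inE sA// andbT; apply/negP => /(fintype.subsetP JA).
  by rewrite !inE i_s.
by rewrite iE.2// (sumpair_indep iE us sA mC) muleAC.
Qed.

(** Disjoint groups are treated one at a time, each condition being absorbed into the past event [E]
    before the next group. *)
Lemma sumpairs_indep E A (ss : seq (seq I)) n C : indep_from E A ->
  uniq (flatten ss) -> {subset flatten ss <= A} -> all (fun s => size s == n) ss ->
  measurable C ->
  P (E `&` [set w | all (fun s => `[< C (sumpair s w) >]) ss]) =
  P E * (fine (sumlaw mu n C) ^+ size ss)%:E.
Proof.
elim: ss E A => [|s ss IH] E A iE /=.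
  move=> _ _ _ mC; rewrite expr0 mule1; congr (P _).
  by apply/seteqP; split=> w; [case|].
rewrite cat_uniq => /and3P[us hs uss] sA /andP[/eqP sn ssn] mC.
have sA1 : {subset s <= A} by move=> i i_s; apply: sA; rewrite mem_cat i_s.
have := IH _ _ (sumpair_indep_from iE us sA1 mC) uss _ ssn mC.
rewrite (sumpair_indep iE us sA1 mC) sn exprS EFinM fineK ?fin_num_measure//.
rewrite muleA => <-.
  congr (P _); apply/seteqP; split=> w /=.
    by move=> [Ew /andP[/asboolP ? ?]].
  by move=> [[Ew Cw] h]; split=> //; rewrite h andbT; apply/asboolP.
move=> i iss; rewrite !inE sA ?mem_cat ?iss ?orbT// andbT.
by apply: contraNN hs => i_s; apply/hasP; exists i.
Qed.

End independence.

(** * Asymptotics *)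

Section asymptotics.
Context {R : realType}.

Lemma gtail_antitone (u v : R) : u <= v -> gtail v <= gtail u.
Proof.
move=> uv; have [c _ E] := gtail_mvt uv.
by rewrite -subr_ge0 E mulr_ge0 ?subr_ge0// ltW// pdf_gt0.
Qed.

Lemma gtail_quantile (q : R) : 0 < q -> q <= 1 / 2 -> exists2 x, 0 <= x & gtail x = q.
Proof.
move=> q0 q1; have [v0 hv] := gtail_small q0.
pose v := Num.max v0 0.
have vv : gtail v < q by apply: hv; rewrite le_max lexx.
have v1 : 0 <= v by rewrite le_max lexx orbT.
have ct : {within `[0, v], continuous (@gtail R)}.
  apply: derivable_within_continuous => y _.
  exact: (@ex_derive _ _ _ _ _ _ _ (is_derive_gtail y)).
have [|c ci E] := IVT (v := q) v1 ct.
  by rewrite gtail0 ge_min le_max q1 (ltW vv) orbT.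
by exists c => //; move: ci; rewrite in_itv/= => /andP[].
Qed.

Lemma gtail_quantile_ge (X : R) : exists2 M : R, 0 < M &
  forall x q, M <= q -> gtail x = q^-1 -> X <= x.
Proof.
have X0 : 0 <= Num.max X 0 by rewrite le_max lexx orbT.
have gX : 0 < gtail (Num.max X 0).
  apply: lt_le_trans (gtail_lb X0 ler01).
  by rewrite mul1r pdf_gt0.
exists (2 / gtail (Num.max X 0)); first by rewrite divr_gt0.
move=> x q Mq gx; rewrite leNgt; apply/negP => xX.
have : gtail (Num.max X 0) <= gtail x.
  by apply: gtail_antitone; rewrite le_max (ltW xX).
have q0 : 0 < q by apply: lt_le_trans Mq; rewrite divr_gt0.
rewrite gx -[leRHS]mul1r ler_pdivlMr// => h.
by move: Mq; rewrite ler_pdivrMr// mulrC; lra.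
Qed.

(** As [Ph = 1 - 1/p] is at most 1, [F >= Ph * (1 + kap / p)]; Bernoulli's inequality then gives a
    gap of [Ph ^+ p * kap], and [Ph >= expR (- 2 / p)] for [p >= 2]. *)
Lemma power_gap (p : nat) (kap F : R) : (2 <= p)%N -> 0 <= kap ->
  1 - p%:R^-1 + kap / p%:R <= F ->
  expR (- 2) * kap <= F ^+ p - (1 - p%:R^-1) ^+ p.
Proof.
move=> p2 kap0 hF; have p2' : 2 <= p%:R :> R by rewrite (ler_nat R 2).
have p0 : 0 < p%:R :> R by lra.
pose Ph := 1 - p%:R^-1 : R.
have q0 : 0 < p%:R^-1 :> R by rewrite invr_gt0.
have q2 : p%:R^-1 <= 1 / 2 :> R by rewrite div1r lef_pV2 ?posrE.
have Ph0 : 0 < Ph by rewrite /Ph; lra.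
have Ph1 : Ph <= 1 by rewrite /Ph; lra.
have PhE : expR (- 2) <= Ph ^+ p.
  have := @expRN_le1B R (2 * p%:R^-1) _ _.
  rewrite (_ : 1 - 2 * p%:R^-1 / 2 = Ph); last by rewrite /Ph; field; rewrite gt_eqF.
  move=> /(_ ltac:(lra) ltac:(lra)) h.
  rewrite (_ : - 2 = p%:R * (- (2 * p%:R^-1))); last by field; rewrite gt_eqF.
  by rewrite expRM_natl lerXn2r ?nnegrE ?expR_ge0// ltW.
have h1 : (Ph * (1 + kap / p%:R)) ^+ p <= F ^+ p.
  have k0 : 0 <= kap / p%:R by rewrite divr_ge0// ltW.
  have le1 : Ph * (1 + kap / p%:R) <= F.
    by apply: le_trans hF; rewrite mulrDr mulr1 lerD2l ler_piMl.
  have ge0 := mulr_ge0 (ltW Ph0) (addr_ge0 ler01 k0).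
  by rewrite lerXn2r ?nnegrE// (le_trans ge0).
have h2 : 1 + kap <= (1 + kap / p%:R) ^+ p.
  have bern (t : R) j : 0 <= t -> 1 + j%:R * t <= (1 + t) ^+ j.
    move=> t0; elim: j => [|j IH]; first by rewrite mul0r addr0 expr0.
    rewrite exprS -natr1; have := ler_wpM2l (addr_ge0 ler01 t0) IH.
    by have := mulr_ge0 (ler0n R j) (sqr_ge0 t); rewrite expr2; lra.
  have := bern (kap / p%:R) p; rewrite mulrCA divff ?mulr1 ?gt_eqF//.
  by apply; rewrite divr_ge0// ltW.
rewrite exprMn in h1.
have := ler_wpM2l (ltW (exprn_gt0 p Ph0)) h2.
have := ler_wpM2r kap0 PhE.
rewrite -/Ph; lra.
Qed.

Lemma limn_einf_ge (u : nat -> \bar R) (K : \bar R) (N : nat) :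
  (forall n, (N <= n)%N -> (K <= u n)%E) -> (K <= limn_einf u)%E.
Proof.
move=> h; rewrite limn_einf_lim; apply: lime_ge; first exact: is_cvg_einfs.
near=> n; apply: le_ereal_inf_tmp => _ [k /= nk <-]; apply: h.
apply: leq_trans nk; near: n; exact: nbhs_infty_ge.
Unshelve. all: by end_near.
Qed.

(** The exponential lower bound on the tail gives [p <= x * expR (x ^+ 2 / 2) / p0], at most
    [expR (x ^+ 2)] for large [x]; Mills' bound gives [expR (x ^+ 2 / 2) <= p] once [x] exceeds the
    peak of the density. *)
Lemma quantile_log_bounds : exists2 x1 : R, 0 < x1 & forall x (p : R),
  x1 <= x -> 0 < p -> gtail x = p^-1 -> ln p <= x ^+ 2 /\ x ^+ 2 <= 2 * ln p.
Proof.
have [p0 p00 glb] := @gtail_exp_lb R.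
have pk0 : 0 < normal_peak (1 : R) by rewrite normal_peak_gt0// oner_eq0.
exists (1 + 2 / p0 + normal_peak 1).
  by rewrite addr_gt0// addr_gt0// divr_gt0.
move=> x p xx p_gt0 gx.
have h2 : 0 < 2 / p0 by rewrite divr_gt0.
have x1 : 1 <= x by lra.
have x0 : 0 < x by lra.
split.
  rewrite -(expRK (x ^+ 2)) ler_ln ?posrE ?expR_gt0//.
  have h := glb x x1; rewrite gx in h.
  have e2 : 0 < expR (- (x ^+ 2 / 2)) by exact: expR_gt0.
  have ee : expR (- (x ^+ 2 / 2)) * expR (x ^+ 2) = expR (x ^+ 2 / 2).
    by rewrite -expRD; congr expR; field.
  have h3 : x <= p0 * expR (x ^+ 2 / 2).
    apply: le_trans (ler_wpM2l (ltW p00) (expR_ge1Dx _)).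
    have h4 : 2 <= p0 * x by rewrite -ler_pdivrMl// mulrC; lra.
    nra.
  have h5 : p0 * expR (- (x ^+ 2 / 2)) * p <= x by rewrite -ler_pdivlMr.
  rewrite -(ler_pM2l (mulr_gt0 p00 e2)) (le_trans h5)//.
  by rewrite -mulrA ee.
have h := gtail_mills (ltW x0); rewrite gx pdfE in h.
have e2 : 0 < expR (x ^+ 2 / 2) by exact: expR_gt0.
have h3 : expR (x ^+ 2 / 2) <= p.
  have ee : expR (- x ^+ 2 / 2) * expR (x ^+ 2 / 2) = 1.
    by rewrite mulNr -expRD addNr expR0.
  have h4 : normal_peak 1 <= x by lra.
  have h5 : x <= normal_peak 1 * expR (- x ^+ 2 / 2) * p by rewrite -ler_pdivrMr.
  have h6 : x * expR (x ^+ 2 / 2) <= normal_peak 1 * p.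
    apply: le_trans (ler_wpM2r (ltW e2) h5) _.
    rewrite (_ : _ * expR (x ^+ 2 / 2) =
      normal_peak 1 * p * (expR (- x ^+ 2 / 2) * expR (x ^+ 2 / 2))); last by ring.
    by rewrite ee mulr1.
  by rewrite -(ler_pM2l x0) (le_trans h6)// ler_wpM2r// ltW.
have := h3; rewrite -ler_ln ?posrE// expRK.
lra.
Qed.

End asymptotics.

Section growth.
Context {R : realType}.
Variable p : nat -> nat.
Hypothesis p_gt0 : forall n, (0 < p n)%N.

Let p1 n : 1 <= (p n)%:R :> R. Proof. by rewrite ler1n. Qed.
Let ln_ge0' n : 0 <= ln (p n)%:R :> R. Proof. exact: ln_ge0. Qed.

(** Since [ln p <= p], the right-hand sequence is at most [p ^+ 3], which therefore eventually
    dominates [sqrt n]. *)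
Lemma p_unbounded :
  (fun n => Num.sqrt n%:R : R) =o_\oo
    (fun n => (p n)%:R * ln (p n)%:R `^ (3 / 2) : R) ->
  forall M : R, \forall n \near \oo, M <= (p n)%:R.
Proof.
move=> /eqoP h M; have := h 1 ltr01.
move=> hn; near=> n.
have H : `|Num.sqrt n%:R : R| <= 1 * `|(p n)%:R * ln (p n)%:R `^ (3 / 2) : R|.
  by near: n.
have sM : M ^+ 3 <= Num.sqrt (n%:R : R).
  have : (M ^+ 3) ^+ 2 <= n%:R by near: n; exact: nbhs_infty_ger.
  move=> h2; rewrite (le_trans (ler_norm _))// -sqrtr_sqr ler_wsqrtr//.
have lnp : ln (p n)%:R `^ (3 / 2) <= (p n)%:R ^+ 2 :> R.
  have lp : ln (p n)%:R <= (p n)%:R :> R.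
    by have := @le_ln1Dx R ((p n)%:R - 1); rewrite subrKC => /(_ _)/le_trans; apply; have := p1 n; lra.
  apply: (@le_trans _ _ ((p n)%:R `^ (3 / 2))).
    by apply: ge0_ler_powR; rewrite ?nnegrE ?divr_ge0.
  rewrite -powR_mulrn//; apply: ler_powR => //.
  by lra.
have Mp : M ^+ 3 <= (p n)%:R ^+ 3.
  apply: le_trans sM _; move: H; rewrite mul1r ger0_norm// ger0_norm ?mulr_ge0 ?powR_ge0//.
  by move=> /le_trans; apply; rewrite [leRHS]exprS ler_wpM2l.
rewrite leNgt; apply/negP => pM; move: Mp; apply/negP; rewrite -ltNge.
by rewrite ltrXn2r.
Unshelve. all: by end_near.
Qed.

(** Shaped for [x ^+ 2 <= 2 * ln p], which turns it into the square of [x ^+ 3 <= e * sqrt n]. *)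
Lemma ln_p_cube_small :
  (fun n => ln (p n)%:R : R) =o_\oo (fun n => n%:R `^ (1 / 3) : R) ->
  forall e : R, 0 < e -> \forall n \near \oo, (2 * ln (p n)%:R) ^+ 3 <= e ^+ 2 * n%:R :> R.
Proof.
move=> /eqoP h e e0.
pose d := Num.min 1 (e ^+ 2 / 8).
have d0 : 0 < d by rewrite lt_min ltr01 divr_gt0// exprn_gt0.
have hn := h d d0; near=> n.
have H : `|ln (p n)%:R : R| <= d * `|n%:R `^ (1 / 3) : R| by near: n.
move: H; rewrite ger0_norm// ger0_norm ?powR_ge0// => H.
have d1 : d <= 1 by rewrite ge_min lexx.
have d2 : d <= e ^+ 2 / 8 by rewrite ge_min lexx orbT.
have d3 : d ^+ 3 <= e ^+ 2 / 8.
  by apply: le_trans d2; rewrite ler_iXnr// ltW.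
have n3 : (n%:R `^ (1 / 3)) ^+ 3 = n%:R :> R.
  by rewrite -powR_mulrn ?powR_ge0// -powRrM mul1r mulVf// powRr1.
have : (ln (p n)%:R) ^+ 3 <= (d * n%:R `^ (1 / 3)) ^+ 3 :> R.
  by rewrite lerXn2r ?nnegrE ?mulr_ge0 ?powR_ge0// ltW.
rewrite [leRHS]exprMn n3 => H3.
rewrite exprMn; have n0 : 0 <= n%:R :> R by [].
have := ler_wpM2r n0 d3.
have -> : 2 ^+ 3 = 8 :> R by ring.
lra.
Unshelve. all: by end_near.
Qed.

End growth.

(** * From random variables to laws on the line, and the laws of the two maxima *)

Section transfer.
Context {R : realType}.

Let idTR (y : measurableTypeR R) : R := y.
Let measurable_idTR : measurable_fun setT idTR.
Proof. by move=> _ B mB; rewrite setTI. Qed.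
HB.instance Definition _ := isMeasurableFun.Build _ _ _ _ idTR measurable_idTR.

(* [mu] lives on an alias of [R] whose measurable structure has another display. *)
Definition real_law (mu : probability (measurableTypeR R) R) : probability R R :=
  distribution mu idTR.

Variable mu : probability (measurableTypeR R) R.
Local Notation nu := (real_law mu).

Section law.
Context d (T : measurableType d) (P : probability T R).

Lemma real_law_integral (X : {RV P >-> R}) (f : R -> R) : has_law X mu ->
  measurable_fun setT f ->
  (forall y, 0 <= f y) \/ P.-integrable setT (EFin \o (f \o X)) ->
  (\int[nu]_y (f y)%:E = \int[P]_w (f (X w))%:E)%E.
Proof.
move=> Xmu mf cond.
rewrite (@eq_measure_integral _ _ _ setT (distribution P X) nu); last first.
  by move=> A mA _; exact/esym/Xmu.
have mfE : measurable_fun setT (fun y => (f y)%:E) by mfun.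
case: cond => h.
  by rewrite ge0_integral_distribution// => y; rewrite lee_fin.
by rewrite integral_distribution.
Qed.

Lemma real_law_moments (X : {RV P >-> R}) : has_law X mu ->
  ('E_P[X] = 0)%E -> ('E_P[fun w => (X w ^+ 2)%R] = 1)%E ->
  ('E_P[fun w => (`|X w| ^+ 3)%R] < +oo)%E ->
  (0 < 'E_P[fun w => (X w ^+ 3)%R])%E ->
  [/\ integrableR nu (fun y : R => (1 + `|y|) ^+ 3), \int[nu]_y y = 0,
    \int[nu]_y (y ^+ 2) = 1 & 0 < \int[nu]_y (y ^+ 3)].
Proof.
move=> Xmu; rewrite !unlock => E1 E2 E3 E3'.
have mX : measurable_fun setT X by exact: measurable_funP.
have i3 : integrableR nu (fun y : R => `|y| ^+ 3).
  apply/integrableP; split; first by mfun.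
  under eq_integral do rewrite /= ger0_norm ?exprn_ge0//.
  rewrite (real_law_integral (f := fun y => `|y| ^+ 3) Xmu)//; first by mfun.
  by left => y; rewrite exprn_ge0.
have iP : integrableR nu (fun y : R => (1 + `|y|) ^+ 3).
  apply: integrableR_le (integrableRZ 4 (integrableRD (integrableR_cst nu 1) i3)) _.
    by mfun.
  move=> y; rewrite ger0_norm ?exprn_ge0 ?addr_ge0//.
  have := normr_ge0 y; set a := `|y| => a0.
  have : 0 <= (a - 1) ^+ 2 * (a + 1) by rewrite mulr_ge0 ?sqr_ge0 ?addr_ge0.
  by rewrite !exprS expr0 !mulr1; nra.
have iX3 : integrableR P (fun w => (1 + `|X w|) ^+ 3).
  apply/integrableP; split; first by mfun.
  under eq_integral do rewrite /= ger0_norm ?exprn_ge0 ?addr_ge0//.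
  rewrite -(real_law_integral (f := fun y => (1 + `|y|) ^+ 3) Xmu); last 2 first.
  - by mfun.
  - by left => y; rewrite exprn_ge0 ?addr_ge0.
  by rewrite -EFin_Rintegral// ltry.
have le3 (f : R -> R) : measurable_fun setT f -> (forall y, `|f y| <= (1 + `|y|) ^+ 3) ->
    (\int[nu]_y (f y)%:E = \int[P]_w (f (X w))%:E)%E.
  move=> mf hf; apply: real_law_integral => //; right.
  have : integrableR P (fun w => f (X w)).
    by apply: integrableR_le iX3 _ => //; exact: measurableT_comp mX.
  exact.
split=> //.
- rewrite /Rintegral (le3 (fun y => y)) ?E1//.
  by move=> y; have := normr_ge0 y; set a := `|y| => a0; rewrite !exprS expr0; nra.
- have m2 : measurable_fun setT (fun y : R => y ^+ 2) by mfun.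
  rewrite /Rintegral (le3 _ m2) ?E2// => y.
  by rewrite normrX; have := normr_ge0 y; set a := `|y| => a0; rewrite !exprS expr0; nra.
- have m3 : measurable_fun setT (fun y : R => y ^+ 3) by mfun.
  have b3 (y : R) : `|y ^+ 3| <= (1 + `|y|) ^+ 3.
    by rewrite normrX lerXn2r ?nnegrE ?addr_ge0// lerDr.
  rewrite -lte_fin EFin_Rintegral; last first.
    by apply: integrableR_le iP _ => // y; rewrite b3.
  by rewrite (le3 _ m3 b3).
Qed.

Lemma iid_indep_from (I : finType) (X : I -> {RV P >-> R}) : iid_with_law X mu ->
  indep_from X nu setT [set: I].
Proof.
move=> [ind Xmu]; split=> // J B _ mB; rewrite setTI probability_setT mul1e ind//.
by apply: eq_bigr => i _; exact: (Xmu i (B i) (mB i)).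
Qed.

Definition selfnorm_below (t : R) : set (R * R) := [set u | u.1 / Num.sqrt u.2 <= t].

Lemma measurable_selfnorm_below t : 0 <= t -> measurable (selfnorm_below t).
Proof.
move=> t0; have ms : measurable_fun setT (fun u : R * R => Num.sqrt u.2).
  by apply: measurableT_comp; [exact: measurable_sqrt|exact: measurable_snd].
(* Where the root vanishes the quotient is 0 by convention, and [0 <= t]. *)
have -> : selfnorm_below t =
    [set u | Num.sqrt u.2 <= 0] `|` [set u | u.1 <= t * Num.sqrt u.2].
  apply/seteqP; split=> -[s v]; rewrite /selfnorm_below /=.
    have [v0|v0] := leP (Num.sqrt v) 0; first by left.
    by rewrite ler_pdivrMr//; right.
  have [v0|v0] := leP (Num.sqrt v) 0; last by rewrite ler_pdivrMr//; case.
  move=> _; have -> : Num.sqrt v = 0 by apply/eqP; rewrite eq_le v0 sqrtr_ge0.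
  by rewrite invr0 mulr0.
by apply: measurableU; apply: measurable_le_set; mfun.
Qed.

Lemma selfnorm_max_law n p (X : 'I_n -> 'I_p -> {RV P >-> R}) t :
  0 <= t ->
  iid_with_law (fun ij : 'I_n * 'I_p => X ij.1 ij.2) mu ->
  P ((fun w => self_normalized_sum (fun i j => X i j w)) @^-1`
    [set x : 'rV[R]_p | forall j, x 0 j <= t]) =
  (fine (sumlaw nu n (selfnorm_below t)) ^+ p)%:E.
Proof.
move=> t0 Xiid; have iT := iid_indep_from Xiid.
(* One group of indices per column; the columns use disjoint entries. *)
pose ss := [seq [seq (i, j) | i <- enum 'I_n] | j <- enum 'I_p].
have := sumpairs_indep (ss := ss) (n := n) iT _ _ _ (measurable_selfnorm_below t0).
rewrite size_map size_enum_ord probability_setT mul1e setTI => <-.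
- congr (P _); apply/seteqP; split => w /=.
    move=> h; apply/allP => s /mapP[j _ ->]; apply/asboolP.
    have := h j; rewrite mxE /selfnorm_below /sumpair /=.
    by rewrite !big_map.
  move=> /allP h j; have /asboolP := h _ (map_f (fun j => [seq (i, j) | i <- enum 'I_n]) (mem_enum _ j)).
  by rewrite mxE /selfnorm_below /sumpair /= !big_map.
- apply: (@allpairs_uniq _ _ _ (fun j i => (i, j)) (enum 'I_p) (enum 'I_n)).
  + exact: enum_uniq.
  + exact: enum_uniq.
  + by move=> [? ?] [? ?] _ _ /= [-> ->].
- by move=> x _; rewrite inE.
- by apply/allP => s /mapP[j _ ->]; rewrite size_map size_enum_ord.
Qed.

End law.

(** An inclusion of sets is enough: outside [selfnorm_event] either the root vanishes and the
    quotient is 0, or the root can be divided out. *)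
Lemma sumlaw_below_ge n t : 0 <= t ->
  1 - fine (sumlaw nu n (selfnorm_event t)) <= fine (sumlaw nu n (selfnorm_below t)).
Proof.
move=> t0; have mB := measurable_selfnorm_below t0.
have mS := measurable_selfnorm_event t.
have -> : 1 - fine (sumlaw nu n (selfnorm_event t)) =
    fine (sumlaw nu n (~` selfnorm_event t)).
  by rewrite probability_setC// fineB// fin_num_measure.
apply: fine_le; rewrite ?fin_num_measure//; first exact: measurableC.
apply: le_measure; rewrite ?inE//; first exact: measurableC.
move=> [s v]; rewrite /selfnorm_event /selfnorm_below /= => /negP; rewrite -leNgt => h.
have [v0|v0] := eqVneq (Num.sqrt v) 0; first by rewrite v0 invr0 mulr0.
by rewrite ler_pdivrMr// lt0r v0 sqrtr_ge0.
Qed.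

Lemma gaussian_max_law d (T : measurableType d) (Q : probability T R) p
    (Z : 'I_p -> {RV Q >-> R}) t : standard_gaussian_vector Z ->
  Q ((fun w => \row_j Z j w) @^-1` [set x : 'rV[R]_p | forall j, x 0 j <= t]) =
  (gcdf t ^+ p)%:E.
Proof.
move=> [ind Zmu]; have := ind [set: 'I_p]%SET (fun=> [set` `]-oo, t]]).
move=> /(_ (fun=> measurable_itv _)).
set A := \bigcap_(i in _) _; set B := _ @^-1` _ => E.
have -> : B = A.
  apply/seteqP; split => w /=.
    by move=> h j _; have := h j; rewrite mxE /= in_itv.
  by move=> h j; have := h j; rewrite mxE /= in_itv/=; apply; rewrite inE.
rewrite E (eq_bigr (fun=> (gcdf t)%:E)); last first.
  move=> j _; rewrite [LHS](Zmu j _ (measurable_itv _)).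
  by rewrite /gcdf fineK// fin_num_measure.
by rewrite prodEFin prodr_const cardsT card_ord.
Qed.

End transfer.

Theorem proposition4p1
  (R : realType)
  (p : nat -> nat) (p_gt0 : forall n, (0 < p n)%N)
  (d : nat -> measure_display) (Omega : forall n, measurableType (d n))
  (P : forall n, probability (Omega n) R)
  (X : forall n, 'I_n -> 'I_(p n) -> {RV (P n) >-> R})
  (mu : probability (measurableTypeR R) R)
  (X_iid : forall n,
     iid_with_law (fun ij : 'I_n * 'I_(p n) => X n ij.1 ij.2) mu)
  (X_mean : forall n i j, ('E_(P n)[X n i j] = 0)%E)
  (X_var : forall n i j, ('E_(P n)[fun w => (X n i j w ^+ 2)%R] = 1)%E)
  (X_abs3 : forall n i j, ('E_(P n)[fun w => (`|X n i j w| ^+ 3)%R] < +oo)%E)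
  (X_skew : forall n i j, (0 < 'E_(P n)[fun w => (X n i j w ^+ 3)%R])%E)
  (d' : nat -> measure_display) (Omega' : forall n, measurableType (d' n))
  (Q : forall n, probability (Omega' n) R)
  (Z : forall n, 'I_(p n) -> {RV (Q n) >-> R})
  (Z_gauss : forall n, standard_gaussian_vector (@Z n))
  (log_p_small :
     (fun n => ln (p n)%:R : R) =o_\oo (fun n => n%:R `^ (1 / 3) : R))
  (p_large :
     (fun n => Num.sqrt n%:R : R) =o_\oo
     (fun n => (p n)%:R * ln (p n)%:R `^ (3 / 2) : R)) :
  let T n (w : Omega n) := self_normalized_sum (fun i j => X n i j w) in
  let tau n :=
    sup_distance (@Amax R (p n)) (P n) (T n)
      (Q n) (fun w => \row_j Z n j w) in
  (0 < limn_einf (fun n =>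
         (Num.sqrt (n%:R / ln (p n)%:R ^+ 3))%:E * tau n))%E.
Proof.
pose T n (w : Omega n) := self_normalized_sum (fun i j => X n i j w).
pose tau n := sup_distance (@Amax R (p n)) (P n) (T n)
  (Q n) (fun w => \row_j Z n j w).
change (0 < limn_einf (fun n =>
  (Num.sqrt (n%:R / ln (p n)%:R ^+ 3))%:E * tau n))%E.
(* The law does not depend on [n], so its moments are read off an entry at [n = 1]; there is none at
   [n = 0]. *)
pose j0 : 'I_(p 1) := Ordinal (p_gt0 1).
have [iP mu1 mu2 skew] := real_law_moments ((X_iid 1%N).2 (ord0, j0)) (X_mean 1%N ord0 j0)
  (X_var 1%N ord0 j0) (X_abs3 1%N ord0 j0) (X_skew 1%N ord0 j0).
have [xa [e0 [c0 [xa0 e00 c00 tail]]]] := selfnorm_tail_lt iP mu1 mu2 skew.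
have [xb xb0 logb] := @quantile_log_bounds R.
(* Quantiles beyond this sum exceed both thresholds, of the tail bound and of the logarithmic
   comparison. *)
have [M M0 largeM] := @gtail_quantile_ge R (1 + xa + xb).
pose K : R := expR (- 2) * c0.
have K0 : 0 < K by rewrite mulr_gt0 ?expR_gt0.
have [N _ HN] : \forall n \near \oo, [/\ (0 < n)%N, M <= (p n)%:R, 2 <= (p n)%:R :> R &
    (2 * ln (p n)%:R) ^+ 3 <= e0 ^+ 2 * n%:R :> R].
  have h1 := p_unbounded p_gt0 p_large M.
  have h2 := p_unbounded p_gt0 p_large 2.
  have h3 := ln_p_cube_small p_gt0 log_p_small e00.
  by near=> n; split; near: n => //; exact: nbhs_infty_gt.
apply: (@lt_le_trans _ _ K%:E); first by rewrite lte_fin.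
apply: (limn_einf_ge (N := N)) => n /HN/= [n0 Mp p2 Lsmall].
have p2' : (2 <= p n)%N by rewrite -(ler_nat R).
have pn0 : 0 < (p n)%:R :> R by lra.
have [x x0 gx] : exists2 x, 0 <= x & gtail x = (p n)%:R^-1 :> R.
  by apply: gtail_quantile; rewrite ?invr_gt0// div1r lef_pV2 ?posrE.
have xX : 1 + xa + xb <= x by exact: largeM Mp gx.
have [L1 L2] : ln (p n)%:R <= x ^+ 2 /\ x ^+ 2 <= 2 * ln (p n)%:R.
  by apply: logb => //; lra.
have n0' : 0 < n%:R :> R by rewrite ltr0n.
have sn0 : 0 < Num.sqrt (n%:R : R) by rewrite sqrtr_gt0.
have L0 : 0 < ln (p n)%:R :> R by apply: ln_gt0; lra.
have x3 : x ^+ 3 <= e0 * Num.sqrt n%:R.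
  have : (x ^+ 3) ^+ 2 <= (e0 * Num.sqrt n%:R) ^+ 2.
    rewrite [leRHS]exprMn sqr_sqrtr ?(ltW n0')//; apply: le_trans Lsmall.
    by rewrite -exprM mulnC exprM lerXn2r ?nnegrE ?sqr_ge0// mulr_ge0// ltW.
  by rewrite ler_sqr ?nnegrE ?exprn_ge0// mulr_ge0 ?(ltW e00)// ltW.
have xa1 : xa <= x by lra.
have F1 := tail n x n0 xa1 x3.
set kap := c0 * (x ^+ 3 / Num.sqrt n%:R) in F1.
have kap0 : 0 <= kap by rewrite mulr_ge0 ?(ltW c00)// divr_ge0 ?exprn_ge0// ltW.
pose F := fine (sumlaw (real_law mu) n (selfnorm_below x)).
have FF : 1 - (p n)%:R^-1 + kap / (p n)%:R <= F.
  apply: le_trans (sumlaw_below_ge mu n x0).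
  by move: F1; rewrite gx mulrBr mulr1 [_^-1 * kap]mulrC; lra.
have gap := power_gap p2' kap0 FF.
have tau_ge : ((expR (- 2) * kap)%:E <= tau n)%E.
  (* A single set, the orthant at the quantile, already witnesses the lower bound. *)
  pose A := [set y : 'rV[R]_(p n) | forall j, y 0 j <= x].
  apply: (@le_trans _ _ (`|P n (T n @^-1` A) -
      Q n ((fun w => \row_j Z n j w) @^-1` A)|)%E); last first.
    by apply: ereal_sup_ubound; exists A => //; exists x.
  rewrite (selfnorm_max_law x0 (X_iid n)) (gaussian_max_law x (Z_gauss n)).
  rewrite -EFinB -/F abse_EFin lee_fin (le_trans gap)// (le_trans _ (ler_norm _))//.
  by rewrite [gcdf x](_ : _ = 1 - (p n)%:R^-1)// -gx gtailE opprB addrC subrK.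
set s := Num.sqrt (n%:R / _).
have s0 : 0 <= s by exact: sqrtr_ge0.
apply: le_trans (lee_wpmul2l _ tau_ge); last by rewrite lee_fin.
rewrite -EFinM lee_fin /K /kap.
have -> : s * (expR (-2) * (c0 * (x ^+ 3 / Num.sqrt n%:R))) =
    expR (-2) * c0 * (s * (x ^+ 3 / Num.sqrt n%:R)) by ring.
(* The factors [sqrt n] cancel, leaving [x ^+ 3 / sqrt (ln p ^+ 3)], at least 1 because
   [ln p <= x ^+ 2]. *)
rewrite ler_peMr ?(ltW K0)// /s sqrtrM ?(ltW n0')//.
have L30 : 0 < ln (p n)%:R ^+ 3 :> R by rewrite exprn_gt0.
have sL0 : 0 < Num.sqrt (ln (p n)%:R ^+ 3 : R) by rewrite sqrtr_gt0.
rewrite sqrtrV ?(ltW L30)//.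
rewrite (_ : _ * (x ^+ 3 / _) = x ^+ 3 / Num.sqrt (ln (p n)%:R ^+ 3)); last first.
  by field; rewrite !gt_eqF.
rewrite ler_pdivlMr// mul1r -[leRHS]ger0_norm ?exprn_ge0// -sqrtr_sqr ler_wsqrtr//.
by rewrite -exprM mulnC exprM lerXn2r ?nnegrE ?sqr_ge0// ltW.
Unshelve. all: by end_near.
Qed.
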